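(* Let $G$ be a finitely generated group which is hyperbolic relative to finitely generated one-ended subgroups $H_1,\dots,H_n$. Let $\mathcal{E}$ be the class of infinite elementary subgroups of $G$ and let $\sim$ be co-elementarity. Let $T$ be a tree with infinite elementary edge stabilizers (the $H_i$'s are not assumed to be elliptic in $T$). Let $T_c$ and $T_c^*$ be its tree of cylinders and collapsed tree of cylinders. Then: 1. Edge stabilizers of $T_c$ are infinite elementary, so $T_c^*=T_c$. 2. $T$ and $T_c$ have the same non-elementary vertex stabilizers. A subgroup is elliptic in $T_c$ if and only if it is elliptic in $T$, or parabolic. In particular, $T_c$ is in the same deformation space as $T$ if and only if every parabolic subgroup is elliptic in $T$. 3. $T_c$ is almost $2$-acylindrical. If the $H_i$'s are small, then $T_c$ dominates any almost acylindrical tree $T'$ which is dominated by $T$.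
   Context: A subgroup of $G$ is parabolic if it is contained in a conjugate of some $H_i$, and elementary if it is finite, two-ended, or parabolic. For infinite elementary subgroups $A,B$, $A\sim B$ (co-elementarity) iff $\langle A,B\rangle$ is elementary. A group is small if it has no non-abelian free subgroups. A tree is a simplicial tree with an action of $G$ without inversions; $G_e$ is the stabilizer of an edge $e$. A subgroup is elliptic in a tree if it fixes a point. $T$ dominates $T'$ if there is a $G$-equivariant map $T\to T'$, equivalently if every subgroup elliptic in $T$ is elliptic in $T'$. Two trees are in the same deformation space if they have the same elliptic subgroups. A tree is almost $k$-acylindrical if the (pointwise) stabilizer of any segment of length $>k$ is finite, and almost acylindrical if this holds for some $k$. Tree of cylinders. Declare two edges $e,e'$ of $T$ equivalent if $G_e\sim G_{e'}$. A cylinder of $T$ is an equivalence class $Y$ of edges, identified with the union of its edges; cylinders are subtrees of $T$ and two distinct cylinders meet in at most one point. $T_c$ is the bipartite tree with vertex set $V_0(T_c)\sqcup V_1(T_c)$, where $V_0(T_c)$ is the set of vertices of $T$ belonging to at least two distinct cylinders, $V_1(T_c)$ is the set of cylinders of $T$, and there is an edge $(x,Y)$ between $x\in V_0(T_c)$ and $Y\in V_1(T_c)$ if and only if $x\in Y$. It carries the induced $G$-action. If $T$ is a single point, $T_c$ is understood to be a point. $T_c^*$ is obtained from $T_c$ by collapsing all edges whose stabilizer is not in $\mathcal{E}$. *)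

(* Defs.v *)
From Stdlib Require Import Relation_Operators List.
From mathcomp Require Import all_boot.
From mathcomp Require Import boolp classical_sets functions cardinality.

Set Implicit Arguments.
Unset Strict Implicit.
Unset Printing Implicit Defensive.

Local Open Scope classical_set_scope.
Local Open Scope group_scope.

(* Graphs are simple graphs given by a (symmetric, irreflexive) adjacency
   relation on a type of vertices; all metric notions are combinatorial and
   only involve vertices. *)
Section Graphs.
Variables (V : Type) (adj : V -> V -> Prop).

(* [walk x p y]: the sequence x :: p is an edge path from x to y; its length is
   [size p]. *)
Fixpoint walk (x : V) (p : seq V) (y : V) : Prop :=
  if p is z :: q then adj x z /\ walk z q y else x = y.

Definition connected_graph := forall x y : V, exists p, walk x p y.

(* x :: p is a closed path with pairwise distinct vertices p, the last of
   which is x; size at least 3 excludes backtracking along an edge. *)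
Definition circuit (x : V) (p : seq V) :=
  [/\ walk x p x, NoDup p & (2 < size p)%N].

Definition geodesic (x : V) (p : seq V) (y : V) :=
  walk x p y /\ forall q, walk x q y -> (size p <= size q)%N.

(* Gromov hyperbolicity: uniformly thin geodesic triangles. *)
Definition hyperbolic_graph :=
  exists d : nat, forall x y z p q r,
    geodesic x p y -> geodesic y q z -> geodesic x r z ->
    forall u, In u (x :: p) ->
    exists w s, [/\ In w (y :: q) \/ In w (x :: r), walk u s w
                  & (size s <= d)%N].

(* Bowditch: every edge lies in finitely many circuits of each length. *)
Definition fine_graph :=
  forall (x y : V) (n : nat), adj x y ->
    finite_set [set p | circuit x (y :: p) /\ size (y :: p) = n].

(* Being joined by an edge path disjoint from K (or equal). *)
Definition conn_off (K : set V) : V -> V -> Prop :=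
  clos_refl_trans V (fun x y => [/\ adj x y, ~ K x & ~ K y]).

(* Some finite set of vertices has at least k infinite complementary
   components. *)
Definition ends_ge (k : nat) :=
  exists K : set V, finite_set K /\
  exists f : 'I_k -> V,
    (forall i, ~ K (f i) /\ infinite_set [set y | conn_off K (f i) y]) /\
    (forall i j, conn_off K (f i) (f j) -> i = j).

End Graphs.

Section Subgroups.
Variable G : groupType.
Implicit Types (A B S : set G) (g x y : G).

Definition subgroup A :=
  [/\ A 1, forall x y, A x -> A y -> A (x * y) & forall x, A x -> A x^-1].

Definition gen S : set G := smallest subgroup S.

Definition finitely_generated A := exists2 S, finite_set S & gen S = A.

(* g^-1 A g; recall that x ^ g = g^-1 * (x * g). *)
Definition conjs A g : set G := [set x ^ g | x in A].

(* The Cayley graph of A with respect to S, as a graph on G in which the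
   elements outside A are isolated vertices (which do not contribute to the
   number of ends). *)
Definition cayley A S x y :=
  [/\ A x, A y, x <> y & exists2 s, S s & y = x * s \/ x = y * s].

(* A is finitely generated and has exactly k ends. *)
Definition has_ends A (k : nat) :=
  exists S, [/\ finite_set S, gen S = A,
    ends_ge (cayley A S) k & ~ ends_ge (cayley A S) k.+1].

Definition one_ended A := has_ends A 1.
Definition two_ended A := has_ends A 2.

(* A letter (x, b) stands for x if b is true, and for x^-1 otherwise. *)
Definition letter_val (l : G * bool) : G := if l.2 then l.1 else l.1^-1.

Fixpoint word_val (w : seq (G * bool)) : G :=
  if w is l :: w' then letter_val l * word_val w' else 1.

Fixpoint reduced (w : seq (G * bool)) : Prop :=
  if w is l :: w' then
    (if w' is m :: _ then ~ (l.1 = m.1 /\ l.2 <> m.2) else True) /\ reduced w'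
  else True.

Definition free_basis (X A : set G) :=
  gen X = A /\
  forall w, w <> [::] -> (forall l, In l w -> X l.1) -> reduced w ->
    word_val w <> 1.

Definition free_subgroup A := subgroup A /\ exists X, free_basis X A.

Definition abelian_subset A := forall x y, A x -> A y -> x * y = y * x.

Definition small A :=
  ~ exists F, [/\ free_subgroup F, F `<=` A & ~ abelian_subset F].

End Subgroups.

(* A graph with an action of G by automorphisms. *)
Record gGraph (G : groupType) := GGraph {
  gvert :> Type;
  adj : gvert -> gvert -> Prop;
  act : G -> gvert -> gvert;
  adj_sym : forall u v, adj u v -> adj v u;
  adj_irr : forall u, ~ adj u u;
  act1 : forall u, act 1 u = u;
  actM : forall g h u, act (g * h) u = act g (act h u);
  act_adj : forall g u v, adj u v -> adj (act g u) (act g v)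
}.
Arguments adj {G T} : rename.
Arguments act {G T} : rename.

Section GGraphs.
Variable G : groupType.
Implicit Types (T : gGraph G) (A : set G).

Definition vstab T (v : T) : set G := [set g | act g v = v].

(* The pointwise stabilizer of the edge uv. It is the stabilizer of the edge
   when G acts without inversions, and has index at most 2 in it in general. *)
Definition estab T (u v : T) : set G := vstab u `&` vstab v.

Definition without_inversions T :=
  forall (g : G) (u v : T), adj u v -> ~ (act g u = v /\ act g v = u).

Definition is_gtree T :=
  [/\ inhabited T, connected_graph (@adj G T),
      forall (x : T) p, ~ circuit adj x p & without_inversions T].

(* As there are no inversions, fixing a point of (the realization of) a tree
   amounts to fixing a vertex. *)
Definition elliptic T A := exists v : T, A `<=` vstab v.

(* Equivariant maps are given on vertices, and extended linearly to edges.
   Conversely, an equivariant map between realizations can be made to send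
   vertices to vertices, because there are no inversions. *)
Definition dominates T T' :=
  exists f : T -> T', forall g v, f (act g v) = act g (f v).

Definition same_deformation_space T T' :=
  forall A, subgroup A -> (elliptic T A <-> elliptic T' A).

Definition almost_k_acylindrical (k : nat) T :=
  forall (x : T) p (y : T), walk adj x p y -> NoDup (x :: p) ->
    (k < size p)%N ->
    finite_set [set g | forall v, In v (x :: p) -> act g v = v].

Definition almost_acylindrical T := exists k, almost_k_acylindrical k T.

Definition is_giso T T' (f : T -> T') :=
  [/\ bijective f, forall g v, f (act g v) = act g (f v)
    & forall u v, adj (f u) (f v) <-> adj u v].

(* Bowditch's definition: G is hyperbolic relative to the conjugates of the
   H_i, which are meant to be infinite and finitely generated. *)
Definition relatively_hyperbolic (n : nat) (H : 'I_n -> set G) :=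
  exists K : gGraph G,
    [/\ inhabited K, connected_graph (@adj G K), hyperbolic_graph (@adj G K)
      & fine_graph (@adj G K)] /\
    [/\ forall u v : K, adj u v -> finite_set (estab u v),
        exists E : set (K * K), finite_set E /\
          forall u v : K, adj u v ->
            exists g e, [/\ E e, u = act g e.1 & v = act g e.2]
      & forall A : set G,
          (infinite_set A /\ exists v : K, A = vstab v) <->
          exists i g, A = conjs (H i) g].

Section Elementary.
Variables (n : nat) (H : 'I_n -> set G).

Definition parabolic A := subgroup A /\ exists i g, A `<=` conjs (H i) g.

Definition elementary A :=
  subgroup A /\ [\/ finite_set A, two_ended A | parabolic A].

Definition infinite_elementary A := infinite_set A /\ elementary A.

(* The relation ~, which is only used between infinite elementary subgroups. *)
Definition coelementary A B := elementary (gen (A `|` B)).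

End Elementary.
End GGraphs.

(* Conjugation invariance of the above notions, needed to let G act on the tree
   of cylinders and on its collapse. *)
Section Conjugation.
Variable G : groupType.
Implicit Types (A B S : set G) (g x y : G).

Definition conj_inv (P : set G -> Prop) := forall A g, P A -> P (conjs A g).
Definition conj_inv2 (R : set G -> set G -> Prop) :=
  forall A B g, R A B -> R (conjs A g) (conjs B g).

Lemma conjsE A g x : conjs A g x <-> A (x ^ g^-1).
Proof.
split=> [[y Ay <-]|Ax]; first by rewrite conjgK.
by exists (x ^ g^-1) => //; rewrite conjgKV.
Qed.

Lemma conjsK A g : conjs (conjs A g) g^-1 = A.
Proof. by apply/seteqP; split=> x; rewrite !conjsE invgK conjgK. Qed.

Lemma conjsKV A g : conjs (conjs A g^-1) g = A.
Proof. by rewrite -{2}(invgK g) conjsK. Qed.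

Lemma conjs_mono A B g : A `<=` B -> conjs A g `<=` conjs B g.
Proof. by move=> AB x /conjsE/AB ?; apply/conjsE. Qed.

Lemma conjsU A B g : conjs (A `|` B) g = conjs A g `|` conjs B g.
Proof. by rewrite /conjs image_setU. Qed.

Lemma conjs_subgroup : conj_inv (@subgroup G).
Proof.
move=> A g [A1 AM AV]; split=> [|x y|x]; rewrite !conjsE.
- by rewrite conj1g.
- by rewrite conjMg; apply: AM.
- by rewrite conjVg; apply: AV.
Qed.

Lemma conjs_finite : conj_inv (@finite_set G).
Proof. by move=> A g; apply: finite_image. Qed.

Lemma conjs_infinite : conj_inv (fun A => infinite_set A).
Proof.
by move=> A g infA /(@conjs_finite _ g^-1); rewrite conjsK.
Qed.

Lemma gen_sub S : S `<=` gen S.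
Proof. exact: sub_gen_smallest. Qed.

Lemma gen_min S A : subgroup A -> S `<=` A -> gen S `<=` A.
Proof. by move=> sA SA x; apply. Qed.

Lemma gen_subgroup S : subgroup (gen S).
Proof.
split=> [A [[]]//|x y Sx Sy A hA|x Sx A hA].
- by case: (hA) => [[_ AM _] _]; apply: AM; [apply: Sx | apply: Sy].
- by case: (hA) => [[_ _ AV] _]; apply: AV; apply: Sx.
Qed.

Lemma conjs_gen S g : gen (conjs S g) = conjs (gen S) g.
Proof.
apply/seteqP; split.
  apply: gen_min; first by apply: conjs_subgroup; apply: gen_subgroup.
  by apply: conjs_mono; apply: gen_sub.
rewrite -[gen (conjs S g)](conjsKV _ g); apply: conjs_mono.
apply: gen_min; first by apply: conjs_subgroup; apply: gen_subgroup.
by rewrite -{1}(conjsK S g); apply: conjs_mono; apply: gen_sub.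
Qed.

Lemma ends_ge_iso (V W : Type) (a : V -> V -> Prop) (b : W -> W -> Prop)
    (f : V -> W) (f' : W -> V) k :
  cancel f f' -> cancel f' f -> (forall x y : V, a x y <-> b (f x) (f y)) ->
  ends_ge a k -> ends_ge b k.
Proof.
move=> fK f'K ab [K [finK [h [hinf hinj]]]].
have co (x y : V) : conn_off a K x y <-> conn_off b (f @` K) (f x) (f y).
  have Kf z : (f @` K) (f z) <-> K z.
    by split=> [[t Kt /(can_inj fK) <-]//|Kz]; exists z.
  split.
    elim=> [u v [auv Ku Kv]|u|u v w _ IH1 _ IH2].
    - by apply: rt_step; split; rewrite ?Kf//; apply/ab.
    - exact: rt_refl.
    - exact: rt_trans IH1 IH2.
  rewrite -{2}(fK x) -{2}(fK y).
  elim=> [u v [buv Ku Kv]|u|u v w _ IH1 _ IH2].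
  - apply: rt_step; split; first by apply/ab; rewrite !f'K.
      by move=> /Kf; rewrite f'K.
    by move=> /Kf; rewrite f'K.
  - exact: rt_refl.
  - exact: rt_trans IH1 IH2.
exists (f @` K); split; first exact: finite_image.
exists (f \o h); split=> [i|i j /co]; last exact: hinj.
have [hK hi] := hinf i; split=> [[t Kt /(can_inj fK) E]|fin].
  by apply: hK; rewrite -E.
apply: hi; apply: (@sub_finite_set _ _
  (f' @` [set y | conn_off b (f @` K) ((f \o h) i) y])); last first.
  exact: finite_image.
by move=> y /co hy; exists (f y); rewrite ?fK.
Qed.

Lemma cayley_conjs A S g x y :
  cayley A S x y <-> cayley (conjs A g) (conjs S g) (x ^ g) (y ^ g).
Proof.
rewrite /cayley; split=> [[Ax Ay xy [s Ss h]]|[Ax Ay xy [s Ss h]]].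
  split; [by exists x|by exists y|by move/conjg_inj|].
  exists (s ^ g); first by exists s.
  by case: h => ->; rewrite conjMg; [left|right].
move: Ax Ay Ss => /conjsE Ax /conjsE Ay /conjsE Ss.
rewrite !conjgK in Ax Ay.
split=> //; first by move=> E; apply: xy; rewrite E.
exists (s ^ g^-1) => //.
by case: h => h; [left|right]; apply: (@conjg_inj _ g); rewrite conjMg conjgKV.
Qed.

Lemma conjs_has_ends k : conj_inv (fun A => has_ends A k).
Proof.
move=> A g [S [finS genS ge nge]]; exists (conjs S g); split.
- exact: conjs_finite.
- by rewrite conjs_gen genS.
- apply: (ends_ge_iso (conjgK g) (conjgKV g)) ge => x y.
  exact: cayley_conjs.
- move=> h; apply: nge.
  apply: (ends_ge_iso (conjgKV g) (conjgK g)) h => x y.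
  by rewrite (cayley_conjs A S g) !conjgKV.
Qed.

Section Peripheral.
Variables (n : nat) (H : 'I_n -> set G).

Lemma conjs_parabolic : conj_inv (parabolic H).
Proof.
move=> A g [sA [i [h Ah]]]; split; first exact: conjs_subgroup.
exists i, (h * g) => x /conjsE /Ah /conjsE Hx; apply/conjsE.
by rewrite invgM conjgM.
Qed.

Lemma conjs_elementary : conj_inv (elementary H).
Proof.
move=> A g [sA eA]; split; first exact: conjs_subgroup.
case: eA => [fA|tA|pA].
- by apply: Or31; apply: conjs_finite.
- by apply: Or32; apply: conjs_has_ends.
- by apply: Or33; apply: conjs_parabolic.
Qed.

Lemma conjs_infinite_elementary : conj_inv (infinite_elementary H).
Proof.
move=> A g [infA eA]; split; first exact: conjs_infinite.
exact: conjs_elementary.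
Qed.

Lemma conjs_coelementary : conj_inv2 (coelementary H).
Proof.
move=> A B g; rewrite /coelementary -conjsU conjs_gen.
exact: conjs_elementary.
Qed.

End Peripheral.
End Conjugation.

Section ActionTheory.
Variables (G : groupType) (T : gGraph G).
Implicit Types (g : G) (u v : T).

Lemma actK g : cancel (@act G T g) (act g^-1).
Proof. by move=> u; rewrite -actM mulVg act1. Qed.

Lemma actKV g : cancel (@act G T g^-1) (act g).
Proof. by move=> u; rewrite -actM mulgV act1. Qed.

Lemma adj_actE g u v : adj (act g u) (act g v) <-> adj u v.
Proof.
split=> [/(act_adj g^-1)|]; last exact: act_adj.
by rewrite !actK.
Qed.

Lemma vstab_act g u : vstab (act g u) = conjs (vstab u) g^-1.
Proof.
apply/seteqP; split=> x; rewrite conjsE invgK /vstab /= conjgE !actM => E.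
  by rewrite E actK.
by rewrite -{2}E actKV.
Qed.

Lemma estab_act g u v : estab (act g u) (act g v) = conjs (estab u v) g^-1.
Proof.
rewrite /estab !vstab_act; apply/seteqP; split=> x.
  by move=> [/conjsE hu /conjsE hv]; apply/conjsE.
by move=> /conjsE [hu hv]; split; apply/conjsE.
Qed.

End ActionTheory.

(* The tree of cylinders of T with respect to a relation R on edge stabilizers,
   as a graph with an action of G. *)
Section TreeOfCylinders.
Variables (G : groupType) (R : set G -> set G -> Prop) (RJ : conj_inv2 R).
Variable T : gGraph G.

(* An unoriented edge uv is encoded by both pairs (u, v) and (v, u). *)
Definition cylinder_of (a b : T) : set (T * T) :=
  [set e | adj e.1 e.2 /\ R (estab a b) (estab e.1 e.2)].

Definition is_cylinder (Y : set (T * T)) :=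
  exists a b : T, adj a b /\ Y = cylinder_of a b.

Definition on_cylinder (x : T) (Y : set (T * T)) := exists y, Y (x, y).

(* The second clause only matters when T is a point: T_c is then a point. *)
Definition is_V0 (x : T) :=
  (exists Y Y', [/\ is_cylinder Y, is_cylinder Y', Y <> Y',
                    on_cylinder x Y & on_cylinder x Y'])
  \/ (forall u v : T, ~ adj u v).

Definition V0 := {x : T | is_V0 x}.
Definition V1 := {Y : set (T * T) | is_cylinder Y}.

Definition Tc_adj (p q : V0 + V1) : Prop :=
  match p, q with
  | inl x, inr Y | inr Y, inl x => on_cylinder (proj1_sig x) (proj1_sig Y)
  | _, _ => False
  end.

Definition act_edges (g : G) (Y : set (T * T)) : set (T * T) :=
  [set e | Y (act g^-1 e.1, act g^-1 e.2)].

Lemma act_cylinder_of g a b :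
  act_edges g (cylinder_of a b) = cylinder_of (act g a) (act g b).
Proof.
apply/seteqP; split=> -[u v] [/= uv h]; split=> /=.
- by apply/(adj_actE g^-1).
- rewrite estab_act -(actKV g u) -(actKV g v) estab_act; exact: RJ.
- by apply/adj_actE.
- move: h => /(@RJ _ _ g); rewrite estab_act conjsKV.
  by rewrite -{1}(actKV g u) -{1}(actKV g v) estab_act conjsKV.
Qed.

Lemma act_is_cylinder g Y : is_cylinder Y -> is_cylinder (act_edges g Y).
Proof.
move=> [a [b [ab ->]]]; exists (act g a), (act g b).
by split; [apply: act_adj | apply: act_cylinder_of].
Qed.

Lemma act_edges1 Y : act_edges 1 Y = Y.
Proof.
by apply/seteqP; split=> -[u v]; rewrite /act_edges /= invg1 !act1.
Qed.

Lemma act_edgesM g h Y : act_edges (g * h) Y = act_edges g (act_edges h Y).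
Proof.
by apply/seteqP; split=> -[u v]; rewrite /act_edges /= invgM !actM.
Qed.

Lemma act_on_cylinder g x Y :
  on_cylinder x Y -> on_cylinder (act g x) (act_edges g Y).
Proof.
by move=> [y Yxy]; exists (act g y); rewrite /act_edges /= !actK.
Qed.

Lemma act_is_V0 g x : is_V0 x -> is_V0 (act g x).
Proof.
case=> [[Y [Y' [cY cY' YY' xY xY']]]|noedge]; last by right.
left; exists (act_edges g Y), (act_edges g Y').
split; do ?[exact: act_is_cylinder | exact: act_on_cylinder].
move=> /(congr1 (act_edges g^-1)).
by rewrite -!act_edgesM mulVg !act_edges1.
Qed.

Definition Tc_act (g : G) (p : V0 + V1) : V0 + V1 :=
  match p with
  | inl x => inl (exist is_V0 _ (act_is_V0 g (proj2_sig x)))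
  | inr Y => inr (exist is_cylinder _ (act_is_cylinder g (proj2_sig Y)))
  end.

Lemma Tc_adj_sym p q : Tc_adj p q -> Tc_adj q p.
Proof. by case: p; case: q. Qed.

Lemma Tc_adj_irr p : ~ Tc_adj p p.
Proof. by case: p => x []. Qed.

Lemma Tc_act1 p : Tc_act 1 p = p.
Proof.
case: p => -[x hx] /=; [congr inl|congr inr]; apply: eq_exist => /=.
  exact: act1.
exact: act_edges1.
Qed.

Lemma Tc_actM g h p : Tc_act (g * h) p = Tc_act g (Tc_act h p).
Proof.
case: p => -[x hx] /=; [congr inl|congr inr]; apply: eq_exist => /=.
  exact: actM.
exact: act_edgesM.
Qed.

Lemma Tc_act_adj g p q : Tc_adj p q -> Tc_adj (Tc_act g p) (Tc_act g q).
Proof. by case: p => x; case: q => y //=; apply: act_on_cylinder. Qed.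

Definition tree_of_cylinders_of : gGraph G :=
  GGraph Tc_adj_sym Tc_adj_irr Tc_act1 Tc_actM Tc_act_adj.

End TreeOfCylinders.

(* The graph obtained from T by collapsing all edges whose stabilizer does not
   satisfy P: its vertices are the classes of vertices of T which can be joined
   through collapsed edges. *)
Section Collapse.
Variables (G : groupType) (P : set G -> Prop) (PJ : conj_inv P).
Variable T : gGraph G.

Definition collapse_class (v : T) : set T :=
  [set w | clos_refl_trans T (fun x y => adj x y /\ ~ P (estab x y)) v w].

Definition is_class (C : set T) := exists v, C = collapse_class v.

Definition collapse_vert := {C : set T | is_class C}.

Definition collapse_adj (C D : collapse_vert) :=
  proj1_sig C <> proj1_sig D /\
  exists u v : T, [/\ proj1_sig C u, proj1_sig D v, adj u v & P (estab u v)].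

Definition act_set (g : G) (C : set T) : set T := [set w | C (act g^-1 w)].

Lemma act_collapse_class_sub g v :
  act_set g (collapse_class v) `<=` collapse_class (act g v).
Proof.
move=> w; rewrite -{2}(actKV g w) /act_set /collapse_class /=.
elim=> [x y [xy nP]|x|x y z _ IH1 _ IH2].
- apply: rt_step; split; first exact: act_adj.
  by rewrite estab_act => /(@PJ _ g); rewrite conjsKV.
- exact: rt_refl.
- exact: rt_trans IH1 IH2.
Qed.

Lemma act_collapse_class g v :
  act_set g (collapse_class v) = collapse_class (act g v).
Proof.
apply/seteqP; split; first exact: act_collapse_class_sub.
move=> w hw; rewrite /act_set /= -{1}(actK g v).
by apply: act_collapse_class_sub; rewrite /act_set /= invgK actKV.
Qed.

Lemma act_is_class g C : is_class C -> is_class (act_set g C).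
Proof. by move=> [v ->]; exists (act g v); apply: act_collapse_class. Qed.

Definition collapse_act (g : G) (C : collapse_vert) : collapse_vert :=
  exist is_class _ (act_is_class g (proj2_sig C)).

Lemma act_setK g : cancel (act_set g) (act_set g^-1).
Proof.
by move=> C; apply/seteqP; split=> w; rewrite /act_set /= invgK actK.
Qed.

Lemma collapse_adj_sym C D : collapse_adj C D -> collapse_adj D C.
Proof.
move=> [CD [u [v [Cu Dv uv Puv]]]]; split; first exact: nesym.
exists v, u; split=> //; first exact: adj_sym.
by rewrite /estab setIC.
Qed.

Lemma collapse_adj_irr C : ~ collapse_adj C C.
Proof. by case. Qed.

Lemma collapse_act1 C : collapse_act 1 C = C.
Proof.
case: C => C hC; apply: eq_exist => /=.
by apply/seteqP; split=> w; rewrite /act_set /= invg1 act1.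
Qed.

Lemma collapse_actM g h C :
  collapse_act (g * h) C = collapse_act g (collapse_act h C).
Proof.
case: C => C hC; apply: eq_exist => /=.
by apply/seteqP; split=> w; rewrite /act_set /= invgM actM.
Qed.

Lemma collapse_act_adj g C D :
  collapse_adj C D -> collapse_adj (collapse_act g C) (collapse_act g D).
Proof.
move=> [CD [u [v [Cu Dv uv Puv]]]]; split=> [/(can_inj (act_setK g))//|].
exists (act g u), (act g v); split.
- by rewrite /= /act_set /= actK.
- by rewrite /= /act_set /= actK.
- exact: act_adj.
- by rewrite estab_act; apply: PJ.
Qed.

Definition collapse : gGraph G :=
  GGraph collapse_adj_sym collapse_adj_irr collapse_act1 collapse_actM
    collapse_act_adj.

Definition collapse_map (v : T) : collapse :=
  exist is_class (collapse_class v) (ex_intro _ v erefl).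

End Collapse.

Section Main.
Variables (G : groupType) (n : nat) (H : 'I_n -> set G) (T : gGraph G).

Definition tree_of_cylinders : gGraph G :=
  tree_of_cylinders_of (@conjs_coelementary G n H) T.

Definition collapsed_tree_of_cylinders : gGraph G :=
  collapse (@conjs_infinite_elementary G n H) tree_of_cylinders.

Definition to_collapsed :
    tree_of_cylinders -> collapsed_tree_of_cylinders :=
  @collapse_map G _ (@conjs_infinite_elementary G n H) tree_of_cylinders.

End Main.

(* Main.v *)
Require Import Defs.
From Stdlib Require Import Relation_Operators Operators_Properties List.
From Stdlib Require FinFun.
From mathcomp Require Import all_boot ssralg ssrnum ssrint zify.
From mathcomp Require Import boolp classical_sets functions cardinality.

(* Idea.  In a relatively hyperbolic group every infinite elementary subgroup
   lies in a unique maximal one (its hull), which is virtually cyclic or a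
   conjugate of some H_i; it contains every elementary subgroup meeting it in an
   infinite set, and is its own normalizer.  Hence cylinders of T correspond to
   hulls, the hull being the stabilizer of the cylinder, and all assertions
   reduce to the action of hulls on trees.  Conjugates of H_i are handled through
   one-endedness (an edge with finite stabilizer in H_i has almost all of each
   orbit on one side), and, for part (3), through ping-pong.

   Hulls of non-parabolic subgroups come from the geometry of the fine hyperbolic
   graph K: edges near the middle of two parallel geodesics lie on a common
   circuit of bounded length, so fineness makes the action acylindrical, and
   elements commuting with a power of h act as almost-translations along long
   geodesics, with finitely many of them up to powers of h. *)

Set Implicit Arguments.
Unset Strict Implicit.
Unset Printing Implicit Defensive.

Local Open Scope classical_set_scope.
Local Open Scope group_scope.

(** * Finite sets, walks and distances in graphs *)

(** Ends enter the definitions only through Cayley graphs, so two-ended groups are shown to be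
    exactly the [virtually_gen] ones; afterwards every argument about them is a pigeonhole on powers
    of one element. No boundary at infinity is used: the hull of an element [h] none of whose powers
    fixes a vertex of K, classically the stabilizer of its two limit points, is the algebraically
    defined [reversing_normalizer], visibly a subgroup, and the work is to bound the cosets of the
    powers of [h] in it. The obstacle is that K need not be locally finite: finiteness comes from
    fineness, finite edge stabilizers and the finite number of edge orbits. These also show that an
    infinite subgroup fixes at most one vertex and that an element with a bounded orbit has a power
    fixing a vertex, whence the two kinds of hulls. In T, an edge between points fixed by two
    infinite subgroups of a hull has its stabilizer in that hull; so cylinders are convex, and a
    path of T_c can be followed in T through the half-trees [side u v] that it enters. *)

Lemma In_mem (T : eqType) (x : T) (s : seq T) : In x s <-> x \in s.
Proof.
elim: s => [|y s IH]; first by split.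
rewrite /= inE; split=> [[->|/IH ->]|/orP[/eqP ->|/IH]]; rewrite ?eqxx ?orbT //; by [left|right].
Qed.

Lemma size_list_prod (T U : Type) (s : seq T) (t : seq U) :
  size (List.list_prod s t) = (size s * size t)%N.
Proof. by elim: s => //= x s IH; rewrite size_cat size_map IH mulSn. Qed.

Section FiniteSets.
Variables (T U : Type).
Implicit Types (A B : set T).

(** Vertices and group elements are handled without decidable equality: a covering list, which may
    be too large, is all that the counting arguments need. *)
Lemma finite_listP A : finite_set A <-> exists l : seq T, forall x, A x -> In x l.
Proof.
split=> [/(@finite_seqP {classic T})[s ->]|[l hl]].
  exists s => x /=; elim: s => //= y s IH; rewrite inE => /orP[/eqP->|/IH]; by [left|right].
apply/(@finite_seqP {classic T}).
exists [seq x : {classic T} <- l | `[< A x >]]; apply/seteqP; split => x /=.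
  move=> Ax; rewrite mem_filter; apply/andP; split; first exact/asboolP.
  by move: (hl x Ax); clear hl; elim: l => //= y s IH [->|/IH]; rewrite inE ?eqxx // => ->; rewrite orbT.
by rewrite mem_filter => /andP[/asboolP].
Qed.

Lemma finite_cover (J : Type) (l : seq J) (Q : J -> set T) A :
  (forall j, finite_set (Q j)) -> (forall x, A x -> exists2 j, In j l & Q j x) ->
  finite_set A.
Proof.
move=> fQ; elim: l A => [|j l IH] A hA.
  by apply/finite_listP; exists nil => x /hA[].
apply: (@sub_finite_set _ _ (Q j `|` [set x | exists2 i, In i l & Q i x])).
  by move=> x /hA[i /= [<-|il] Qx]; [left|right; exists i].
by rewrite finite_setU; split=> //; apply: IH.
Qed.

Lemma infinite_fiber (f : T -> U) (l : seq U) A :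
  infinite_set A -> (forall x, A x -> In (f x) l) ->
  exists2 u, In u l & infinite_set [set x | A x /\ f x = u].
Proof.
move=> iA hA; apply: contrapT => h; apply: iA.
apply: (@finite_cover _ l (fun u => [set x | [/\ A x, f x = u & In u l]])).
  move=> u; have [ul|ul] := EM (In u l); last by apply/finite_listP; exists nil => x [].
  apply: contrapT => iu; apply: h; exists u => // fu; apply: iu.
  by apply: sub_finite_set fu => x [].
by move=> x Ax; exists (f x); [exact: hA|split=> //; exact: hA].
Qed.

Lemma infinite_notin A (l : seq T) :
  infinite_set A -> exists2 x, A x & ~ In x l.
Proof.
move=> iA; apply: contrapT => h; apply: iA; apply/finite_listP; exists l => x Ax.
by apply: contrapT => xl; apply: h; exists x.
Qed.

Lemma infinite_setD A B : infinite_set A -> finite_set B ->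
  infinite_set [set x | A x /\ ~ B x].
Proof.
move=> iA fB f; apply: iA; apply: (@sub_finite_set _ _ (B `|` [set x | A x /\ ~ B x])).
  by move=> x Ax; have [?|?] := EM (B x); [left|right].
by rewrite finite_setU.
Qed.

Lemma infinite_sub A B : A `<=` B -> infinite_set A -> infinite_set B.
Proof. by move=> AB iA fB; apply: iA; apply: sub_finite_set fB. Qed.

Lemma infinite_pair A (f : T -> U) (l : seq U) :
  infinite_set A -> (forall x, A x -> In (f x) l) ->
  exists x y, [/\ A x, A y, x <> y & f x = f y].
Proof.
move=> iA hA; have [u _ iu] := infinite_fiber iA hA.
have [x [Ax fx] _] := infinite_notin nil iu.
have [y [Ay fy] xy] := infinite_notin [:: x] iu.
by exists x, y; split=> //; [move=> E; apply: xy; left|rewrite fx fy].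
Qed.

End FiniteSets.

Lemma infinite_nat_injection (T : Type) (f : nat -> T) : injective f -> infinite_set (range f).
Proof.
move=> fi /finite_listP[l hl]; apply: infinite_nat; apply/finite_listP => /=.
exists (List.map (fun x => xget 0%N [set n | f n = x]) l) => n _.
apply/in_map_iff; exists (f n); split; last by apply: hl; exists n.
by apply: fi; apply: (@xgetI _ 0%N [set m | f m = f n] n).
Qed.

Lemma uniq_bound (T : eqType) (J : Type) (l : seq J) (Q : J -> T -> Prop) N (s : seq T) :
  uniq s -> (forall g, g \in s -> exists2 j, In j l & Q j g) ->
  (forall j (t : seq T), uniq t -> (forall g, g \in t -> Q j g) -> (size t <= N)%N) ->
  (size s <= size l * N)%N.
Proof.
move=> us hs hN; elim: l s us hs => [|j l IH] s us hs /=.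
  case: s us hs => [|g s] _ hs; first exact: leq0n.
  by have [? []] := hs g (mem_head _ _).
rewrite -(count_predC (fun g => `[< Q j g >]) s) mulSn -!size_filter; apply: leq_add.
  by apply: (hN j); [exact: filter_uniq|move=> g; rewrite mem_filter => /andP[/asboolP]].
apply: IH; first exact: filter_uniq.
move=> g; rewrite mem_filter => /andP[/= /asboolP nQ /hs[i /= [<-//|il] Qi]].
by exists i.
Qed.

Section Walks.
Variables (V : Type).
Implicit Types (r : V -> V -> Prop) (p q : seq V).

Lemma walk_cat r x p q z :
  walk r x (p ++ q) z <-> exists2 y, walk r x p y & walk r y q z.
Proof.
elim: p x => [|u p IH] x /=; first by split=> [w|[y -> //]]; exists x.
split=> [[xu /IH[y wp wq]]|[y [xu wp] wq]]; first by exists y.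
by split=> //; apply/IH; exists y.
Qed.

Lemma walk_trans r x p y q z : walk r x p y -> walk r y q z -> walk r x (p ++ q) z.
Proof. by move=> wp wq; apply/walk_cat; exists y. Qed.

Lemma walk_rcons r x p y z : walk r x p y -> r y z -> walk r x (p ++ [:: z]) z.
Proof. by move=> wp yz; apply: walk_trans wp _. Qed.

Lemma walk_sub r r' x p y :
  (forall u v, r u v -> r' u v) -> walk r x p y -> walk r' x p y.
Proof. by move=> h; elim: p x => //= u p IH x [/h ? /IH]. Qed.

Lemma walk_end r x p y : walk r x p y -> In y (x :: p).
Proof. by elim: p x => [|u p IH] x /= => [->|[_ /IH]]; [left|right]. Qed.

Lemma walk_end_tail r x p y : walk r x p y -> p <> nil -> In y p.
Proof. by case: p => // u p w _; apply: walk_end w.2. Qed.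

Lemma walk_rev r x p y : (forall u v, r u v -> r v u) ->
  walk r x p y -> exists q, [/\ walk r y q x, size q = size p
    & forall z, In z (y :: q) <-> In z (x :: p)].
Proof.
move=> rs; elim: p x => [|u p IH] x.
  by move=> /= ->; exists nil; split.
move=> [/= xu /IH[q [wq sq hq]]]; exists (q ++ [:: x]); split.
- by apply: walk_rcons wq _; apply: rs.
- by rewrite size_cat /= sq addn1.
- by move=> z; have := hq z; rewrite /= in_app_iff /=; tauto.
Qed.

(** Loop erasure. The relation [r] is arbitrary, so restrictions such as avoiding a vertex or an
    edge survive it. *)
Lemma walk_simple r x p y : walk r x p y ->
  exists q, [/\ walk r x q y, NoDup (x :: q), (size q <= size p)%N
    & forall z, In z q -> In z p].
Proof.
elim: p x => [|u p IH] x /=.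
  by move=> ->; exists nil; split=> //; constructor=> //; constructor.
move=> [xu /IH[q [wq nq sq hq]]].
have [xq|xq] := EM (In x (u :: q)); last first.
  exists (u :: q); split=> //; first by constructor.
  by move=> z /= [->|/hq]; [left|right].
move: (xq) => /(@in_split _ _ _)[l1 [l2 E]].
exists l2; split=> //.
- case: l1 E => [|v l1] /=; first by move=> [<- <-].
  by move=> [_ E]; move: wq; rewrite E => /walk_cat[t _ /= []].
- by move: nq; rewrite E => /NoDup_app_remove_l.
- have := congr1 size E; rewrite size_cat /=; lia.
- move=> z zl; have : In z (u :: q) by rewrite E in_app_iff; right; right.
  by case=> [->|/hq]; [left|right].
Qed.

Lemma walk_cross r (P : V -> Prop) x p y : walk r x p y -> P x -> ~ P y ->
  exists u v, [/\ r u v, P u, ~ P v, In u (x :: p) & In v p].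
Proof.
elim: p x => [|u p IH] x /= => [-> //|[xu w] Px Py].
have [Pu|Pu] := EM (P u).
  have [a [b [ab Pa Pb ha hb]]] := IH u w Pu Py.
  by exists a, b; split=> //; right.
by exists x, u; split=> //; left.
Qed.

End Walks.

Lemma walk_map (V W : Type) (f : V -> W) (r : V -> V -> Prop) (r' : W -> W -> Prop) x p y :
  (forall u v, r u v -> r' (f u) (f v)) -> walk r x p y ->
  walk r' (f x) [seq f z | z <- p] (f y).
Proof. by move=> h; elim: p x => [|u p IH] x /= => [->|[/h ? /IH]]. Qed.

Section Distance.
Variables (V : Type) (adj : V -> V -> Prop).
Hypothesis adjS : forall u v, adj u v -> adj v u.
Hypothesis conn : connected_graph adj.

Definition dist (x y : V) : nat := xget 0%N [set n | exists2 p, geodesic adj x p y & size p = n].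

Lemma geodesic_exists x y : exists2 p, geodesic adj x p y & size p = dist x y.
Proof.
rewrite /dist; case: xgetP => [n _ //|].
have : exists n, `[< exists2 p, walk adj x p y & size p = n >].
  by have [p wp] := conn x y; exists (size p); apply/asboolP; exists p.
move=> ex; case: (ex_minnP ex) => n /asboolP[p wp sp] hn /(_ n); case.
exists p => //; split=> // q wq; rewrite sp; apply: hn.
by apply/asboolP; exists q.
Qed.

Lemma dist_le x p y : walk adj x p y -> (dist x y <= size p)%N.
Proof. by move=> wp; have [q [_ gq] <-] := geodesic_exists x y; apply: gq. Qed.

Lemma distxx x : dist x x = 0%N.
Proof. by apply/eqP; rewrite -leqn0; apply: (@dist_le x nil x). Qed.

Lemma dist_sym x y : dist x y = dist y x.
Proof.
suff h a b : (dist a b <= dist b a)%N by apply/eqP; rewrite eqn_leq !h.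
have [p [wp _] <-] := geodesic_exists b a.
by have [q [wq <- _]] := walk_rev adjS wp; apply: dist_le.
Qed.

Lemma dist_tri y x z : (dist x z <= dist x y + dist y z)%N.
Proof.
have [p [wp _] <-] := geodesic_exists x y; have [q [wq _] <-] := geodesic_exists y z.
by rewrite -size_cat; apply: dist_le; apply: walk_trans wp wq.
Qed.

Lemma dist_eq0 x y : dist x y = 0%N -> x = y.
Proof. by have [[|u p] [w _] <-] := geodesic_exists x y. Qed.

Lemma dist_adj x y : adj x y -> (dist x y <= 1)%N.
Proof. by move=> xy; apply: (@dist_le x [:: y] y). Qed.

Lemma geodesic_fun x y : exists c : nat -> V,
  [/\ c 0%N = x, c (dist x y) = y,
      forall i, (i < dist x y)%N -> adj (c i) (c i.+1)
    & forall i j, (i <= j <= dist x y)%N -> dist (c i) (c j) = (j - i)%N].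
Proof.
have [p [wp gp] sp] := geodesic_exists x y.
have wi0 x0 z s t i j : walk adj z s t -> (i <= j)%N -> (j <= size s)%N ->
    exists2 q, walk adj (nth x0 (z :: s) i) q (nth x0 (z :: s) j) & size q = (j - i)%N.
  elim: s z i j => [|u s IH] z i j ws ij jp.
    by exists nil; move: ij jp => /=; case: i => //; case: j.
  case: ws => zu ws; case: i ij => [|i] ij; case: j jp ij => [|j] jp ij //.
  - by exists nil.
  - have [q wq sq] := IH u 0%N j ws (leq0n _) jp.
    by exists (u :: q); [split|rewrite /= sq !subn0].
  - by have [q wq sq] := IH u i j ws ij jp; exists q; rewrite // sq; lia.
have wi i j := wi0 x x p y i j wp.
exists (fun i => nth x (x :: p) i).
have c0 : nth x (x :: p) 0 = x by [].
have ce : nth x (x :: p) (dist x y) = y.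
  rewrite -sp; suff h x0 z s t : walk adj z s t -> nth x0 (z :: s) (size s) = t by apply: h.
  by elim: s z => [|u s IH] z //= [_ /IH].
(* The three subwalks have total length [dist x y], so by the triangle inequality none of them can
   be shortened. *)
have ci i j : (i <= j <= dist x y)%N ->
   dist (nth x (x :: p) i) (nth x (x :: p) j) = (j - i)%N.
  move=> /andP[ij jd]; rewrite -sp in jd.
  have [q1 /dist_le w1 s1] := wi 0%N i (leq0n _) (leq_trans ij jd).
  have [q2 /dist_le w2 s2] := wi i j ij jd.
  have [q3 /dist_le w3 s3] := wi j (size p) jd (leqnn _).
  rewrite -sp in ce; rewrite ce c0 in w1 w3.
  have := dist_tri (nth x (x :: p) i) x y.
  have := dist_tri (nth x (x :: p) j) (nth x (x :: p) i) y; lia.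
split=> // i id; rewrite -sp in id.
have [q wq sq] := wi i i.+1 (leqnSn _) id.
case: q wq sq => [|a [|b q]] wq /= sq; try lia.
case: wq => ? E; rewrite -[X in adj _ X]E.
by [].
Qed.

End Distance.

(** * Integer powers and virtually cyclic groups *)

Lemma pigeonhole (T : eqType) (J : Type) (l : seq J) (Q : J -> T -> Prop) (s : seq T) :
  uniq s -> (size l < size s)%N -> (forall g, g \in s -> exists2 j, In j l & Q j g) ->
  exists x y j, [/\ x \in s, y \in s, x <> y, Q j x & Q j y].
Proof.
move=> us ls hs; apply: contrapT => no.
suff : (size s <= size l * 1)%N by lia.
apply: (uniq_bound (Q := fun j g => g \in s /\ Q j g)) us _ _.
  by move=> g gs; have [j jl Qj] := hs g gs; exists j.
move=> j [|x [|y t]] //= /andP[xt _] h; exfalso; apply: no.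
have [xs Qx] := h x (mem_head _ _).
have [ys Qy] : y \in s /\ Q j y by apply: h; rewrite !inE eqxx orbT.
by exists x, y, j; split=> // E; move: xt; rewrite E mem_head.
Qed.

Section IntegerPowers.
Variable G : groupType.
Implicit Types (g h x : G) (A B : set G).

Definition zexp h (z : int) : G :=
  match z with Posz n => h ^+ n | Negz n => (h ^+ n.+1)^-1 end.

Lemma zexp_sub h m n : zexp h (Posz m - Posz n)%R = h ^+ m * (h ^+ n)^-1.
Proof.
have [nm|mn] := leqP n m.
  rewrite -expgnFr //; have -> : (Posz m - Posz n)%R = Posz (m - n) by lia.
  by [].
have -> : (Posz m - Posz n)%R = Negz (n - m).-1 by lia.
rewrite /= prednK ?subn_gt0// expgnFr; last exact: ltnW.
by rewrite invgM invgK.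
Qed.

Lemma zexpE (z : int) : exists m n, z = (Posz m - Posz n)%R.
Proof. by case: z => n; [exists n, 0%N|exists 0%N, n.+1]; lia. Qed.

Lemma commute_exp h m n : h ^+ m * h ^+ n = h ^+ n * h ^+ m.
Proof. by rewrite -!expgnDr addnC. Qed.

Lemma zexpD h a b : zexp h (a + b)%R = zexp h a * zexp h b.
Proof.
have [m [n ->]] := zexpE a; have [m' [n' ->]] := zexpE b.
have -> : (Posz m - Posz n + (Posz m' - Posz n'))%R =
  (Posz (m + m') - Posz (n' + n))%R by lia.
rewrite !zexp_sub !expgnDr invgM -!mulgA; congr (_ * _); rewrite !mulgA; congr (_ * _).
have := commute_exp h m' n => E.
by rewrite -[RHS]mulg1 -(mulgV (h ^+ n)) mulgA -[_ * h ^+ n]mulgA E !mulgA mulVg mul1g.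
Qed.

Lemma zexp0 h : zexp h 0%R = 1. Proof. by []. Qed.
Lemma zexp1 h : zexp h 1%R = h. Proof. by rewrite /= expg1. Qed.

Lemma zexpN h a : zexp h (- a)%R = (zexp h a)^-1.
Proof.
by apply: (mulgI (zexp h a)); rewrite -zexpD mulgV; have -> : (a - a)%R = 0%R by lia.
Qed.

Lemma zexpC h a b : zexp h a * zexp h b = zexp h b * zexp h a.
Proof. by rewrite -!zexpD GRing.addrC. Qed.

Lemma zexp_expn h a n : zexp h a ^+ n = zexp h (a * Posz n)%R.
Proof.
elim: n => [|n IH]; first by rewrite expg0 GRing.mulr0.
by rewrite expgS IH -zexpD; congr zexp; lia.
Qed.

Lemma zexpM h a b : zexp (zexp h a) b = zexp h (a * b)%R.
Proof.
have [m [n ->]] := zexpE b; rewrite zexp_sub !zexp_expn -zexpN -zexpD.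
by congr zexp; lia.
Qed.

Lemma zexpJ h g a : zexp (h ^ g) a = zexp h a ^ g.
Proof.
have e n : (h ^ g) ^+ n = (h ^+ n) ^ g.
  by elim: n => [|n IH]; rewrite ?expg0 ?conj1g // !expgS conjMg IH.
by case: a => n /=; rewrite e // conjVg.
Qed.

Lemma zexp_subgroup A h a : subgroup A -> A h -> A (zexp h a).
Proof.
move=> [A1 AM AV] Ah; have e n : A (h ^+ n).
  by elim: n => [|n IH]; rewrite ?expg0 // expgS; apply: AM.
by case: a => n /=; last apply: AV; apply: e.
Qed.

Definition infinite_order h := forall n, (0 < n)%N -> h ^+ n <> 1.

Lemma zexp_inj h : infinite_order h -> injective (zexp h).
Proof.
move=> ih a b /(congr1 (fun x => x * (zexp h b)^-1)); rewrite mulgV -zexpN -zexpD => E.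
have [//|ab] := eqVneq a b; exfalso.
have [le|lt] := boolP (b <= a)%R.
  apply: (ih `|a - b|%N); first by lia.
  by have -> : h ^+ `|a - b|%N = zexp h (a - b)%R by rewrite -[LHS]/(zexp h (Posz _)); congr zexp; lia.
apply: (ih `|b - a|%N); first by lia.
have -> : h ^+ `|b - a|%N = zexp h (- (a - b))%R by rewrite -[LHS]/(zexp h (Posz _)); congr zexp; lia.
by rewrite zexpN E invg1.
Qed.

Lemma infinite_orderP h : injective (zexp h) -> infinite_order h.
Proof. by move=> ih n n0 E; have := ih (Posz n) 0%R E; lia. Qed.

Lemma infinite_order_pow h a : infinite_order h -> a <> 0%R -> infinite_order (zexp h a).
Proof.
move=> ih a0; apply: infinite_orderP => b c; rewrite !zexpM => /(zexp_inj ih) E.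
by apply: (GRing.mulfI _ E); apply/eqP.
Qed.

Lemma infinite_orderJ h g : infinite_order h -> infinite_order (h ^ g).
Proof.
move=> ih; apply: infinite_orderP => b c; rewrite !zexpJ => /conjg_inj.
exact: zexp_inj.
Qed.

Lemma infinite_powers h : infinite_order h -> infinite_set [set x | exists z, x = zexp h z].
Proof.
move=> ih; apply: (@infinite_sub _ (range (fun n => zexp h (Posz n)))).
  by move=> x [n _ <-]; exists (Posz n).
by apply: infinite_nat_injection => m n /(zexp_inj ih) [].
Qed.

Lemma powers_subgroup h : subgroup [set x | exists z, x = zexp h z].
Proof.
split=> [|x y [a ->] [b ->]|x [a ->]]; first by exists 0%R.
- by exists (a + b)%R; rewrite zexpD.
- by exists (- a)%R; rewrite zexpN.
Qed.

(* [T] meets the coset <h>a of each [a] in [A], so that <h> has finite index in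
   [A] when [A] is a subgroup. *)
Definition virtually_gen A h :=
  [/\ A h, infinite_order h
    & exists2 T : set G, finite_set T & forall a, A a -> exists z, T (zexp h z * a)].

(** Powers of [h] bring the infinitely many elements of [B] into a finite set, so two of them, [b]
    and [c], are brought to the same place; then [c * b^-1] is a nontrivial power of [h] lying in
    [B]. *)
Lemma vgen_meet A B h : virtually_gen A h -> subgroup B -> infinite_set B -> B `<=` A ->
  exists2 n, (0 < n)%N & B (h ^+ n).
Proof.
move=> [Ah ih [T /finite_listP[l hl] hT]] sB iB BA.
have [z hz] : {z : G -> int & forall b, B b -> T (zexp h (z b) * b)}.
  apply: (@choice _ _ (fun b z => B b -> T (zexp h z * b))) => b.
  by have [/BA/hT[z ?]|?] := EM (B b); [exists z|exists 0%R].
have [b [c [Bb Bc bc E]]] := infinite_pair iB (fun b Bb => hl _ (hz b Bb)).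
have {E}E : zexp h (z b - z c)%R = c * b^-1.
  rewrite GRing.addrC zexpD zexpN; apply: (mulgI (zexp h (z c))).
  by rewrite mulgA mulgV mul1g mulgA -E -mulgA mulgV mulg1.
have Bz : B (zexp h (z b - z c)%R) by rewrite E; case: sB => _ BM BV; apply/BM/BV.
have zbc : (z b - z c)%R <> 0%R.
  by move=> E0; move: E; rewrite E0 /= => /esym /(congr1 (fun x => x * b)); rewrite -mulgA mulVg mulg1 mul1g => /esym.
exists `|z b - z c|%N; first by lia.
rewrite -[_ ^+ _]/(zexp h (Posz _)); have [le|lt] := boolP (0 <= z b - z c)%R.
  by have -> : Posz `|z b - z c|%N = (z b - z c)%R by lia.
have -> : Posz `|z b - z c|%N = (- (z b - z c))%R by lia.
by rewrite zexpN; case: sB => _ _; apply.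
Qed.

Lemma vgen_pow A h a : subgroup A -> virtually_gen A h -> a <> 0%R ->
  virtually_gen A (zexp h a).
Proof.
move=> sA [Ah ih [T /finite_listP[l hl] hT]] a0; split.
- exact: zexp_subgroup.
- exact: infinite_order_pow.
- exists [set x | exists r t, [/\ (r < `|a|)%N, In t l & x = h ^+ r * t]].
    apply: (@finite_cover _ _ (iota 0 `|a|)
      (fun r => [set x | In x (List.map (fun t => h ^+ r * t) l)])).
      by move=> r; apply/finite_listP; exists (List.map (fun t => h ^+ r * t) l).
    move=> x [r [t [ra tl ->]]]; exists r; last by apply/in_map_iff; exists t.
    have : r \in iota 0 `|a| by rewrite mem_iota.
    by elim: (iota _ _) => //= y s IH; rewrite inE => /orP[/eqP ->|/IH]; [left|right].
  move=> x /hT[z Tz].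
  (* [a * w] is a multiple of [a] less than [|a|] above [z]; the remainder [r] is absorbed by the
     enlarged finite set. *)
  have [w [r [ra E]]] : exists w r, (r < `|a|)%N /\ (a * w)%R = (Posz r + z)%R.
    clear -a0; suff [q [r [ra E]]] : exists q r, (r < `|a|)%N /\ (- z)%R = (q * Posz `|a| + Posz r)%R.
      have [pa|na] := boolP (0 <= a)%R; [exists (- q)%R, r|exists q, r]; split=> //.
        have Ea : Posz `|a| = a by lia.
        by rewrite Ea in E; rewrite GRing.mulrN GRing.mulrC; lia.
      have Ea : Posz `|a| = (- a)%R by lia.
      by rewrite Ea GRing.mulrN in E; rewrite GRing.mulrC; lia.
    have n0 : (0 < `|a|)%N by lia.
    case: z => n.
      have e := divn_eq n `|a|; have l := ltn_pmod n n0.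
      have [z0|z0] := posnP (n %% `|a|)%N.
        by exists (- Posz (n %/ `|a|))%R, 0%N; split=> //; lia.
      by exists (- Posz (n %/ `|a|) - 1)%R, (`|a| - n %% `|a|)%N; split; lia.
    have e := divn_eq n.+1 `|a|; have l := ltn_pmod n.+1 n0.
    by exists (Posz (n.+1 %/ `|a|))%R, (n.+1 %% `|a|)%N; split; lia.
  exists w, r, (zexp h z * x); split=> //; first exact: hl.
  by rewrite zexpM E zexpD -mulgA.
Qed.

Lemma vgen_change A h h' : subgroup A -> virtually_gen A h -> A h' -> infinite_order h' ->
  virtually_gen A h'.
Proof.
move=> sA vA Ah' ih'; split=> //.
have [n n0 [k hk]] : exists2 n, (0 < n)%N & [set x | exists z, x = zexp h' z] (h ^+ n).
  apply: vgen_meet vA (powers_subgroup h') (infinite_powers ih') _.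
  by move=> x [z ->]; apply: zexp_subgroup.
have [|_ _ [T fT hT]] := @vgen_pow _ _ (Posz n) sA vA; first by lia.
by exists T => // a /hT[z]; rewrite [zexp h _]hk zexpM => ?; exists (k * z)%R.
Qed.

Lemma vgen_sub A B h : subgroup A -> virtually_gen A h -> subgroup B -> infinite_set B ->
  B `<=` A -> exists h', virtually_gen B h'.
Proof.
move=> sA vA sB iB BA; have [n n0 Bn] := vgen_meet vA sB iB BA.
have [|_ ih [T fT hT]] := @vgen_pow _ _ (Posz n) sA vA; first by lia.
by exists (h ^+ n); split=> //; exists T => // b /BA/hT.
Qed.

(** Among [u ^ 0, ..., u ^ (size l)] two lie in the same coset of the powers of [h], and the
    difference of their exponents divides [(size l)!]. *)
Lemma vgen_uniform_exponent A h : subgroup A -> virtually_gen A h ->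
  exists2 M, (0 < M)%N & forall u, A u -> exists z, u ^+ M = zexp h z.
Proof.
move=> sA [Ah ih [T /finite_listP[l hl] hT]].
exists ((size l)`!)%N; first exact: fact_gt0.
move=> u Au.
have Ap n : A (u ^+ n) by apply: (@zexp_subgroup A u (Posz n)).
have [i [j [t [il jl ij [z Ez] [w Ew]]]]] : exists i j t,
    [/\ i \in iota 0 (size l).+1, j \in iota 0 (size l).+1, i <> j,
        exists z, zexp h z * u ^+ i = t & exists z, zexp h z * u ^+ j = t].
  apply: (@pigeonhole _ _ l (fun t i => exists z, zexp h z * u ^+ i = t)) => //.
  - exact: iota_uniq.
  - by rewrite size_iota.
  - by move=> i _; have [z Tz] := hT _ (Ap i); exists (zexp h z * u ^+ i); [apply: hl|exists z].
wlog lt : i j z w il jl ij Ez Ew / (i < j)%N.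
  move=> W; have [lt|] := ltnP i j; first exact: (W i j z w).
  move=> ji; apply: (W j i w z) => //; first by move=> E; apply: ij.
  by move: ij ji; lia.
have d : (j - i %| (size l)`!)%N.
  apply: dvdn_fact; rewrite subn_gt0 lt /=; move: jl; rewrite mem_iota; lia.
have e : u ^+ (j - i) = zexp h (z - w)%R.
  rewrite expgnFr; last exact: ltnW.
  apply: (mulgI (zexp h w)); rewrite mulgA Ew -Ez GRing.addrC zexpD zexpN !mulgA mulgV mul1g.
  by rewrite -mulgA mulgV mulg1.
have [q ->] := dvdnP d.
by exists ((z - w) * Posz q)%R; rewrite mulnC expgnA e zexp_expn.
Qed.

(** Bernoulli's inequality in the form [b ^ k * (b + k) <= a ^ k * b]; at [k = M * b] the factor [b]
    cancels and [M + 1] is left. *)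
Lemma pow_lt_absurd a b M : (0 < b)%N -> (b < a)%N ->
  exists k, (b ^ k * M < a ^ k)%N.
Proof.
move=> b0 ba; exists (M * b)%N.
have h k : (b ^ k * (b + k) <= a ^ k * b)%N.
  elim: k => [|k IH]; first by rewrite !expn0 !mul1n addn0.
  apply: (@leq_trans (a * (b ^ k * (b + k)))%N); last by rewrite expnS -mulnA leq_pmul2l //; lia.
  rewrite expnS; set B := (b ^ k)%N.
  have : (b * (b + k.+1) <= a * (b + k))%N by nia.
  by move=> /(leq_mul (leqnn B)); nia.
have := h (M * b)%N; set B := (b ^ _)%N; set A := (a ^ _)%N.
have B0 : (0 < B)%N by rewrite expn_gt0 b0.
nia.
Qed.

(* If [h^g] is commensurable to [h] inside a virtually cyclic setting, the
   exponents agree: otherwise the conjugates of [h] by powers of [g] would have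
   powers of bounded exponent lying arbitrarily deep. *)
Lemma conj_exponent (C : set G) h g M a b : infinite_order h -> (0 < M)%N ->
  (forall u, C u -> exists z, u ^+ M = zexp h z) ->
  (forall k, C (h ^ (g ^+ k)) /\ C (h ^ (g ^+ k)^-1)) ->
  a <> 0%R -> b <> 0%R -> zexp h a ^ g = zexp h b -> a = b \/ a = (- b)%R.
Proof.
move=> ih M0 hM hC.
have key g' a' b' : (forall k, C (h ^ (g' ^+ k))) -> b' <> 0%R ->
    zexp h a' ^ g' = zexp h b' -> (`|a'| <= `|b'|)%N.
  move=> hC' b0 E; rewrite leqNgt; apply/negP => lt.
  have e k : zexp h (a' ^+ k)%R ^ (g' ^+ k) = zexp h (b' ^+ k)%R.
    elim: k => [|k IH]; first by rewrite expg0 conjg1.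
    rewrite GRing.exprS expgS conjgM -zexpM -zexpJ E zexpM GRing.mulrC -zexpM.
    by rewrite -zexpJ IH zexpM GRing.exprS GRing.mulrC.
  have [|k hk] := @pow_lt_absurd `|a'| `|b'| M _ lt; first by lia.
  have [l hl] := hM _ (hC' k).
  (* Comparing exponents gives [l * a' ^ k = b' ^ k * M], whose right side is nonzero and smaller
     than [a' ^ k] in absolute value. *)
  have := congr1 (fun x => zexp x (a' ^+ k)%R) hl.
  rewrite -[_ ^+ M]/(zexp _ (Posz M)) !zexpM [(Posz M * _)%R]GRing.mulrC.
  rewrite -(zexpM _ (a' ^+ k)%R (Posz M)) zexpJ e zexpM.
  move=> /(zexp_inj ih)/(congr1 absz); rewrite !abszM !abszX /= => F.
  have : (0 < `|b'| ^ k)%N by rewrite expn_gt0; apply/orP; left; lia.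
  have : (0 < `|a'| ^ k)%N by rewrite expn_gt0; apply/orP; left; lia.
  by move: F hk; set x := (_ ^ k)%N; set y := (_ ^ k)%N; case: `|l|%N => [|n]; nia.
move=> a0 b0 E.
have h1 : (`|a| <= `|b|)%N by apply: (key g) => // k; case: (hC k).
have h2 : (`|b| <= `|a|)%N.
  apply: (key g^-1) => //; last by rewrite -E conjgK.
  by move=> k; rewrite expVgn; case: (hC k).
lia.
Qed.

(** One exponent sends [h'] and all its conjugates by powers of [c] into the powers of [h'], and
    then [conj_exponent] leaves only the sign free. *)
Lemma vgen_conj A h h' c : subgroup A -> virtually_gen A h -> A h' -> infinite_order h' ->
  A c -> exists2 m, (0 < m)%N & (h' ^+ m) ^ c = h' ^+ m \/ (h' ^+ m) ^ c = (h' ^+ m)^-1.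
Proof.
move=> sA vA Ah' ih' Ac.
have vA' := vgen_change sA vA Ah' ih'.
have AJ x y : A x -> A y -> A (x ^ y).
  by case: sA => _ AM AV Ax Ay; rewrite conjgE; apply: (AM); [apply: AV|apply: AM].
have [M M0 hM] := vgen_uniform_exponent sA vA'.
have [b hb] := hM _ (AJ _ _ Ah' Ac).
have Eb : zexp h' (Posz M) ^ c = zexp h' b by rewrite -hb -zexpJ.
have b0 : b <> 0%R.
  by move=> b0; apply: (@infinite_orderJ h' c ih' _ M0); rewrite hb b0.
have hC k : A (h' ^ (c ^+ k)) /\ A (h' ^ (c ^+ k)^-1).
  have Ack : A (c ^+ k) by apply: (@zexp_subgroup A c (Posz k)).
  by split; apply: AJ => //; case: sA => _ _; apply.
have M0' : Posz M <> 0%R by lia.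
exists M => //; case: (conj_exponent ih' M0 hM hC M0' b0 Eb) => E.
- by left; rewrite -[h' ^+ M]/(zexp h' (Posz M)) Eb E.
- right; rewrite -[h' ^+ M]/(zexp h' (Posz M)) Eb -zexpN; congr zexp; lia.
Qed.

End IntegerPowers.

(** * Ends of Cayley graphs *)

Section CayleyEnds.
Variables (G : groupType) (A S : set G).
Hypotheses (finS : finite_set S) (genS : gen S = A).
Implicit Types (X Y Z K : set G) (a b g x y : G).
Let cay := cayley A S.

Lemma cayley_sub : subgroup A. Proof. by rewrite -genS; apply: gen_subgroup. Qed.

Lemma cayley_sym a b : cay a b -> cay b a.
Proof.
move=> [Aa Ab ab [s Ss h]]; split=> //; first by move=> E; apply: ab.
by exists s => //; case: h; [right|left].
Qed.

Lemma cayley_mul g a b : A g -> cay a b -> cay (g * a) (g * b).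
Proof.
have [_ AM _] := cayley_sub.
move=> Ag [Aa Ab ab [s Ss h]]; split; [exact: AM|exact: AM|by move/mulgI|].
by exists s => //; case: h => ->; [left|right]; rewrite mulgA.
Qed.

(** Connectedness of the Cayley graph as an induction principle: the elements whose right
    multiplication preserves [P] on [A] form a subgroup containing [S]. *)
Lemma cayley_invariant (P : set G) : (forall a b, cay a b -> P a -> P b) ->
  forall a b, A a -> A b -> P a -> P b.
Proof.
move=> hP; have [A1 AM AV] := cayley_sub.
have hs a s : A a -> S s -> (P a <-> P (a * s)).
  move=> Aa Ss; have As : A s by rewrite -genS; apply: gen_sub.
  have [E|E] := EM (a = a * s); first by rewrite -E.
  have c : cay a (a * s) by split=> //; [exact: AM|exists s => //; left].
  by split; apply: hP => //; apply: cayley_sym.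
have h c : A c -> forall a, A a -> (P a <-> P (a * c)).
  rewrite -{1}genS => gc; suff [] : [set c | A c /\ forall a, A a -> (P a <-> P (a * c))] c by [].
  apply: (gen_min _ _ gc).
    split=> [|x y [Ax hx] [Ay hy]|x [Ax hx]].
    - by split=> // a; rewrite mulg1.
    - split; first exact: AM.
      by move=> a Aa; rewrite mulgA hx // hy //; apply: AM.
    - split; first exact: AV.
      by move=> a Aa; rewrite -[X in P X <-> _](mulgVK x) -hx //; apply: AM => //; apply: AV.
  by move=> s Ss; split=> [|a Aa]; [rewrite -genS; apply: gen_sub|apply: hs].
move=> a b Aa Ab Pa; have Ac : A (a^-1 * b) by apply: AM => //; apply: AV.
by have /(h _ Ac) := Pa; rewrite mulgA mulgV mul1g; apply.
Qed.

Lemma cayley_walk a b : A a -> A b -> exists p, walk cay a p b.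
Proof.
move=> Aa Ab; apply: (@cayley_invariant (fun b => exists p, walk cay a p b) _ a b) => //.
  by move=> x y xy [p wp]; exists (p ++ [:: y]); apply: walk_rcons wp xy.
by exists nil.
Qed.

(** Vertex form of the coboundary: both ends of every edge between [X] and its complement. It is
    finite exactly when the coboundary is, because [S] is finite. *)
Definition bdry X : set G := [set a | exists2 b, cay a b & (X a <-> ~ X b)].

Lemma bdry_sub X a : bdry X a -> A a. Proof. by case=> b []. Qed.

Lemma bdryP X a b : cay a b -> X a -> ~ X b -> bdry X a /\ bdry X b.
Proof.
move=> ab Xa Xb; split; [by exists b|exists a; first exact: cayley_sym].
by split=> // _ /(_ Xa).
Qed.

Lemma bdryI X Y : bdry (X `&` Y) `<=` bdry X `|` bdry Y.
Proof.
move=> a [b ab h]; have [[Xa Ya]|nXa] := EM ((X `&` Y) a).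
  have nb : ~ (X `&` Y) b by apply/h.
  have [Xb|Xb] := EM (X b); last by left; have [] := bdryP ab Xa Xb.
  by right; apply: (bdryP ab Ya _).1 => Yb; apply: nb.
have [Xb Yb] : (X `&` Y) b by apply: contrapT => /h.
have [Xa|Xa] := EM (X a); last by left; apply: (bdryP (cayley_sym ab) Xb Xa).2.
by right; apply: (bdryP (cayley_sym ab) Yb _).2 => Ya; apply: nXa.
Qed.

Lemma bdryC X : bdry (A `\` X) = bdry X.
Proof.
apply/seteqP; split=> a [b ab h]; exists b => //; case: (ab) => Aa Ab _ _.
  split=> [Xa Xb|nXb].
    by have [_] : (A `\` X) a by apply/h => -[_]; apply.
  apply: contrapT => Xa; have : ~ (A `\` X) b by apply/h.
  by apply.
split=> [[_ Xa] [_ Xb]|nXb]; first by apply: Xa; apply/h.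
by split=> // /h Xb; apply: nXb.
Qed.

Lemma bdry_stable X : bdry X `<=` set0 -> forall a b, cay a b -> X a -> X b.
Proof. by move=> h a b ab Xa; apply: contrapT => Xb; have [/h] := bdryP ab Xa Xb. Qed.

Lemma conn_off_stay K Z w y : (forall a, bdry Z a -> K a) ->
  conn_off cay K w y -> Z w -> Z y.
Proof.
move=> hK; elim=> [u v [uv nKu nKv] Zu|//|u v z _ h1 _ h2 /h1/h2//].
by apply: contrapT => Zv; have [/hK] := bdryP uv Zu Zv.
Qed.

Lemma neighbours_finite K : finite_set K ->
  finite_set [set w | exists2 k, K k & cay k w].
Proof.
move=> fK; have [ls hls] := (finite_listP _).1 finS.
have [lk hlk] := (finite_listP _).1 fK.
apply: (@finite_cover _ _ lk (fun k => [set w | cay k w])); last by move=> w [k /hlk ? ?]; exists k.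
move=> k; apply/finite_listP.
exists (List.map (fun s => k * s) ls ++ List.map (fun s => k * s^-1) ls).
move=> w [_ _ _ [s /hls sl [->|->]]]; apply/in_app_iff; [left|right]; apply/in_map_iff; exists s => //.
by rewrite mulgK.
Qed.

(** Every point of [Z] outside [K] is joined off [K] to a neighbour of [K], as is seen on a path to
    [1]. There are finitely many neighbours, so one of them serves infinitely many points, and its
    component cannot leave [Z] without meeting [K]. *)
Lemma ends_piece K Z : finite_set K -> K 1 -> Z `<=` A -> infinite_set Z ->
  (forall a, bdry Z a -> K a) ->
  exists w, [/\ Z w, ~ K w & infinite_set [set y | conn_off cay K w y]].
Proof.
move=> fK K1 ZA iZ hK; have [A1 _ _] := cayley_sub.
have co z : Z z -> ~ K z -> exists w, [/\ exists2 k, K k & cay k w, ~ K w & conn_off cay K z w].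
  move=> Zz nKz; have [p wp] := cayley_walk (ZA _ Zz) A1.
  have [|u [v [uv [nu cu] nv _ _]]] := @walk_cross _ _
    (fun u => ~ K u /\ conn_off cay K z u) z p 1 wp (conj nKz (rt_refl _ _ z)).
  - by case.
  - exists u; split=> //; exists v; last exact: cayley_sym.
    apply: contrapT => nKv; apply: nv; split=> //; apply: rt_trans cu _.
    exact: rt_step.
have [f hf] : {f : G -> G & forall z, Z z -> ~ K z ->
   [/\ exists2 k, K k & cay k (f z), ~ K (f z) & conn_off cay K z (f z)]}.
  apply: (@choice _ _ (fun z w => Z z -> ~ K z ->
    [/\ exists2 k, K k & cay k w, ~ K w & conn_off cay K z w])) => z.
  by have [[Zz Kz]|h] := EM (Z z /\ ~ K z); [have [w hw] := co z Zz Kz; exists w|exists z => Zz Kz; case: h].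
have [l hl] := (finite_listP _).1 (neighbours_finite fK).
have [|w _ iw] := @infinite_fiber _ _ f l [set z | Z z /\ ~ K z] (infinite_setD iZ fK).
  by move=> z [Zz Kz]; apply: hl; have [] := hf z Zz Kz.
have [z [[Zz Kz] Ez] _] := infinite_notin nil iw.
have [_ Kw zw] := hf z Zz Kz; rewrite Ez in Kw zw.
exists w; split=> //; first exact: conn_off_stay zw Zz.
apply: infinite_sub iw => y [[Zy Ky] Ey].
have [_ _] := hf y Zy Ky; rewrite Ey => /(@clos_rt_rt1n _ _ _ _) {}yw.
elim: yw => [x|x t u [xt nx nt] _ IH]; first exact: rt_refl.
by apply: rt_trans IH _; apply: rt_step; split=> //; apply: cayley_sym.
Qed.

Lemma ends_ge_family k (Z : 'I_k -> set G) :
  (forall i, [/\ Z i `<=` A, infinite_set (Z i) & finite_set (bdry (Z i))]) ->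
  (forall i j x, Z i x -> Z j x -> i = j) -> ends_ge cay k.
Proof.
move=> hZ dZ; pose K := [set x : G | x = 1 \/ exists i, bdry (Z i) x].
have fK : finite_set K.
  apply: (@finite_cover _ _ (None :: [seq Some i | i <- enum 'I_k])
     (fun o x => if o is Some i then bdry (Z i) x else x = 1)).
    by case=> [i|]; [have [] := hZ i|apply/finite_listP; exists [:: 1] => x ->; left].
  move=> x [->|[i hi]]; first by exists None => //; left.
  exists (Some i) => //; right.
  have : i \in enum 'I_k by rewrite mem_enum.
  by elim: (enum _) => //= j s IH; rewrite inE => /orP[/eqP ->|/IH]; [left|right].
have hK i a : bdry (Z i) a -> K a by right; exists i.
have [f hf] : {f : 'I_k -> G & forall i, [/\ Z i (f i), ~ K (f i) & infinite_set [set y | conn_off cay K (f i) y]]}.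
  apply: (@choice _ _ (fun i w =>
    [/\ Z i w, ~ K w & infinite_set [set y | conn_off cay K w y]])) => i.
  have [ZA iZ _] := hZ i.
  by apply: ends_piece => //; [left|exact: hK].
exists K; split=> //; exists f; split=> [i|i j co].
  by have [] := hf i.
have [Zi _ _] := hf i; have [Zj _ _] := hf j.
by apply: (dZ i j (f j)) => //; apply: conn_off_stay co Zi; apply: hK.
Qed.

Lemma ends_ge2 X : X `<=` A -> infinite_set X -> infinite_set (A `\` X) ->
  finite_set (bdry X) -> ends_ge cay 2.
Proof.
move=> XA iX iX' fX.
apply: (@ends_ge_family 2 (fun i => if i == ord0 then X else A `\` X)) => [i|i j x].
  by case: (i == ord0); [split|split=> [x []||//]//; rewrite bdryC].
case: (eqVneq i ord0) => [->|i0]; case: (eqVneq j ord0) => [->|j0] //.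
- by move=> Xx [].
- by move=> [].
- move=> _ _; apply/val_inj; case: i i0 => [[|[|i]] //= hi] _; by case: j j0 => [[|[|j]] //= hj] _.
Qed.

Lemma ends_ge3 X Y Z : X `<=` A -> Y `<=` A -> Z `<=` A ->
  infinite_set X -> infinite_set Y -> infinite_set Z ->
  finite_set (bdry X) -> finite_set (bdry Y) -> finite_set (bdry Z) ->
  (forall x, X x -> ~ Y x) -> (forall x, X x -> ~ Z x) -> (forall x, Y x -> ~ Z x) ->
  ends_ge cay 3.
Proof.
move=> XA YA ZA iX iY iZ fX fY fZ XY XZ YZ.
apply: (@ends_ge_family 3 (fun i => match val i with 0 => X | 1 => Y | _ => Z end)).
  by move=> [[|[|i]] hi].
move=> [[|[|[|i]]] //= hi] [[|[|[|j]]] //= hj] x hx hy; apply/val_inj => //=; exfalso;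
  solve [exact: XY hx hy|exact: XZ hx hy|exact: YZ hx hy|exact: XY hy hx|exact: XZ hy hx|exact: YZ hy hx].
Qed.

Lemma one_ended_bdry X : ~ ends_ge cay 2 -> X `<=` A -> finite_set (bdry X) ->
  finite_set X \/ finite_set (A `\` X).
Proof.
move=> ne XA fX; apply: contrapT => /not_orP[iX iX'].
by apply: ne; apply: ends_ge2 fX.
Qed.

(** Elements outside [A] are isolated vertices, so their components are single points. *)
Lemma infinite_component K w : infinite_set [set y | conn_off cay K w y] ->
  forall y, conn_off cay K w y -> A y.
Proof.
move=> iw; have [y /= wy yl] := infinite_notin [:: w] iw.
have Aw : A w.
  have := clos_rt_rt1n _ _ _ _ wy => {}wy.
  by case: wy yl => [[]|u v [[]] //]; left.
move=> z co; elim: co Aw => // [u v [[]]//|u v t _ h1 _ h2 /h1/h2//].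
Qed.

(** [X] is one of the two components off [K]: an edge leaving it has its outer end in [K], hence its
    inner end among the neighbours of [K]. *)
Lemma ends_ge2_bdry : ends_ge cay 2 -> exists X,
  [/\ X `<=` A, infinite_set X, infinite_set (A `\` X) & finite_set (bdry X)].
Proof.
move=> [K [fK [f [hf fi]]]].
pose i0 : 'I_2 := ord0; pose i1 : 'I_2 := ord_max.
have [nK0 c0] := hf i0; have [nK1 c1] := hf i1.
pose X := [set y | conn_off cay K (f i0) y].
have nK w y : ~ K w -> conn_off cay K w y -> ~ K y.
  by move=> nKw co; elim: co nKw => // [u v []//|u v t _ h1 _ h2 /h1/h2].
have coS u v : conn_off cay K u v -> conn_off cay K v u.
  elim=> [x y [xy nx ny]|x|x y z _ h1 _ h2]; last exact: rt_trans h2 h1.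
    by apply: rt_step; split=> //; apply: cayley_sym.
  exact: rt_refl.
exists X; split=> //; first exact: (infinite_component c0).
- apply: infinite_sub (c1) => y c1y; split; first exact: (infinite_component c1 c1y).
  by move=> c0y; have := fi i0 i1 (rt_trans _ _ _ _ _ c0y (coS _ _ c1y)) => /(congr1 val).
- apply: (@sub_finite_set _ _ (K `|` [set w | exists2 k, K k & cay k w])); last first.
    by rewrite finite_setU; split=> //; apply: neighbours_finite.
  have key a b : cay a b -> X a -> ~ X b -> K b.
    move=> ab Xa Xb; apply: contrapT => Kb; apply: Xb; apply: rt_trans (Xa) _.
    by apply: rt_step; split=> //; apply: nK Xa.
  move=> a [b ab h]; have [Xa|Xa] := EM (X a).
    by right; exists b; [apply: (key _ _ ab Xa); apply/h|exact: cayley_sym].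
  have Xb : X b by apply: contrapT => /h.
  by left; apply: (key _ _ (cayley_sym ab) Xb Xa).
Qed.

End CayleyEnds.

(** * Hopf's theorem: a group with exactly two ends has an infinite cyclic subgroup of finite
    index *)

Section TwoEnded.
Variables (G : groupType) (A S : set G).
Hypotheses (finS : finite_set S) (genS : gen S = A).
Implicit Types (X Y Z K : set G) (a b g x y : G).
Local Notation cay := (cayley A S).
Local Notation bd := (bdry A S).
Let sA : subgroup A := cayley_sub genS.

Definition translate g Z : set G := [set a | Z (g^-1 * a)].

Lemma translate_bdry g Z : A g -> bd (translate g Z) = translate g (bd Z).
Proof.
have [_ _ AV] := sA.
move=> Ag; apply/seteqP; split=> a [b ab h].
  by exists (g^-1 * b) => //; apply: (cayley_mul genS _ ab); apply: AV.
exists (g * b); last by rewrite /translate /= mulKg.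
by rewrite -(mulVKg g a); apply: (cayley_mul genS _ ab).
Qed.

Lemma translate_finite g Z : finite_set Z -> finite_set (translate g Z).
Proof.
move=> /finite_listP[l hl]; apply/finite_listP; exists (List.map (fun x => g * x) l).
by move=> a /hl ?; apply/in_map_iff; exists (g^-1 * a); rewrite mulVKg.
Qed.

Lemma translateK g Z : translate g^-1 (translate g Z) = Z.
Proof. by apply/seteqP; split=> a; rewrite /translate /= invgK mulKg. Qed.

Lemma translate_infinite g Z : infinite_set Z -> infinite_set (translate g Z).
Proof. by move=> iZ /(@translate_finite g^-1); rewrite translateK. Qed.

Lemma translate_sub g Z : A g -> Z `<=` A -> translate g Z `<=` A.
Proof.
by have [_ AM _] := sA; move=> Ag ZA a /ZA; rewrite -{2}(mulVKg g a); apply: AM.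
Qed.

(* The finite set [K] consists of a base point and of the vertices of finitely
   many paths issued from it. *)
Lemma connected_hull F : finite_set F -> F `<=` A -> exists K,
  [/\ finite_set K, F `<=` K, K 1, K `<=` A
    & forall Y, (forall a, K a -> ~ bd Y a) -> forall k, K k -> (Y 1 <-> Y k)].
Proof.
have [A1 _ _] := sA.
move=> fF FA; have [l hl] := (finite_listP _).1 fF.
have [p hp] : {p : G -> seq G & forall x, F x -> walk cay 1 (p x) x}.
  apply: (@choice _ _ (fun x p => F x -> walk cay 1 p x)) => x.
  have [Fx|Fx] := EM (F x); last by exists nil.
  by have [p wp] := cayley_walk genS A1 (FA _ Fx); exists p.
have wA x q y : walk cay x q y -> A x -> forall z, In z (x :: q) -> A z.
  elim: q x => [|u q IH] x /= => [_ Ax z [<-|]//|[[_ Au _ _] w] Ax z [<-//|]].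
  exact: IH.
exists [set k | k = 1 \/ exists2 x, F x & In k (p x)]; split.
- apply: (@finite_cover _ _ (None :: List.map Some l) (fun o k =>
    if o is Some x then In k (p x) else k = 1)).
    by case=> [x|]; apply/finite_listP; [exists (p x)|exists [:: 1] => k ->; left].
  move=> k [->|[x Fx kx]]; first by exists None => //; left.
  by exists (Some x) => //; right; apply/in_map_iff; exists x; split=> //; apply: hl.
- by move=> x Fx; have [<-|] := walk_end (hp x Fx); [left|right; exists x].
- by left.
- move=> k [->//|[x Fx kx]]; apply: (wA _ _ _ (hp x Fx) A1); by right.
- move=> Y hY k [->//|[x Fx kx]].
  have {}hY a : a = 1 \/ In a (p x) -> ~ bd Y a.
    by move=> h; apply: hY; case: h; [left|right; exists x].
  suff h v q z : walk cay v q z -> (forall a, In a (v :: q) -> ~ bd Y a) ->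
      forall c, In c q -> (Y v <-> Y c).
    by apply: (h 1 (p x) x (hp x Fx)) => // a /= [<-|aq]; apply: hY; [left|right].
  elim: q v {hY kx} => //= u q IH v [vu w] hY c cq.
  have vuY : Y v <-> Y u.
    by split=> Yv; apply: contrapT => Yu; [have [h _] := bdryP vu Yv Yu
      |have [_ h] := bdryP (cayley_sym vu) Yv Yu]; apply: (hY v) => //; left.
  case: cq => [<-//|cq]; rewrite vuY; apply: (IH u) => // d dq; apply: hY; by right.
Qed.

(** An edge leaving the intersection would have its inner end in the boundary of [P], hence in [K]
    and outside [Q], or in that of [Q], hence in [g K] and outside [P]. So the intersection has no
    boundary, and it is not all of the connected graph. *)
Lemma nested (P Q K : set G) g : A g -> P `<=` A -> P !=set0 -> (A `\` P) !=set0 ->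
  (forall a, bd P a -> K a) -> (forall a, bd Q a -> translate g K a) ->
  (forall a, K a -> ~ Q a) -> (forall a, translate g K a -> ~ P a) ->
  P `&` Q = set0.
Proof.
move=> Ag PA [x0 Px0] [y0 [Ay0 nPy0]] hP hQ KQ KP.
apply/seteqP; split=> // a [Pa Qa]; apply: nPy0.
suff [] : (P `&` Q) y0 by [].
apply: (@cayley_invariant _ _ _ genS (P `&` Q) _ a y0) => //; last exact: PA.
apply: bdry_stable => b hb; exfalso.
case: (hb) => c bc h; have [[Pb Qb]|nb] := EM ((P `&` Q) b).
  have nc : ~ (P `&` Q) c by apply/h.
  have [Pc|Pc] := EM (P c); last by have [/hP/KQ] := bdryP bc Pb Pc.
  have Qc : ~ Q c by move=> Qc; apply: nc.
  by have [/hQ/KP] := bdryP bc Qb Qc.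
have [Pc Qc] : (P `&` Q) c by apply: contrapT => /h.
have cb := cayley_sym bc.
have [Pb|Pb] := EM (P b); last by have [/hP/KQ] := bdryP cb Pc Pb.
have Qb : ~ Q b by move=> Qb; apply: nb.
by have [/hQ/KP] := bdryP cb Qc Qb.
Qed.

(** If [k ^ n b] stays in [P] for all [n] and a neighbour [c] does not do so, then the translates of
    [c] stay outside from some moment on, and infinitely many [k ^ n b] lie on the boundary. So
    staying in [P] would spread to all of [A]. *)
Lemma escape (P : set G) k : A k -> infinite_order k -> P `<=` A -> (A `\` P) !=set0 ->
  finite_set (bd P) -> (forall y, A y -> P (k * y) -> P y) ->
  forall a, A a -> exists n, ~ P (k ^+ n * a).
Proof.
move=> Ak ik PA [y0 [Ay0 nPy0]] fP hk a Aa; apply: contrapT => no.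
have {no}Pa n : P (k ^+ n * a) by apply: contrapT => nP; apply: no; exists n.
have [_ AM _] := sA.
have Akn n : A (k ^+ n) by apply: (@zexp_subgroup _ A k (Posz n)).
suff : forall n, P (k ^+ n * y0) by move=> /(_ 0%N); rewrite mul1g.
apply: (@cayley_invariant _ _ _ genS (fun y => forall n, P (k ^+ n * y)) _ a) => // b c bc Pb n0.
apply: contrapT => nPc.
have nP n : ~ P (k ^+ (n + n0) * c).
  elim: n => [//|n IH]; rewrite addSn expgS -mulgA => /hk h; apply/IH/h.
  by apply: AM => //; case: bc.
have iP : infinite_set [set x | exists n : nat, x = k ^+ (n + n0) * b].
  apply: (@infinite_sub _ (range (fun n => k ^+ (n + n0) * b))).
    by move=> x [n _ <-]; exists n.
  apply: infinite_nat_injection => m n /mulIg E.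
  by have := @zexp_inj _ k ik (Posz (m + n0)) (Posz (n + n0)) E; lia.
apply: iP; apply: sub_finite_set fP => x [n ->].
by have [] := bdryP (cayley_mul genS (Akn (n + n0)%N) bc) (Pb _) (nP n).
Qed.

(** Negative powers of [h] push [a] out of [X] and positive ones push it in. When it first enters,
    it lies in [X] but not in [h X], so this finite difference meets every coset. *)
Lemma half_virtually_gen X h : A h -> X `<=` A -> X !=set0 -> (A `\` X) !=set0 ->
  finite_set (bd X) -> translate h X `<=` X -> (X `\` translate h X) !=set0 ->
  finite_set (X `\` translate h X) -> virtually_gen A h.
Proof.
move=> Ah XA X0 X'0 fX hX [s [Xs nXs]] fT.
have [A1 AM AV] := sA.
have st y : X y -> X (h * y) by move=> Xy; apply: hX; rewrite /translate /= mulKg.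
have stn n y : X y -> X (h ^+ n * y).
  by move=> Xy; elim: n => [|n IH]; rewrite ?mul1g // expgS -mulgA; apply: st.
have ih : infinite_order h.
  case=> [//|n] _ E; apply: nXs.
  rewrite /translate /=; have -> : h^-1 * s = h ^+ n * s.
    by apply: (mulgI h); rewrite mulVKg mulgA -expgS E mul1g.
  exact: stn.
split=> //; exists (X `\` translate h X) => // a Aa.
have [n1 h1] : exists n, ~ X (h^-1 ^+ n * a).
  apply: (@escape X h^-1) => //; first exact: AV.
    by rewrite -[h^-1]zexp1 -/(zexp h (- 1)%R); apply: infinite_orderP => u v;
       rewrite zexp1 -[h^-1]/(zexp h (-1)%R) !zexpM => /(zexp_inj ih); lia.
  by move=> y Ay /st; rewrite mulVKg.
have [n2 h2] : exists n, ~ (A `\` X) (h ^+ n * a).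
  apply: (@escape (A `\` X) h) => //.
  - by case: X0 => x Xx; exists x; split; [exact: XA|case].
  - by rewrite bdryC.
  - by move=> y Ay [_ nX]; split=> // /st.
have {}h2 : X (h ^+ n2 * a).
  apply: contrapT => nX; apply: h2; split=> //; apply: AM => //.
  exact: (@zexp_subgroup _ A h (Posz n2)).
have [m [m1 m2]] : exists m : nat,
    ~ X (zexp h (Posz m - Posz n1)%R * a) /\ X (zexp h (Posz m.+1 - Posz n1)%R * a).
  apply: contrapT => no.
  have : forall m, ~ X (zexp h (Posz m - Posz n1)%R * a).
    elim=> [|m IH]; last by move=> Xm; apply: no; exists m.
    by rewrite zexp_sub mul1g -expVgn.
  move=> /(_ (n1 + n2)%N); have -> : (Posz (n1 + n2) - Posz n1)%R = Posz n2 by lia.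
  by apply.
exists (Posz m.+1 - Posz n1)%R; split=> //.
rewrite /translate /= mulgA -{1}[h]zexp1 -zexpN -zexpD.
by have -> : (- 1 + (Posz m.+1 - Posz n1))%R = (Posz m - Posz n1)%R by lia.
Qed.

(* Hopf: two ends give a set with finite coboundary which is infinite and
   coinfinite, and some translation maps it properly into itself. *)
Lemma two_ends_virtually_gen : ends_ge cay 2 -> ~ ends_ge cay 3 ->
  exists h, virtually_gen A h.
Proof.
move=> /(ends_ge2_bdry finS)[X [XA iX iX' fX]] n3.
have [A1 AM AV] := sA.
pose X' := A `\` X; have fX' : finite_set (bd X') by rewrite /X' bdryC.
have X'A : X' `<=` A by move=> x [].
have bI U V : finite_set (bd U) -> finite_set (bd V) -> finite_set (bd (U `&` V)).
  by move=> fU fV; apply: (sub_finite_set (@bdryI _ A S U V)); rewrite finite_setU.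
(* [A0] collects the [g] that preserve the two ends: [g X] and [X] differ by a finite set. *)
pose A0 := [set g | [/\ A g, finite_set (X `&` translate g X') & finite_set (X' `&` translate g X)]].
have trX' g a : A g -> A a -> translate g X' a <-> ~ translate g X a.
  move=> Ag Aa; split=> [[]//|h]; split=> //; apply: AM => //; exact: AV.
(* Three infinite corners among the intersections of [X], [X'] with their translates would give
   three ends, and adjacent corners cannot both be finite. So one opposite pair is finite; outside
   [A0] it is this one. *)
have split4 g : A g -> ~ A0 g ->
    finite_set (X `&` translate g X) /\ finite_set (X' `&` translate g X').
  move=> Ag nA0; pose Y := translate g X; pose Y' := translate g X'.
  have fY : finite_set (bd Y) by rewrite /Y translate_bdry //; apply: translate_finite.
  have fY' : finite_set (bd Y') by rewrite /Y' translate_bdry //; apply: translate_finite.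
  have YY' x : Y x -> ~ Y' x by move=> Yx [].
  have XX' x : X x -> ~ X' x by move=> Xx [].
  have YA : Y `<=` A by apply: translate_sub.
  have Y'A : Y' `<=` A by apply: translate_sub.
  have cutY U : infinite_set U -> U `<=` A -> ~ (finite_set (U `&` Y) /\ finite_set (U `&` Y')).
    move=> iU UA [f1 f2]; apply: iU; apply: (@sub_finite_set _ _ ((U `&` Y) `|` (U `&` Y'))).
      by move=> x Ux; have [Yx|Yx] := EM (Y x); [left|right; split=> //; apply/trX' => //; apply: UA].
    by rewrite finite_setU.
  have cutX U : infinite_set U -> U `<=` A -> ~ (finite_set (X `&` U) /\ finite_set (X' `&` U)).
    move=> iU UA [f1 f2]; apply: iU; apply: (@sub_finite_set _ _ ((X `&` U) `|` (X' `&` U))).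
      by move=> x Ux; have [Xx|Xx] := EM (X x); [left|right; split=> //; split=> //; apply: UA].
    by rewrite finite_setU.
  have three U V W : ~ finite_set U -> ~ finite_set V -> ~ finite_set W ->
      U `<=` A -> V `<=` A -> W `<=` A ->
      finite_set (bd U) -> finite_set (bd V) -> finite_set (bd W) ->
      (forall x, U x -> ~ V x) -> (forall x, U x -> ~ W x) -> (forall x, V x -> ~ W x) -> False.
    by move=> *; apply: n3; apply: (@ends_ge3 _ _ _ finS genS U V W).
  have sXY : X `&` Y `<=` A by move=> x [/XA].
  have sXY' : X `&` Y' `<=` A by move=> x [/XA].
  have sX'Y : X' `&` Y `<=` A by move=> x [/X'A].
  have sX'Y' : X' `&` Y' `<=` A by move=> x [/X'A].
  have b1 := bI _ _ fX fY; have b2 := bI _ _ fX fY'.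
  have b3 := bI _ _ fX' fY; have b4 := bI _ _ fX' fY'.
  have iY : infinite_set Y by apply: translate_infinite.
  have iY' : infinite_set Y' by apply: translate_infinite.
  have c1 := cutY _ iX XA; have c2 := cutY _ iX' X'A.
  have c3 := cutX _ iY YA; have c4 := cutX _ iY' Y'A.
  have t1 : finite_set (X `&` Y) \/ finite_set (X `&` Y') \/ finite_set (X' `&` Y).
    apply: contrapT => /not_orP[i1 /not_orP[i2 i3]].
    by apply: (three _ _ _ i1 i2 i3) => // x [Ux Vx] [Ux' Vx']; [exact: YY' Vx Vx'|exact: XX' Ux Ux'|exact: XX' Ux Ux'].
  have t2 : finite_set (X' `&` Y') \/ finite_set (X `&` Y') \/ finite_set (X' `&` Y).
    apply: contrapT => /not_orP[i1 /not_orP[i2 i3]].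
    by apply: (three _ _ _ i1 i2 i3) => // x [Ux Vx] [Ux' Vx']; [exact: XX' Ux' Ux|exact: YY' Vx' Vx|exact: XX' Ux Ux'].
  have t3 : finite_set (X `&` Y) \/ finite_set (X' `&` Y') \/ finite_set (X `&` Y').
    apply: contrapT => /not_orP[i1 /not_orP[i2 i3]].
    by apply: (three _ _ _ i1 i2 i3) => // x [Ux Vx] [Ux' Vx']; [exact: XX' Ux Ux'|exact: YY' Vx Vx'|exact: XX' Ux' Ux].
  have t4 : finite_set (X `&` Y) \/ finite_set (X' `&` Y') \/ finite_set (X' `&` Y).
    apply: contrapT => /not_orP[i1 /not_orP[i2 i3]].
    by apply: (three _ _ _ i1 i2 i3) => // x [Ux Vx] [Ux' Vx']; [exact: XX' Ux Ux'|exact: XX' Ux Ux'|exact: YY' Vx' Vx].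
  have n0 : ~ (finite_set (X `&` Y') /\ finite_set (X' `&` Y)) by move=> [f1 f2]; apply: nA0.
  tauto.
(* Two elements outside [A0] differ by an element of [A0], so a finite [A0] would make [A]
   finite. *)
have iA0 : infinite_set A0.
  move=> f0; have iA : infinite_set A by apply: infinite_sub iX.
  have [g1 [Ag1 n1] _] := infinite_notin nil (infinite_setD iA f0).
  have [f1 f1'] := split4 g1 Ag1 n1.
  apply: iA; apply: (@sub_finite_set _ _ (A0 `|` translate g1 A0)); last first.
    by rewrite finite_setU; split=> //; apply: translate_finite.
  move=> g Ag; have [g0|g0] := EM (A0 g); [by left|right].
  have [f2 f2'] := split4 g Ag g0.
  have Au : A (g1^-1 * g) by apply: AM => //; apply: AV.
  have eq Z : translate g1 (translate (g1^-1 * g) Z) = translate g Z.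
    by apply/seteqP; split=> a; rewrite /translate /= invgM invgK !mulgA mulgK.
  have fin Z : finite_set (translate g1 Z) -> finite_set Z.
    by move=> /(@translate_finite g1^-1); rewrite translateK.
  split=> //; apply: fin.
    apply: (@sub_finite_set _ _ ((X `&` translate g1 X) `|` (X' `&` translate g X'))).
      move=> a [ha1 ha2]; have {}ha2 : translate g X' a by rewrite -eq.
      have [Xa|Xa] := EM (X a); first by left.
      right; split=> //; split=> //; exact: (translate_sub Ag X'A).
    by rewrite finite_setU.
  apply: (@sub_finite_set _ _ ((X `&` translate g X) `|` (X' `&` translate g1 X'))).
    move=> a [ha1 ha2]; have {}ha2 : translate g X a by rewrite -eq.
    have [Xa|Xa] := EM (X a); first by left.
    right; split=> //; split=> //; exact: (translate_sub Ag XA).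
  by rewrite finite_setU.
(* [K] acts as a connected set containing the boundary of [X]. Once [g K] is disjoint from [K], the
   set [K] lies on one side of [g X] and [g K] on one side of [X]. *)
have [K [fK bK K1 KA hK]] := connected_hull fX (@bdry_sub _ A S X).
have [lk hlk] := (finite_listP _).1 fK.
have [g [Ag fg fg'] gK] := infinite_notin
  (List.flat_map (fun k => List.map (fun k' => k * k'^-1) lk) lk) iA0.
have dis a : K a -> ~ translate g K a.
  move=> Ka Kga; apply: gK; apply/in_flat_map; exists a; split; first exact: hlk.
  apply/in_map_iff; exists (g^-1 * a); split; last exact: hlk.
  by rewrite invgM invgK mulgA mulgV mul1g.
have X0 : X !=set0 by have [x] := infinite_notin nil iX; exists x.
have X'0 : X' !=set0 by have [x] := infinite_notin nil iX'; exists x.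
have XC : A `\` X' !=set0 by case: X0 => x Xx; exists x; split; [exact: XA|case].
have [u [v [uv Xu nXv Ku Kv]]] : exists u v, [/\ cay u v, X u, ~ X v, K u & K v].
  case: X0 => x Xx; case: X'0 => y [Ay nXy].
  have [p wp] := cayley_walk genS (XA _ Xx) Ay.
  have [u [v [uv Xu nXv _ _]]] := walk_cross wp Xx nXy.
  by exists u, v; have [/bK ? /bK ?] := bdryP uv Xu nXv.
have AVg : A g^-1 by apply: AV.
have bgX : bd (translate g X) = translate g (bd X) by apply: translate_bdry.
have cK k : K k -> translate g X 1 <-> translate g X k.
  apply: hK => a Ka; rewrite bgX => ba; apply: (dis a Ka); exact: bK.
have cgK a : translate g K a -> X g <-> X a.
  have hb b : K b -> ~ bd (translate g^-1 X) b.
    move=> Kb; rewrite translate_bdry // /translate /= invgK => /bK Kgb.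
    by apply: (dis _ Kgb); rewrite /translate /= mulKg.
  by move=> Ka; have := hK _ hb _ Ka; rewrite /translate /= invgK mulg1 mulVKg.
have hbX a : bd X a -> K a by apply: bK.
have hbX' a : bd X' a -> K a by rewrite bdryC; apply: bK.
have hbY a : bd (translate g X) a -> translate g K a by rewrite bgX; apply: bK.
have hbY' a : bd (translate g X') a -> translate g K a.
  by rewrite translate_bdry // /X' bdryC; apply: bK.
have nX'K a : K a -> (~ translate g X' a) <-> translate g X a.
  by move=> Ka; rewrite trX' //; [split=> [/contrapT|]//; tauto|apply: KA].
have tKA a : translate g K a -> A a by apply: translate_sub.
(* In each case [nested] empties one corner. The mixed cases give a strict inclusion between [X] and
   [g X]; the other two make an infinite translate finite, against the choice of [g] in [A0]. *)
have [c1|c1] := EM (translate g X 1); have [c2|c2] := EM (X g).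
- exfalso; have E : X' `&` translate g X' = set0.
    apply: (@nested X' (translate g X') K g) => //.
      by move=> a Ka; apply/nX'K => //; apply/cK.
    by move=> a Ka [_]; apply; apply/cgK.
  apply: (translate_infinite (g := g) iX'); apply: sub_finite_set fg => a ha; split=> //.
  apply: contrapT => nXa; have : (X' `&` translate g X') a.
    by split=> //; split=> //; apply: (translate_sub Ag X'A).
  by rewrite E.
- exists g^-1; have E : X `&` translate g X' = set0.
    apply: (@nested X (translate g X') K g) => //.
      by move=> a Ka; apply/nX'K => //; apply/cK.
    by move=> a Ka; rewrite -cgK.
  have XY : X `<=` translate g X.
    move=> a Xa; apply: contrapT => nY; have : (X `&` translate g X') a.
      by split=> //; apply/trX' => //; apply: XA.
    by rewrite E.
  apply: (@half_virtually_gen X g^-1) => //.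
  + by move=> a; rewrite /translate /= invgK => /XY; rewrite /translate /= mulKg.
  + exists (g^-1 * v); split; first by apply/cK.
    by rewrite /translate /= invgK mulVKg.
  + apply: (@sub_finite_set _ _ (translate g^-1 (X' `&` translate g X))); last exact: translate_finite.
    move=> a [Xa]; rewrite /translate /= invgK mulKg => na; split=> //; split=> //.
    by apply: AM => //; apply: XA.
- exists g; have E : X' `&` translate g X = set0.
    apply: (@nested X' (translate g X) K g) => //.
      by move=> a Ka; rewrite -cK.
    by move=> a Ka [_]; apply; apply/cgK.
  apply: (@half_virtually_gen X g) => //.
  + move=> a ha; apply: contrapT => nXa; have : (X' `&` translate g X) a.
      by split=> //; split=> //; apply: (translate_sub Ag XA).
    by rewrite E.
  + by exists u; split=> //; rewrite -cK.
  + apply: sub_finite_set fg => a [Xa nYa]; split=> //; apply/trX' => //; exact: XA.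
- exfalso; have E : X `&` translate g X = set0.
    apply: (@nested X (translate g X) K g) => //.
      by move=> a Ka; rewrite -cK.
    by move=> a Ka; rewrite -cgK.
  apply: (translate_infinite (g := g) iX); apply: sub_finite_set fg' => a ha; split=> //.
  split; first exact: (translate_sub Ag XA).
  by move=> Xa; have : (X `&` translate g X) a by []; rewrite E.
Qed.

End TwoEnded.

(** * Virtually infinite cyclic groups have exactly two ends *)

Section VirtuallyCyclic.
Variable G : groupType.
Implicit Types (A F : set G) (h x : G).

Lemma powers_avoid h F : infinite_order h -> finite_set F ->
  exists N, forall z, F (zexp h z) -> (`|z| < N)%N.
Proof.
move=> ih /finite_listP[l hl].
suff [N hN] : exists N, forall z, In (zexp h z) l -> (`|z| < N)%N.
  by exists N => z /hl/hN.
elim: l {hl} => [|x l [N hN]]; first by exists 0%N => z [].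
have [[w Ew]|no] := EM (exists w, x = zexp h w).
  exists (maxn N `|w|.+1) => z /= [E|/hN]; last by lia.
  by have := @zexp_inj _ h ih z w; rewrite -E Ew => /(_ erefl) ->; lia.
exists N => z /= [E|/hN//]; by case: no; exists z.
Qed.

(** With generators [T] and [h], the elements [h ^ z * t] with [z >= 0] have finite boundary, which
    gives two ends. Beyond a slab [|z| < N] containing the removed set everything is joined to one
    of two rays of powers of [h], which forbids three. *)
Lemma two_ended_vgen A h : subgroup A -> virtually_gen A h -> two_ended A.
Proof.
move=> sA vA; have [Ah ih [T0 fT0 hT0]] := vA.
have [A1 AM AV] := sA.
have Az z : A (zexp h z) by apply: zexp_subgroup.
pose T := [set t | A t /\ (T0 t \/ t = 1)].
have fT : finite_set T.
  apply: (@sub_finite_set _ _ (T0 `|` [set 1])); first by move=> t [_ [|->]]; [left|right].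
  by rewrite finite_setU; split=> //; apply: finite_set1.
have T1 : T 1 by split=> //; right.
have TA t : T t -> A t by case.
have hT a : A a -> exists z, T (zexp h z * a).
  by move=> Aa; have [z Tz] := hT0 a Aa; exists z; split; [apply: AM|left].
have {}hT a : A a -> exists z t, T t /\ a = zexp h z * t.
  move=> /hT[z Tz]; exists (- z)%R, (zexp h z * a); split=> //.
  by rewrite mulgA -zexpD GRing.addNr mul1g.
pose S := [set s | T s \/ s = h].
have fS : finite_set S.
  apply: (@sub_finite_set _ _ (T `|` [set h])); first by move=> t [|->]; [left|right].
  by rewrite finite_setU; split=> //; apply: finite_set1.
have SA s : S s -> A s by case=> [/TA//|->].
have genS : gen S = A.
  apply/seteqP; split; first exact: gen_min.
  move=> a /hT[z [t [Tt ->]]]; have [_ gM _] := gen_subgroup S.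
  apply: gM; last by apply: gen_sub; left.
  have Sgh : gen S h by apply: gen_sub; right.
  exact: (@zexp_subgroup _ (gen S) h z (gen_subgroup S) Sgh).
have [lT hlT] := (finite_listP _).1 fT.
have fslab N : finite_set [set a | exists z t, [/\ (`|z| < N)%N, T t & a = zexp h z * t]].
  apply: (@finite_cover _ _ (List.map Posz (iota 0 N) ++ List.map (fun n => (- Posz n)%R) (iota 0 N))
    (fun z a => exists2 t, T t & a = zexp h z * t)).
    move=> z; apply/finite_listP; exists (List.map (fun t => zexp h z * t) lT).
    by move=> a [t /hlT ? ->]; apply/in_map_iff; exists t.
  move=> a [z [t [zN Tt ->]]]; exists z; last by exists t.
  apply/in_app_iff; have zi : In `|z|%N (iota 0 N) by apply/In_mem; rewrite mem_iota.
  by case: (boolP (0 <= z)%R) => z0; [left|right]; apply/in_map_iff; exists `|z|%N; split=> //; lia.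
have iP (f : nat -> int) : injective f -> infinite_set (range (fun n => zexp h (f n))).
  by move=> fi; apply: infinite_nat_injection => m n /(zexp_inj ih)/fi.
exists S; split=> //.
- pose X := [set a | exists z t, [/\ (0 <= z)%R, T t & a = zexp h z * t]].
  apply: (@ends_ge2 _ _ _ fS genS X).
  + by move=> a [z [t [_ Tt ->]]]; apply: AM => //; apply: TA.
  + have Pi : injective Posz by move=> m n [].
    apply: infinite_sub (iP _ Pi).
    by move=> x [n _ <-]; exists (Posz n), 1; split=> //; rewrite mulg1.
  + have [N hN] := powers_avoid ih fT.
    have Ni : injective (fun n => (- Posz (n + N.+1))%R) by move=> m n; lia.
    apply: infinite_sub (iP _ Ni).
    move=> x [n _ <-]; split=> // -[z [t [z0 Tt E]]].
    have : T (zexp h (- z - Posz (n + N.+1))%R).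
      by rewrite zexpD E mulgA -zexpD GRing.addNr mul1g.
    by move=> /hN; lia.
  (* Right multiplication by a generator changes the exponent of [h] by less than [B], so an edge
     leaving [X] starts in the slab [|z| < B]. *)
  + have [B hB] : exists B, forall t s, T t -> S s -> exists z1 z2 t1 t2,
        [/\ (`|z1| < B)%N, (`|z2| < B)%N, T t1 /\ T t2, t * s = zexp h z1 * t1 & t * s^-1 = zexp h z2 * t2].
      have [lS hlS] := (finite_listP _).1 fS.
      have [f hf] : {f : G -> int & forall a, A a -> exists t, T t /\ a = zexp h (f a) * t}.
        apply: (@choice _ _ (fun a z => A a -> exists t, T t /\ a = zexp h z * t)) => a.
        by have [/hT[z ?]|?] := EM (A a); [exists z|exists 0%R].
      exists (\max_(a <- List.flat_map (fun t => List.map (fun s => t * s) lS ++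
          List.map (fun s => t * s^-1) lS) lT) `|f a|).+1 => t s Tt Ss.
      have [t1 [Tt1 E1]] := hf (t * s) (AM _ _ (TA _ Tt) (SA _ Ss)).
      have [t2 [Tt2 E2]] := hf (t * s^-1) (AM _ _ (TA _ Tt) (AV _ (SA _ Ss))).
      exists (f (t * s)), (f (t * s^-1)), t1, t2; split=> //; rewrite ltnS;
        apply: (leq_bigmax_seq (F := fun a => `|f a|%N)) => //; apply/In_mem/in_flat_map;
        exists t; (split; first exact: hlT); apply/in_app_iff; [left|right];
        by apply/in_map_iff; exists s; split=> //; apply: hlS.
    have key a b : cayley A S a b -> X a -> ~ X b -> [set a | exists z t, [/\ (`|z| < B)%N, T t & a = zexp h z * t]] a.
      move=> [_ _ _ [s Ss E]] [z [t [z0 Tt Ea]]] nXb; exists z, t; split=> //.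
      have [z1 [z2 [t1 [t2 [b1 b2 [Tt1 Tt2] E1 E2]]]]] := hB t s Tt Ss.
      rewrite ltnNge; apply/negP => Bz; apply: nXb; case: E => E.
        exists (z + z1)%R, t1; split=> //; first by lia.
        by rewrite zexpD -mulgA -E1 E Ea mulgA.
      exists (z + z2)%R, t2; split=> //; first by lia.
      by rewrite zexpD -mulgA -E2 mulgA -Ea E mulgK.
    have fsl := fslab B.
    apply: (@sub_finite_set _ _ ([set a | exists z t, [/\ (`|z| < B)%N, T t & a = zexp h z * t]] `|`
      [set w | exists2 k, [set a | exists z t, [/\ (`|z| < B)%N, T t & a = zexp h z * t]] k & cayley A S k w])).
      move=> a [b ab hab]; have [Xa|Xa] := EM (X a).
        by left; apply: (key a b ab Xa); apply/hab.
      have Xb : X b by apply: contrapT => /hab.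
      by right; exists b; [exact: (key b a (cayley_sym ab) Xb Xa)|exact: cayley_sym].
    by rewrite finite_setU; split=> //; apply: neighbours_finite.
- move=> [K [fK [f [hf fi]]]].
  have [lK hlK] := (finite_listP _).1 fK.
  have [N hN] : exists N, forall z t, T t -> K (zexp h z * t) -> (`|z| < N)%N.
    have [|N hN] := @powers_avoid h [set x | exists2 t, T t & K (x * t)] ih.
      apply: (@finite_cover _ _ lT (fun t x => K (x * t))) => [t|x [t /hlT ? ?]]; last by exists t.
      apply/finite_listP; exists (List.map (fun k => k * t^-1) lK) => x /hlK ?.
      by apply/in_map_iff; exists (x * t); rewrite mulgK.
    by exists N => z t Tt Kt; apply: hN; exists t.
  pose co := conn_off (cayley A S) K.
  have coS u v : co u v -> co v u.
    elim=> [x y [xy nx ny]|x|x y z _ h1 _ h2]; last exact: rt_trans h2 h1.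
      by apply: rt_step; split=> //; apply: cayley_sym.
    exact: rt_refl.
  have nKz z t : T t -> (N <= `|z|)%N -> ~ K (zexp h z * t).
    by move=> Tt Nz /(hN _ _ Tt); lia.
  have nKz1 z : (N <= `|z|)%N -> ~ K (zexp h z) by move=> Nz; rewrite -[zexp h z]mulg1; apply: nKz.
  have step u s : A u -> S s -> ~ K u -> ~ K (u * s) -> co u (u * s).
    move=> Au Ss nu nus; have [E|E] := EM (u = u * s); first by rewrite -E; apply: rt_refl.
    apply: rt_step; split=> //; split=> //; first by apply: AM => //; apply: SA.
    by exists s => //; left.
  have Sh : S h by right.
  have up n : co (zexp h (Posz N)) (zexp h (Posz (N + n))).
    elim: n => [|n IH]; first by rewrite addn0; apply: rt_refl.
    apply: rt_trans IH _; have -> : zexp h (Posz (N + n.+1)) = zexp h (Posz (N + n)) * h.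
      by rewrite addnS -[X in _ * X]zexp1 -zexpD; congr zexp; lia.
    apply: step => //; first by apply: nKz1; lia.
    by rewrite -[X in _ * X]zexp1 -zexpD; apply: nKz1; lia.
  have down n : co (zexp h (- Posz N)%R) (zexp h (- Posz (N + n))%R).
    elim: n => [|n IH]; first by rewrite addn0; apply: rt_refl.
    apply: rt_trans IH _; apply: coS.
    have -> : zexp h (- Posz (N + n))%R = zexp h (- Posz (N + n.+1))%R * h.
      by rewrite -[X in _ * X]zexp1 -zexpD; congr zexp; lia.
    apply: step => //; first by apply: nKz1; lia.
    by rewrite -[X in _ * X]zexp1 -zexpD; apply: nKz1; lia.
  have reach i : co (f i) (zexp h (Posz N)) \/ co (f i) (zexp h (- Posz N)%R).
    have [nKi ci] := hf i.
    have [y [fy ny] _] := infinite_notin nil (infinite_setD ci (fslab N)).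
    have Ay := infinite_component ci fy.
    have [z [t [Tt Ey]]] := hT y Ay.
    have Nz : (N <= `|z|)%N by rewrite leqNgt; apply/negP => zN; apply: ny; exists z, t.
    have yz : co (f i) (zexp h z).
      apply: rt_trans (fy) _; apply: coS; rewrite Ey; apply: step => //; first by left.
        exact: nKz1.
      exact: nKz.
    case: (boolP (0 <= z)%R) => z0; [left|right].
      apply: rt_trans yz _; apply: coS; have -> : z = Posz (N + (`|z| - N)) by lia.
      exact: up.
    apply: rt_trans yz _; apply: coS; have -> : z = (- Posz (N + (`|z| - N)))%R by lia.
    exact: down.
  have same i j w : co (f i) w -> co (f j) w -> i = j.
    by move=> ci cj; apply: fi; apply: rt_trans ci (coS _ _ cj).
  pose i0 : 'I_3 := Ordinal (isT : (0 < 3)%N).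
  pose i1 : 'I_3 := Ordinal (isT : (1 < 3)%N).
  pose i2 : 'I_3 := Ordinal (isT : (2 < 3)%N).
  have n01 : i0 <> i1 by move=> /(congr1 val).
  have n02 : i0 <> i2 by move=> /(congr1 val).
  have n12 : i1 <> i2 by move=> /(congr1 val).
  case: (reach i0) => c0; case: (reach i1) => c1; case: (reach i2) => c2;
  solve [by case: n01; apply: same c0 c1|by case: n02; apply: same c0 c2|by case: n12; apply: same c1 c2].
Qed.

Lemma two_ended_virtually_gen A : two_ended A -> exists h, virtually_gen A h.
Proof. by move=> [S [fS gS e2 e3]]; apply: (two_ends_virtually_gen fS gS). Qed.

Lemma one_ended_infinite A : one_ended A -> infinite_set A.
Proof.
move=> [S [fS gS [K [fK [f [hf _]]]] _]]; have [_ iw] := hf ord0.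
apply: infinite_sub (iw) => y; exact: (infinite_component iw).
Qed.

End VirtuallyCyclic.

(** * Hyperbolic fine graphs *)

Section Hyperbolic.
Variables (V : Type) (adj : V -> V -> Prop).
Hypothesis adjS : forall u v, adj u v -> adj v u.
Hypothesis conn : connected_graph adj.
Local Notation d := (dist adj).

Lemma walk_of_fun (r : V -> V -> Prop) (f : nat -> V) a n :
  (forall i, (a <= i < a + n)%N -> r (f i) (f i.+1)) ->
  exists q, [/\ walk r (f a) q (f (a + n)%N), size q = n
    & forall v, In v (f a :: q) <-> exists2 i, (a <= i <= a + n)%N & v = f i].
Proof.
elim: n a => [|n IH] a h.
  exists nil; rewrite addn0; split=> // v; split=> [[<-|//]|[i hi ->]]; first by exists a; rewrite ?leqnn.
  by left; congr f; lia.
have [|q [wq sq hq]] := IH a.+1; first by move=> i hi; apply: h; lia.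
exists (f a.+1 :: q); split; last 1 first.
- move=> v; split=> [[<-|/hq[i hi ->]]|[i hi ->]]; first by exists a => //; lia.
    by exists i => //; lia.
  have [->|ai] := eqVneq i a; [by left|right]; apply/hq; exists i => //; lia.
- by split; [apply: h; lia|rewrite addnS -addSn].
- by rewrite /= sq.
Qed.

Lemma walk_mem x p y v : walk adj x p y -> In v (x :: p) ->
  exists q1 q2, [/\ walk adj x q1 v, walk adj v q2 y & (size q1 + size q2 = size p)%N].
Proof.
elim: p x => [|u p IH] x /= => [-> [<-|//]|[xu w] [<-|vu]].
- by exists nil, nil.
- by exists nil, (u :: p).
- have [q1 [q2 [w1 w2 E]]] := IH u w vu.
  by exists (u :: q1), q2; split=> //=; rewrite -E.
Qed.

Lemma walk_ball x p y v : walk adj x p y -> In v (x :: p) -> (d x v <= size p)%N.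
Proof.
by move=> w /(walk_mem w)[q1 [q2 [/(dist_le conn) h _ E]]]; lia.
Qed.

Lemma geodesic_mem x p y v : geodesic adj x p y -> In v (x :: p) ->
  (d x v + d v y <= d x y)%N.
Proof.
move=> [w g] /(walk_mem w)[q1 [q2 [/(dist_le conn) h1 /(dist_le conn) h2 E]]].
by have [q [wq _] <-] := geodesic_exists conn x y; have := g q wq; lia.
Qed.

Lemma walk_within (P : V -> Prop) x p y : walk adj x p y ->
  (forall v, In v (x :: p) -> P v) -> walk (fun u v => adj u v /\ (P u /\ P v)) x p y.
Proof.
elim: p x => //= u p IH x [xu w] h; split; last by apply: IH => // v hv; apply: h; right.
by split=> //; split; apply: h; [left|right; left].
Qed.

Definition four_point c := forall x y z w,
  (d x z + d y w <= maxn (d x y + d z w) (d x w + d y z) + c)%N.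

(** The sides through [y] and through [w] are compared with one geodesic from [x] to [z]: [c i] and
    [c j] serve as projections of [y] and [w], each with error [2 * e + 2], and [y] is joined to [w]
    through them. *)
Lemma hyperbolic_four_point : hyperbolic_graph adj -> exists c, four_point c.
Proof.
have dS := dist_sym adjS conn; have dT := dist_tri conn.
move=> [e thin]; exists (4 * e + 4)%N => x y z w.
have [c [c0 cn ca cd]] := geodesic_fun conn x z.
set n := d x z in cn ca cd *.
(* Some vertex of the side [c] is close to both other sides of the triangle xzy'. *)
have tri y' : exists i, [/\ (i <= n)%N, (i + d (c i) y' <= d x y' + 2 * e + 2)%N
    & (n - i + d (c i) y' <= d z y' + 2 * e + 2)%N].
  have [q gq _] := geodesic_exists conn z y'.
  have [r gr _] := geodesic_exists conn x y'.
  have [|p [wp sp hp]] := @walk_of_fun adj c 0 n; first by move=> i; apply: ca.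
  rewrite add0n c0 cn in wp.
  have gp : geodesic adj x p z.
    by split=> // p' /(dist_le conn); rewrite sp.
  pose P i := (i + d (c i) y' <= d x y' + 2 * e)%N.
  pose Q i := (n - i + d (c i) y' <= d z y' + 2 * e)%N.
  have dxi i : (i <= n)%N -> d x (c i) = i by move=> hi; rewrite -{1}c0 cd ?subn0.
  have dzi i : (i <= n)%N -> d z (c i) = (n - i)%N by move=> hi; rewrite dS -{1}cn cd ?hi /=.
  have PQ i : (i <= n)%N -> P i \/ Q i.
    move=> hi; have ci : In (c i) (x :: p) by rewrite -{1}c0; apply/hp; exists i.
    have [v [s [hv /(dist_le conn) ws se]]] := thin x z y' p q r gp gq gr _ ci.
    case: hv => hv; [right|left].
      have := geodesic_mem gq hv; rewrite /Q -(dzi i hi).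
      by have := dT v (c i) y'; have := dT v z (c i); have := dS (c i) v; lia.
    have := geodesic_mem gr hv; rewrite /P -{1}(dxi i hi).
    by have := dT v (c i) y'; have := dT v x (c i); have := dS (c i) v; lia.
  have P0 : P 0%N by rewrite /P c0; lia.
  have Qn : Q n by rewrite /Q cn; lia.
  apply: contrapT => no.
  have all i : (i <= n)%N -> P i.
    elim: i => [//|i IH] hi; have Pi := IH (ltnW hi).
    have [//|Qi] := PQ _ hi; exfalso; apply: no.
    exists i; have := dT (c i.+1) (c i) y'; have := dist_adj conn (ca i hi).
    by move: Pi Qi; rewrite /P /Q => *; split; lia.
  by apply: no; exists n; have := all n (leqnn n); move: Qn; rewrite /P /Q; split; lia.
have [i [hi i1 i2]] := tri y; have [j [hj j1 j2]] := tri w.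
have := dT (c i) y w; have := dT (c j) (c i) w; have := dS y (c i); have := dS w (c j).
have := dS y z; have := dS w z.
have [ij|ji] := leqP i j.
  by rewrite (cd i j) ?ij //; lia.
by rewrite [d (c i) (c j)]dS (cd j i) ?hi ?(ltnW ji) //; lia.
Qed.

End Hyperbolic.

Section Isometries.
Variables (G : groupType) (K : gGraph G).
Hypothesis conn : connected_graph (@adj G K).
Local Notation d := (dist (@adj G K)).

Lemma walk_act g (x : K) p y : walk adj x p y ->
  walk adj (act g x) [seq act g z | z <- p] (act g y).
Proof. by apply: walk_map => u v; apply: act_adj. Qed.

Lemma dist_act g (x y : K) : d (act g x) (act g y) = d x y.
Proof.
have h k (u v : K) : (d (act k u) (act k v) <= d u v)%N.
  have [p [wp _] <-] := geodesic_exists conn u v.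
  by have := dist_le conn (walk_act k wp); rewrite size_map.
apply/eqP; rewrite eqn_leq h /=.
by have := h g^-1 (act g x) (act g y); rewrite !actK.
Qed.

Variable c : nat.
Hypothesis fp : four_point (@adj G K) c.
Let dS := dist_sym (@adj_sym G K) conn.
Let dT := dist_tri conn.

Section Segment.
Variables (f : nat -> K) (p q : K) (D : nat).
Hypotheses (f0 : f 0%N = p) (fe : f (d p q) = q)
  (fd : forall i j, (i <= j <= d p q)%N -> d (f i) (f j) = (j - i)%N).

Lemma seg_dist_l i : (i <= d p q)%N -> d p (f i) = i.
Proof. by move=> hi; rewrite -f0 fd ?subn0. Qed.

Lemma seg_dist_r i : (i <= d p q)%N -> d (f i) q = (d p q - i)%N.
Proof. by move=> hi; rewrite -{1}fe fd ?hi /=. Qed.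

(** Two four-point inequalities, with [g p] and [g q] as auxiliary points; the margins [D + c]
    exclude in each the term containing the displacement of [p] or of [q]. *)
Lemma seg_near g i : (d p (act g p) <= D)%N -> (d q (act g q) <= D)%N ->
  (D + c < i)%N -> (i + D + c < d p q)%N ->
  (d p (act g (f i)) + d (act g (f i)) q <= d p q + 2 * c)%N.
Proof.
move=> hp hq i1 i2; set z := act g (f i).
have e1 : d (act g p) z = i by rewrite dist_act seg_dist_l //; lia.
have e2 : d z (act g q) = (d p q - i)%N by rewrite dist_act seg_dist_r //; lia.
have e3 : d (act g p) (act g q) = d p q by apply: dist_act.
have := fp p (act g p) z (act g q); have := fp z p q (act g q).
have := dT (act g p) p z; have := dT p (act g p) z; have := dT z q (act g q).
have := dT z (act g q) q.
have := dS (act g p) p; have := dS (act g q) q; have := dS z p; have := dS z (act g p).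
by lia.
Qed.

Lemma seg_close g i j : (d p (act g p) <= D)%N -> (d q (act g q) <= D)%N ->
  (D + c < i)%N -> (i + D + c < d p q)%N -> (j <= d p q)%N ->
  (d (f j) (act g (f i)) <= (j - d p (act g (f i))) + (d p (act g (f i)) - j) + 3 * c)%N.
Proof.
move=> hp hq i1 i2 jl; have := seg_near hp hq i1 i2; set z := act g (f i).
have e1 := seg_dist_l jl; have e2 := seg_dist_r jl.
have := fp (f j) p z q; have := dS (f j) p; have := dS z p.
lia.
Qed.

Lemma seg_disp g i : (i <= d p q)%N ->
  (i <= d p (act g (f i)) + d p (act g p))%N /\ (d p (act g (f i)) <= i + d p (act g p))%N.
Proof.
move=> il; have e1 : d (act g p) (act g (f i)) = i by rewrite dist_act seg_dist_l.
by have := dT (act g p) p (act g (f i)); have := dT p (act g p) (act g (f i)); have := dS p (act g p); lia.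
Qed.

(** The displacement along the geodesic is the same at [i] and at [j], up to [c]; this is what makes
    a translation length meaningful. *)
Lemma seg_shift g i j : (d p (act g p) <= D)%N -> (D + c < i)%N -> (i <= j)%N -> (j <= d p q)%N ->
  (d p (act g (f i)) + j <= d p (act g (f j)) + i + c)%N /\
  (d p (act g (f j)) + i <= d p (act g (f i)) + j + c)%N.
Proof.
move=> hp i1 ij jl.
have e1 : d (act g p) (act g (f i)) = i by rewrite dist_act seg_dist_l //; lia.
have e2 : d (act g p) (act g (f j)) = j by rewrite dist_act seg_dist_l //; lia.
have e3 : d (act g (f i)) (act g (f j)) = (j - i)%N by rewrite dist_act fd // ij.
have := fp p (act g p) (act g (f i)) (act g (f j)); have := fp p (act g p) (act g (f j)) (act g (f i)).
have := dS (act g (f i)) (act g (f j)).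
have := dT (act g p) p (act g (f i)); have := dT (act g p) p (act g (f j)).
have := dS p (act g p); lia.
Qed.

End Segment.

(* Elements moving two very distant points by a bounded amount act on the
   middle of a geodesic joining them as almost-translations; [s g] is the
   translation length, positive towards [q]. *)
Lemma segment_shift D L : exists M, forall p q : K, (M <= d p q)%N ->
  exists (s : G -> int) (y1 y2 : K), [/\ (L <= d y1 y2)%N,
    forall g, (d p (act g p) <= D)%N -> (d q (act g q) <= D)%N ->
      [/\ (`|s g| <= d p (act g p))%N, (d y1 (act g y1) <= `|s g| + 4 * c)%N
        & (d y2 (act g y2) <= `|s g| + 4 * c)%N]
    & forall g h, (d p (act g p) <= D)%N -> (d q (act g q) <= D)%N ->
      (d p (act h p) <= D)%N -> (d q (act h q) <= D)%N ->
      (absz (s (g * h)%g - s g - s h)%R <= 4 * c)%N].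
Proof.
(* Far enough from [p] that [d p (act h (f m))], which is at least [m - D], still exceeds the
   threshold [D + c] of the preceding lemmas. *)
pose m := (2 * D + c + 1)%N.
exists (m + L + 2 * D + c + 1)%N => p q hpq.
have [f [f0 fe _ fd]] := geodesic_fun conn p q.
exists (fun g => Posz (d p (act g (f m))) - Posz m)%R, (f m), (f (m + L)%N).
have ml : (m <= d p q)%N by lia.
have near := @seg_close f p q D f0 fe fd; have disp := @seg_disp f p q f0 fd.
have shift := @seg_shift f p q D f0 fd.
split.
- by rewrite fd; lia.
- move=> g gp gq; have [h1 h2] := disp g m ml.
  split; first by lia.
    by have := near g m m gp gq; lia.
  have [|||s1 s2] := @shift g m (m + L)%N gp; [by lia..|].
  by have := near g (m + L)%N (m + L)%N gp gq; lia.
- move=> g h gp gq hp hq; have [h1 h2] := disp h m ml; rewrite /= actM.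
  (* [h (f m)] is within [3 * c] of [f i], and [g] shifts [f i] as much as [f m] up to [c]; hence
     additivity up to [4 * c]. *)
  set i := d p (act h (f m)).
  have : (d (f i) (act h (f m)) <= 3 * c)%N.
    have il : (i <= d p q)%N by lia.
    by have := near h m i hp hq _ _ il; rewrite -/i subnn; apply; lia.
  have : d (act g (f i)) (act g (act h (f m))) = d (f i) (act h (f m)) by apply: dist_act.
  have := dT (act g (f i)) p (act g (act h (f m))).
  have := dT (act g (act h (f m))) p (act g (f i)).
  have := dS (act g (f i)) (act g (act h (f m))).
  have [im|mi] := leqP i m.
    by have [|||s1 s2] := @shift g i m gp; lia.
  by have [|||s1 s2] := @shift g m i gp; lia.
Qed.

End Isometries.

(** * Fineness makes the action on K acylindrical *)

Section Acylindricity.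
Variables (G : groupType) (K : gGraph G).
Hypothesis conn : connected_graph (@adj G K).
Local Notation d := (dist (@adj G K)).
Variable c : nat.
Hypothesis fp : four_point (@adj G K) c.
Hypothesis fine : fine_graph (@adj G K).
Hypothesis finE : forall u v : K, adj u v -> finite_set (estab u v).
Hypothesis cofin : exists E : set (K * K), finite_set E /\
          forall u v : K, adj u v ->
            exists g e, [/\ E e, u = act g e.1 & v = act g e.2].
Let dS := dist_sym (@adj_sym G K) conn.
Let dT := dist_tri conn.

(** There are finitely many orbits of edges, so an invariant bound that exists for each edge is
    uniform. *)
Lemma edge_orbit_bound (phi : K -> K -> nat -> Prop) :
  (forall u v m n, (m <= n)%N -> phi u v m -> phi u v n) ->
  (forall g u v n, phi u v n -> phi (act g u) (act g v) n) ->
  (forall u v, adj u v -> exists n, phi u v n) ->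
  exists n, forall u v, adj u v -> phi u v n.
Proof.
move=> mono inv ex; have [E [/finite_listP[l hl] hE]] := cofin.
have [n hn] : exists n, forall e, In e l -> adj e.1 e.2 -> phi e.1 e.2 n.
  elim: l {hl} => [|e l [n hn]]; first by exists 0%N.
  have [ae|nae] := EM (adj e.1 e.2); last first.
    by exists n => e' /= [<-//|/hn].
  have [m hm] := ex _ _ ae; exists (maxn m n) => e' /= [<-|/hn h] a.
    by apply: mono hm; lia.
  by apply: mono (h a); lia.
exists n => u v uv; have [g [e [Ee eu ev]]] := hE u v uv.
rewrite eu ev; apply/inv/hn; first exact: hl.
by move: uv; rewrite eu ev adj_actE.
Qed.

Lemma edge_stabilizer_bound : exists N, forall u v : K, adj u v ->
  forall s : seq G, uniq s -> (forall g, g \in s -> estab u v g) -> (size s <= N)%N.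
Proof.
apply: (@edge_orbit_bound (fun u v N => forall s : seq G, uniq s ->
  (forall g, g \in s -> estab u v g) -> (size s <= N)%N)).
- by move=> u v m n mn h s us hs; apply: leq_trans mn; apply: h.
- move=> g u v n h s us hs; rewrite -(size_map (fun x => x ^ g)); apply: h.
    by rewrite map_inj_uniq //; apply: conjg_inj.
  move=> x /mapP[y /hs ys ->]; move: ys; rewrite estab_act => /conjsE.
  by rewrite invgK.
- move=> u v uv; have [l hl] := (finite_listP _).1 (finE uv).
  exists (size l) => s us hs; rewrite -(muln1 (size l)).
  apply: (@uniq_bound _ _ l (fun j g => j = g)) us _ _; first by move=> g /hs/hl ?; exists g.
  move=> j [|x [|y t]] //= /andP[xt _] h; exfalso; move: xt.
  by rewrite -(h x (mem_head _ _)) (h y _) ?mem_head // inE mem_head orbT.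
Qed.

(** The endpoints are added for the degenerate loop that, once simplified, runs along the edge and
    back. *)
Definition circuit_nbhd n (u u' v : K) := v = u \/ v = u' \/
  exists q, [/\ circuit adj u (u' :: q), (size (u' :: q) <= n)%N & In v (u' :: q)].

Lemma circuit_act g (u : K) q : circuit adj u q -> circuit adj (act g u) [seq act g z | z <- q].
Proof.
move=> [w n s]; split; [exact: walk_act|apply: FinFun.Injective_map_NoDup n|by rewrite size_map].
exact: can_inj (actK g).
Qed.

Lemma circuit_nbhd_bound n : exists N, forall u u' : K, adj u u' ->
  exists2 F : seq K, (size F <= N)%N & forall v, circuit_nbhd n u u' v -> In v F.
Proof.
apply: (@edge_orbit_bound (fun u u' N => exists2 F : seq K, (size F <= N)%N &
  forall v, circuit_nbhd n u u' v -> In v F)).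
- by move=> u v m m' mm [F sF hF]; exists F => //; apply: leq_trans mm.
- move=> g u u' m [F sF hF]; exists [seq act g z | z <- F]; first by rewrite size_map.
  move=> v hv; apply/in_map_iff; exists (act g^-1 v); split; first exact: actKV.
  apply: hF; case: hv => [->|[->|[q [cq sq vq]]]]; [by left; rewrite actK|by right; left; rewrite actK|].
  right; right; exists [seq act g^-1 z | z <- q]; split.
  + by have := circuit_act g^-1 cq; rewrite /= !actK.
  + by rewrite /= size_map.
  + by case: vq => [<-|vq]; [left; rewrite actK|right; apply/in_map_iff; exists v].
- move=> u u' uu'; pose P k := [set p | circuit adj u (u' :: p) /\ size (u' :: p) = k].
  have [l hl] : exists l, forall p, circuit adj u (u' :: p) -> (size (u' :: p) <= n)%N -> In p l.
    have : finite_set [set p | circuit adj u (u' :: p) /\ (size (u' :: p) <= n)%N].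
      apply: (@finite_cover _ _ (iota 0 n.+1) P); first by move=> k; apply: fine.
      by move=> p [cp sp]; exists (size (u' :: p)) => //; apply/In_mem; rewrite mem_iota; lia.
    by move=> /finite_listP[l hl]; exists l => p cp sp; apply: hl.
  exists (size (u :: u' :: List.concat l)), (u :: u' :: List.concat l) => //.
  move=> v [->|[->|[q [cq sq /= [<-|vq]]]]]; [by left|by right; left|by right; left|].
  by right; right; apply/in_concat; exists q; split=> //; apply: hl.
Qed.

Variables (f : nat -> K) (p q : K) (C M : nat).
Hypotheses (f0 : f 0%N = p) (fe : f (d p q) = q)
  (fa : forall i, (i < d p q)%N -> adj (f i) (f i.+1))
  (fd : forall i j, (i <= j <= d p q)%N -> d (f i) (f j) = (j - i)%N).
Let R := (3 * c)%N.
Hypotheses (hM1 : (2 * C + c + R < M)%N) (hM2 : (M + 1 + R + 2 * C + c < d p q)%N).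
Let lo := (M - R - C)%N.
Let hi := (M + 1 + R + C)%N.

(* The two almost parallel geodesics [f] and [g f], with short connections far
   from the middle edge of [f], form a loop crossing this edge only once,
   unless [g f] crosses it too. *)
Lemma middle_edge g : (d p (act g p) <= C)%N -> (d q (act g q) <= C)%N ->
  exists l, [/\ (lo <= l < hi)%N,
    circuit_nbhd (4 * R + 2 * R + 2 * C + 2) (f M) (f M.+1) (act g (f l))
    & circuit_nbhd (4 * R + 2 * R + 2 * C + 2) (f M) (f M.+1) (act g (f l.+1))].
Proof.
move=> gp gq; set nb := circuit_nbhd _ _ _.
(* [P] separates [f M.+1] from [f M]. Edges of type [r1] do not cross it; those of type [r2] belong
   to [g f]. The connecting paths start at distance [R] from the middle edge and have length at most
   [R], so they stay on one side. *)
pose P z := (M.+1 <= d p z)%N.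
pose r1 z z' := adj z z' /\ (P z <-> P z').
pose r2 z z' := exists l, (lo <= l < hi)%N /\
  ((z = act g (f l) /\ z' = act g (f l.+1)) \/ (z' = act g (f l) /\ z = act g (f l.+1))).
pose r z z' := r1 z z' \/ r2 z z'.
have rS z z' : r z z' -> r z' z.
  case=> [[zz h]|[l [hl h]]]; [left; split; [exact: adj_sym|by rewrite h]|].
  by right; exists l; split=> //; case: h; [right|left].
have radj z z' : r z z' -> adj z z'.
  case=> [[]//|[l [hl h]]].
  have a : adj (act g (f l)) (act g (f l.+1)) by apply: act_adj; apply: fa; rewrite /hi in hl; lia.
  by case: h => [[-> ->]//|[-> ->]]; apply: adj_sym.
have dl := seg_dist_l f0 fd.
have gVp : (d p (act g^-1 p) <= C)%N by rewrite -(dist_act conn g) actKV dS.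
have gVq : (d q (act g^-1 q) <= C)%N by rewrite -(dist_act conn g) actKV dS.
have connect i : (i = M - R \/ i = M + 1 + R)%N -> exists j s,
    [/\ (lo <= j <= hi)%N, walk adj (f i) s (act g (f j)) & (size s <= R)%N].
  move=> hi0; pose j := d p (act g^-1 (f i)).
  have il : (i <= d p q)%N by lia.
  have [j1 j2] := seg_disp conn f0 fd g^-1 il; rewrite -/j in j1 j2.
  have := seg_close conn fp f0 fe fd gVp gVq _ _ (_ : (j <= d p q)%N); rewrite -/j => close.
  have {}close : (d (f j) (act g^-1 (f i)) <= R)%N.
    have := @close i; rewrite -/j subnn => h; apply: h; lia.
  rewrite -(dist_act conn g) actKV dS in close.
  have [s [ws _] ss] := geodesic_exists conn (f i) (act g (f j)).
  by exists j, s; split=> //; [rewrite /lo /hi; lia|rewrite ss].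
have [j1 [s1 [hj1 ws1 ss1]]] := connect (M + 1 + R)%N (or_intror erefl).
have [j2 [s2 [hj2 ws2 ss2]]] := connect (M - R)%N (or_introl erefl).
have w1 : exists2 s, walk r (f M.+1) s (f (M + 1 + R)%N) & (size s <= R)%N.
  have [|s [ws ss _]] := @walk_of_fun _ r f M.+1 R.
    move=> i hi0; left; split; first by apply: fa; lia.
    by rewrite /P !dl; lia.
  by exists s; [move: ws; rewrite addn1|rewrite ss].
have w5 : exists2 s, walk r (f (M - R)%N) s (f M) & (size s <= R)%N.
  have [|s [ws ss _]] := @walk_of_fun _ r f (M - R)%N R.
    move=> i hi0; left; split; first by apply: fa; lia.
    by rewrite /P !dl; lia.
  by exists s; [move: ws; rewrite subnK //; lia|rewrite ss].
have w2 : walk r (f (M + 1 + R)%N) s1 (act g (f j1)).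
  apply: walk_sub (walk_within (P := P) ws1 _); first by move=> u v [uv [Pu Pv]]; left.
  move=> v hv; have := walk_ball conn ws1 hv; rewrite /P.
  have := dT v p (f (M + 1 + R)%N); rewrite dl; last by lia.
  by rewrite [d v _]dS; lia.
have w4 : walk r (f (M - R)%N) s2 (act g (f j2)).
  apply: walk_sub (walk_within (P := fun z => ~ P z) ws2 _); first by move=> u v [uv [Pu Pv]]; left.
  move=> v hv; have := walk_ball conn ws2 hv; rewrite /P.
  have := dT (f (M - R)%N) p v; rewrite dl; last by lia.
  by lia.
have w3 a b : (lo <= a <= hi)%N -> (lo <= b <= hi)%N ->
    exists2 s, walk r (act g (f a)) s (act g (f b)) & (size s <= 2 * R + 2 * C + 1)%N.
  have h a' b' : (lo <= a' <= hi)%N -> (lo <= b' <= hi)%N -> (a' <= b')%N ->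
      exists2 s, walk r (act g (f a')) s (act g (f b')) & (size s <= 2 * R + 2 * C + 1)%N.
    move=> ha hb ab; have [|s [ws ss _]] := @walk_of_fun _ r (fun i => act g (f i)) a' (b' - a').
      by move=> i hi0; right; exists i; split; [lia|left].
    exists s; first by move: ws; rewrite subnKC.
    by rewrite ss; rewrite /lo /hi in ha hb; lia.
  move=> ha hb; have [ab|/ltnW ba] := leqP a b; first exact: h.
  have [s ws ss] := h b a hb ha ba; have [s' [ws' ss' _]] := walk_rev rS ws.
  by exists s'; rewrite ?ss'.
have [t1 wt1 st1] := w1; have [t5 wt5 st5] := w5; have [t3 wt3 st3] := w3 j1 j2 hj1 hj2.
have [t4 [wt4 st4 _]] := walk_rev rS w4.
have W := walk_trans (walk_trans (walk_trans (walk_trans wt1 w2) wt3) wt4) wt5.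
have [t [wt nt st _]] := walk_simple W.
(* Four of the five pieces have length at most [R], and the part of [g f] has length at most
   [2 * R + 2 * C + 1]. *)
have {}st : (size t <= 4 * R + 2 * R + 2 * C + 1)%N.
  by apply: leq_trans st _; rewrite !size_cat; lia.
have PM1 : P (f M.+1) by rewrite /P dl //; lia.
have PM : ~ P (f M) by rewrite /P dl; [lia|lia].
have [u [v [uv Pu Pv hu hv]]] := @walk_cross _ _ (fun z => P z) _ _ _ wt PM1 PM.
have {}uv : r2 u v by case: uv => // -[_ h]; case: Pv; apply/h.
have aM : adj (f M) (f M.+1) by apply: fa; lia.
have hnb z : In z (f M.+1 :: t) -> nb z.
  move=> hz; case: t wt nt st hu hv hz => [|t0 [|t1' t']] wt nt st hu hv hz.
  - by case: hz => [<-|[]]; right; left.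
  - move: wt => /= [_ E]; move: hz => /= [<-|[<-|[]]]; first by right; left.
    by rewrite E; left.
  right; right; exists [:: t0, t1' & t']; split; [|by move: st => /=; lia|by []].
  by split=> //; split; [exact: aM|exact: walk_sub wt].
have [l [hl h]] := uv; exists l; split=> //; case: h => [[Eu Ev]|[Ev Eu]].
- by rewrite -Eu; apply: hnb.
- by rewrite -Ev; apply: hnb; right.
- by rewrite -Ev; apply: hnb; right.
- by rewrite -Eu; apply: hnb.
Qed.

End Acylindricity.

Section Loxodromic.
Variables (G : groupType) (K : gGraph G).
Hypothesis conn : connected_graph (@adj G K).
Local Notation d := (dist (@adj G K)).
Variable c : nat.
Hypothesis fp : four_point (@adj G K) c.
Hypothesis fine : fine_graph (@adj G K).
Hypothesis finE : forall u v : K, adj u v -> finite_set (estab u v).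
Hypothesis cofin : exists E : set (K * K), finite_set E /\
          forall u v : K, adj u v ->
            exists g e, [/\ E e, u = act g e.1 & v = act g e.2].
Let dS := dist_sym (@adj_sym G K) conn.
Let dT := dist_tri conn.

(** Up to an edge stabilizer of size at most [N2], an element is determined by the index of an edge
    that it moves near the middle edge, with [2 * R + 2 * C + 1] choices, and by the images of its
    two ends, with [N1] choices each. *)
Lemma acylindrical_action C : exists L N, forall x y : K, (L <= d x y)%N ->
  forall s : seq G, uniq s ->
  (forall g, g \in s -> (d x (act g x) <= C)%N /\ (d y (act g y) <= C)%N) ->
  (size s <= N)%N.
Proof.
pose R := (3 * c)%N; pose M := (2 * C + c + R + 1)%N; pose lm := (4 * R + 2 * R + 2 * C + 2)%N.
have [N1 hN1] := circuit_nbhd_bound fine cofin lm.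
have [N2 hN2] := edge_stabilizer_bound finE cofin.
exists (M + 1 + R + 2 * C + c + 1)%N, ((2 * R + 2 * C + 1) * (N1 * N1) * N2)%N => x y xy s us hs.
have [f [f0 fe fa fd]] := geodesic_fun conn x y.
have hM1 : (2 * C + c + R < M)%N by lia.
have hM2 : (M + 1 + R + 2 * C + c < d x y)%N by lia.
have aM : adj (f M) (f M.+1) by apply: fa; lia.
have [F sF hF] := hN1 _ _ aM.
pose J := List.list_prod (iota (M - R - C) (2 * R + 2 * C + 1)) (List.list_prod F F).
apply: (@leq_trans (size J * N2)%N); last first.
  by rewrite leq_mul2r /J !size_list_prod size_iota leq_mul2l !leq_mul ?orbT.
apply: (@uniq_bound _ _ J (fun j g => [/\ (j.1.+1 <= d x y)%N, act g (f j.1) = j.2.1 & act g (f j.1.+1) = j.2.2])) us _ _.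
  move=> g /hs[gx gy].
  have [l [hl n1 n2]] := middle_edge conn fp f0 fe fa fd hM1 hM2 gx gy.
  exists (l, (act g (f l), act g (f l.+1))); last by split=> //=; lia.
  apply/in_prod; last by apply/in_prod; apply: hF.
  by apply/In_mem; rewrite mem_iota; lia.
move=> [l [v v']] [//|g0 t] ut ht.
have [hl E1 E2] : [/\ (l.+1 <= d x y)%N, act g0 (f l) = v & act g0 (f l.+1) = v'] by apply: (ht g0); rewrite mem_head.
rewrite -(size_map (fun g => g0^-1 * g)); apply: (hN2 (f l) (f l.+1)); first exact: fa.
  by rewrite map_inj_uniq //; apply: mulgI.
move=> g /mapP[g' /ht[_ /= F1 F2] ->]; split; rewrite /vstab /= actM.
  by rewrite F1 -E1 actK.
by rewrite F2 -E2 actK.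
Qed.

(* The elements commuting with a power of [h] fall into finitely many cosets
   of the powers of [h]: on a long geodesic from [x] to [h^k x] they all act as
   almost-translations, as does some power of [h], with a large translation
   length; so each can be composed with a power of [h] to get an element of
   bounded translation length, and there are few of these. *)
Lemma centralizer_cosets (x : K) h : (forall B, exists k, (B <= d x (act (h ^+ k) x))%N) ->
  exists N, forall s : seq G, uniq s -> (N < size s)%N ->
    (forall g, g \in s -> exists2 n, (0 < n)%N & commute g (h ^+ n)) ->
    exists g g' z, [/\ g \in s, g' \in s, g <> g' & g' * g^-1 = zexp h z].
Proof.
move=> unb.
have ih : infinite_order h.
  move=> n n0 En; pose B := \max_(k <- iota 0 n) d x (act (h ^+ k) x).
  have [k hk] := unb B.+1; move: hk; rewrite (divn_eq k n) expgnDr mulnC expgnA En expg1n mul1g.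
  have : (d x (act (h ^+ (k %% n)) x) <= B)%N.
    by apply: (leq_bigmax_seq (F := fun k => d x (act (h ^+ k) x))) => //; rewrite mem_iota ltn_pmod.
  by move=> le; rewrite ltnNge le.
pose c4 := (4 * c)%N.
(* [c4] bounds the failure of additivity of the shift. Among [N1 + 1] powers of [h] one has shift
   above [7 * c4 + 8], since otherwise all would move [y1] and [y2] by at most [8 * c4 + 8]. *)
have [L1 [N1 acyl1]] := acylindrical_action (8 * c4 + 8).
pose D0 := \max_(i <- iota 0 N1.+1) d x (act (h ^+ i) x).
pose C2 := (D0 + 3 * c4 + 1)%N.
have [L2 [N2 acyl2]] := acylindrical_action (C2 + c4).
exists N2 => s us ss hs; apply: contrapT => no.
pose DF := \max_(g <- s) d x (act g x).
(* [J] bounds the exponents [z0 * j] used below, where [|z0| <= N1] and [|j| <= DF + 1]; [D] bounds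
   the displacement of [x] by all resulting products. *)
pose J := (N1 * DF.+1)%N.
pose zs := [seq Posz i | i <- iota 0 J.+1] ++ [seq (- Posz i)%R | i <- iota 0 J.+1].
pose D := (\max_(g <- [seq (zexp h z * g)%g | z <- zs, g <- 1%g :: s]) d x (act g x) + D0)%N.
have [M hM] := segment_shift conn fp D (maxn L1 L2).
have [n n0 hn] : exists2 n, (0 < n)%N & forall g, g \in s -> commute g (h ^+ n).
  elim: s hs {us ss no DF J zs D M hM} => [|g s IH] hs; first by exists 1%N.
  have [|n n0 hn] := IH; first by move=> g' g's; apply: hs; rewrite inE g's orbT.
  have [m m0 hm] := hs g (mem_head _ _).
  exists (m * n)%N; first by rewrite muln_gt0 m0.
  move=> g'; rewrite inE => /orP[/eqP->|/hn h']; first by rewrite expgnA; apply: commuteX.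
  by rewrite mulnC expgnA; apply: commuteX.
have [k hk] : exists k, (M <= d x (act (h ^+ (n * k)) x))%N.
  have [k hk] := unb (M + \max_(i <- iota 0 n) d x (act (h ^+ i) x))%N.
  exists (k %/ n)%N; move: hk; rewrite {1}(divn_eq k n) [(_ * n + _)%N]addnC expgnDr actM [(_ * n)%N]mulnC.
  have : (d x (act (h ^+ (k %% n)) x) <= \max_(i <- iota 0 n) d x (act (h ^+ i) x))%N.
    by apply: (leq_bigmax_seq (F := fun k => d x (act (h ^+ k) x))) => //; rewrite mem_iota ltn_pmod.
  set a := h ^+ (k %% n); set b := h ^+ _.
  have := dT (act a x) x (act a (act b x)); rewrite (dist_act conn).
  by lia.
set y := act _ x in hk.
have [sg [y1 [y2 [y12 hs1 hs2]]]] := hM x y hk.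
(* [y] is the image of [x] under a power of [h ^+ n], so an element commuting with [h ^+ n] moves
   both equally far, as [segment_shift] requires. *)
have cy g : commute g (h ^+ n) -> d y (act g y) = d x (act g x).
  move=> cg; rewrite /y -actM expgnA; have -> : g * h ^+ n ^+ k = h ^+ n ^+ k * g by apply: commuteX.
  by rewrite actM (dist_act conn).
have ch z : commute (zexp h z) (h ^+ n) by rewrite -[h ^+ n]/(zexp h (Posz n)) /commute zexpC.
have ok z g : (`|z| <= J)%N -> g \in 1%g :: s ->
    [/\ commute (zexp h z * g) (h ^+ n), (d x (act (zexp h z * g)%g x) <= D)%N &
        (d y (act (zexp h z * g)%g y) <= D)%N].
  move=> zJ gs; have cg : commute (zexp h z * g) (h ^+ n).
    apply: commute_sym; apply: commuteM; apply: commute_sym; first exact: ch.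
    by move: gs; rewrite inE => /orP[/eqP->|/hn//]; apply: commute_sym; apply: commute1.
  have dx : (d x (act (zexp h z * g)%g x) <= D)%N.
    apply: leq_trans (leq_addr _ _).
    apply: (leq_bigmax_seq (F := fun g => d x (act g x))) => //.
    apply/allpairsP; exists (z, g); split=> //=; rewrite mem_cat.
    case: (boolP (0 <= z)%R) => z0; apply/orP; [left|right]; apply/mapP; exists `|z|%N; rewrite ?mem_iota; lia.
  by split=> //; rewrite cy.
have okz z : (`|z| <= J)%N -> (d x (act (zexp h z) x) <= D)%N /\ (d y (act (zexp h z) y) <= D)%N.
  by move=> zJ; have [_] := ok z 1%g zJ (mem_head _ _); rewrite mulg1.
have sg0 : sg 1%g = 0%R.
  have [d1 d2] := okz 0%R (leq0n _).
  by have [h0 _ _] := hs1 _ d1 d2; move: h0; rewrite zexp0 act1 (distxx conn); lia.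
have N1J : (N1 <= J)%N by rewrite /J; nia.
have [i iN1 hi] : exists2 i : nat, (i <= N1)%N & (7 * c4 + 8 < `|sg (zexp h (Posz i))|)%N.
  apply: contrapT => nox.
  have : (size [seq zexp h (Posz i) | i <- iota 0 N1.+1] <= N1)%N.
    apply: (acyl1 y1 y2); first by move: y12; rewrite geq_max => /andP[].
      by rewrite map_inj_uniq ?iota_uniq // => u v /(zexp_inj ih)[].
    move=> g /mapP[i]; rewrite mem_iota => hi ->.
    have le : (`|sg (zexp h (Posz i))| <= 7 * c4 + 8)%N.
      by rewrite leqNgt; apply/negP => lt; apply: nox; exists i => //; lia.
    have [|d1 d2] := okz (Posz i); first by rewrite /=; lia.
    by have [_] := hs1 _ d1 d2; rewrite -/c4; lia.
  by rewrite size_map size_iota; lia.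
have dxi : (d x (act (zexp h (Posz i)) x) <= D0)%N.
  by apply: (leq_bigmax_seq (F := fun k => d x (act (h ^+ k) x))) => //; rewrite mem_iota; lia.
(* An element and its inverse have nearly opposite shifts, so one of [h ^ i] and its inverse has a
   large positive one. *)
have [z0 z0N [z01 z02]] : exists2 z, (`|z| <= N1)%N & (Posz (6 * c4 + 8) < sg (zexp h z))%R /\
    (sg (zexp h z) <= Posz D0)%R.
  have [|d1 d2] := okz (Posz i); first by rewrite /=; lia.
  have [|e1 e2] := okz (- Posz i)%R; first by lia.
  have [b1 _ _] := hs1 _ d1 d2; have [b2 _ _] := hs1 _ e1 e2.
  have := hs2 _ _ d1 d2 e1 e2; rewrite -zexpD GRing.addrN zexp0 sg0 -/c4 => b3.
  have Ei : d x (act (zexp h (- Posz i)%R) x) = d x (act (zexp h (Posz i)) x).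
    by rewrite zexpN -(dist_act conn (zexp h (Posz i))) actKV dS.
  rewrite Ei in b2; have [pos|neg] := boolP (0 <= sg (zexp h (Posz i)))%R.
    by exists (Posz i); [lia|split; lia].
  by exists (- Posz i)%R; [lia|split; lia].
have dxg g : g \in s -> (d x (act g x) <= DF)%N.
  by move=> gs; apply: (leq_bigmax_seq (F := fun g => d x (act g x))).
(* Each increment of [j] raises the shift by at least 1 and at most [C2]. Starting from absolute
   value at most [DF], it is at most [C2] in absolute value after at most [DF] steps. *)
have shift_back g : g \in s -> exists2 j : int, (`|j| <= DF)%N &
    (`|sg (zexp h (z0 * j)%R * g)%g| <= C2)%N.
  move=> gs; pose a j := sg (zexp h (z0 * j)%R * g)%g.
  have zJ (j : int) : (`|j| <= DF.+1)%N -> (`|(z0 * j)%R| <= J)%N.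
    by move=> hj; rewrite abszM /J; apply: leq_mul.
  have gs1 : g \in 1%g :: s by rewrite inE gs orbT.
  have step j : (`|j| <= DF.+1)%N -> (`|(j + 1)%R| <= DF.+1)%N ->
     (a j + 1 <= a (j + 1)%R)%R /\ (a (j + 1)%R <= a j + Posz C2)%R.
    move=> h1 h2; have [_ d1 d2] := ok _ _ (zJ _ h1) gs1.
    have [e1 e2] := okz z0 (leq_trans z0N N1J).
    have := hs2 _ _ e1 e2 d1 d2; rewrite mulgA -zexpD.
    have -> : (z0 + z0 * j)%R = (z0 * (j + 1))%R by lia.
    by rewrite -/(a j) -/(a (j + 1)%R) -/c4 /C2; split; lia.
  have a0 : (`|a 0%R| <= DF)%N.
    have [_ d1 d2] := ok 0%R g (leq0n _) gs1; have [b _ _] := hs1 _ d1 d2.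
    by apply: leq_trans (dxg _ gs); rewrite /a GRing.mulr0; move: b; rewrite zexp0 mul1g.
  have descent : forall N (b : nat -> int), (0 <= b 0%N)%R -> (b 0%N <= Posz N)%R ->
      (forall n, (n < N)%N -> (b n.+1 + 1 <= b n)%R /\ (b n <= b n.+1 + Posz C2)%R) ->
      exists2 n, (n <= N)%N & (0 <= b n)%R /\ (b n <= Posz C2)%R.
    elim=> [|N IH] b b0 bN hb; first by exists 0%N => //; split; lia.
    have [le|gt] := boolP (b 0%N <= Posz C2)%R; first by exists 0%N.
    have [s1 s2] := hb 0%N isT.
    have [||m|m mN [m1 m2]] := IH (fun m => b m.+1); [by move=> /=; lia|by move=> /=; lia|exact: (hb m.+1)|].
    by exists m.+1.
  have [pos|neg] := boolP (0 <= a 0%R)%R.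
    have [||m mD|m mD [m1 m2]] := descent DF (fun m => a (- Posz m)%R);
      [by []|by rewrite /= -[a _]/(a 0%R); lia| |].
      have [||s1 s2] := step (- Posz m.+1)%R; [lia|lia|].
      have E : (- Posz m.+1 + 1)%R = (- Posz m)%R by lia.
      by rewrite E in s1 s2; split; lia.
    by exists (- Posz m)%R; [lia|rewrite -/(a _); lia].
  have [||m mD|m mD [m1 m2]] := descent DF (fun m => (- a (Posz m))%R);
    [by rewrite /= -[a _]/(a 0%R); lia|by rewrite /= -[a _]/(a 0%R); lia| |].
    have [||s1 s2] := step (Posz m); [lia|lia|].
    have E : (Posz m + 1)%R = Posz m.+1 by lia.
    by rewrite E in s1 s2; split; lia.
  by exists (Posz m); [lia|rewrite -/(a _); lia].
have [j hj] : {j : G -> int & forall g, g \in s -> (`|j g| <= DF)%N /\ (`|sg (zexp h (z0 * j g)%R * g)%g| <= C2)%N}.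
  apply: (@choice _ _ (fun g (j : int) => g \in s -> (`|j| <= DF)%N /\ (`|sg (zexp h (z0 * j)%R * g)%g| <= C2)%N)) => g.
  by have [gs|gs] := boolP (g \in s); [have [j ? ?] := shift_back g gs; exists j|exists 0%R].
(* The corrected elements move [y1] and [y2] by at most [C2 + c4]; if two of them coincided, the
   originals would differ by a power of [h]. *)
have : (size [seq (zexp h (z0 * j g)%R * g)%g | g <- s] <= N2)%N.
  apply: (acyl2 y1 y2); first by move: y12; rewrite geq_max => /andP[].
    rewrite map_inj_in_uniq // => g g' gs g's E; apply: contrapT => gg'; apply: no.
    exists g, g', (z0 * j g - z0 * j g')%R; split=> //.
    rewrite GRing.addrC zexpD zexpN; apply: (mulgI (zexp h (z0 * j g')%R)).
    by rewrite mulgA -E mulgK mulVKg.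
  move=> g /mapP[g' g's ->]; have [j1 j2] := hj g' g's.
  have zJ : (`|(z0 * j g')%R| <= J)%N by rewrite abszM /J; apply: leq_mul => //; lia.
  have gs1 : g' \in 1%g :: s by rewrite inE g's orbT.
  have [_ d1 d2] := ok _ _ zJ gs1; have [_ b1 b2] := hs1 _ d1 d2.
  by rewrite -/c4 in b1 b2; split; lia.
by rewrite size_map leqNgt ss.
Qed.

End Loxodromic.

(** * Pair stabilizers and bounded orbits in fine graphs *)

Section FineGraphs.
Variables (G : groupType) (K : gGraph G).
Hypothesis conn : connected_graph (@adj G K).
Local Notation d := (dist (@adj G K)).
Hypothesis fine : fine_graph (@adj G K).
Hypothesis finE : forall u v : K, adj u v -> finite_set (estab u v).
Hypothesis cofin : exists E : set (K * K), finite_set E /\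
          forall u v : K, adj u v ->
            exists g e, [/\ E e, u = act g e.1 & v = act g e.2].

Definition avoiding (w a b : K) := adj a b /\ a <> w /\ b <> w.

Lemma avoiding_sym w a b : avoiding w a b -> avoiding w b a.
Proof. by move=> [ab [aw bw]]; split; first exact: adj_sym. Qed.

Lemma walk_avoiding (w x : K) p y : walk adj x p y -> ~ In w (x :: p) ->
  walk (avoiding w) x p y.
Proof.
move=> wp nw; apply: walk_sub (walk_within (P := fun z => z <> w) wp _); first by [].
by move=> v hv E; apply: nw; rewrite -E.
Qed.

Lemma walk_avoiding_In w x p y : x <> w -> walk (avoiding w) x p y -> ~ In w (x :: p).
Proof.
elim: p x => [|u p IH] x xw /= => [_ [//|//]|[[_ [_ uw]] h] [//|]].
exact: (IH u uw h).
Qed.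

(** Two such arcs with different first vertices contain a circuit through both first edges, of
    length at most [2 * n + 2]. Fixing one of the arcs, fineness bounds the other first edges. *)
Lemma finitely_many_arcs (w w' : K) n : w <> w' ->
  finite_set [set z | adj w z /\ exists2 p, walk (avoiding w) z p w' & (size p <= n)%N].
Proof.
move=> ww'; set A := [set z | _]; apply: contrapT => iA.
have [z' [wz' [p' wp' sp']] _] := infinite_notin nil iA.
have [N hN] := circuit_nbhd_bound fine cofin (2 * n + 2)%N.
have [F _ hF] := hN w z' wz'; apply: iA; apply/finite_listP; exists F => z [wz [p wp sp]].
apply: hF; have [->|zz'] := EM (z = z'); first by right; left.
right; right; have [q [wq sq _]] := walk_rev (@avoiding_sym w) wp.
have [t [wt nt st _]] := walk_simple (walk_trans wp' wq).
have zw : z' <> w by move=> E; apply: (@adj_irr _ _ w); rewrite -{2}E.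
have nw := walk_avoiding_In zw wt.
have {}st : (size t <= 2 * n)%N by apply: leq_trans st _; rewrite size_cat sq; lia.
exists (t ++ [:: w]); split.
- split.
  + split=> //; apply: walk_rcons (adj_sym wz).
    by apply: walk_sub wt => a b [].
  + apply: (@NoDup_app _ (z' :: t) [:: w]) => //; first by constructor=> //; constructor.
    by move=> a ha [E|[]]; apply: nw; rewrite E.
  + rewrite /= size_cat /=; case: t wt {nt st nw} => [|? ?] /= => [E|_]; last by lia.
    by case: zz'.
- by rewrite /= size_cat /=; lia.
- have /= := walk_end wt; rewrite in_app_iff; tauto.
Qed.

(** Elements fixing [u] and [v] move the first edge of a fixed path from [u] to [v] to finitely many
    places; two with the same effect differ by an element of a finite edge stabilizer. *)
Lemma vstab_pair_finite (u v : K) : u <> v -> finite_set (vstab u `&` vstab v).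
Proof.
move=> uv; apply: contrapT => iS.
have [p0 wp0] := conn u v; have [p [wp np _ _]] := walk_simple wp0.
case: p wp np => [//|z p] [uz wp] np.
have wa : walk (avoiding u) z p v by apply: walk_avoiding wp _; inversion np.
have [l hl] := (finite_listP _).1 (finitely_many_arcs (size p) uv).
have [|z1 _ i1] := @infinite_fiber _ _ (fun s => act s z) l _ iS.
  move=> s [su sv]; apply: hl; split; first by rewrite -su; apply: act_adj.
  exists [seq act s a | a <- p]; last by rewrite size_map.
  rewrite -sv; apply: walk_map wa => a b [ab [au bu]]; split; first exact: act_adj.
  by split; rewrite -su => /(can_inj (actK s)).
have [s0 [[s0u s0v] s0z] _] := infinite_notin nil i1.
have /finite_listP[m hm] := finE uz.
apply: i1; apply/finite_listP; exists (List.map (fun t => s0 * t) m) => s [[su sv] sz].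
apply/in_map_iff; exists (s0^-1 * s); split; first by rewrite mulVKg.
by apply: hm; split; rewrite /vstab /= actM ?su ?sz -?s0z ?actK // -{1}s0u actK.
Qed.

(** Induction on the length, as in Koenig's lemma: either the first steps from [v] are
    finite-to-one, or infinitely many paths share a first step and the search continues from
    there. *)
Lemma branch_vertex (y : nat -> K) n (v : K) (I : set nat) : injective y -> infinite_set I ->
  (forall i, I i -> exists p, [/\ walk adj v p (y i), NoDup (v :: p) & (size p <= n)%N]) ->
  exists w (J : set nat) (z : nat -> K), [/\ infinite_set J,
    forall i, J i -> adj w (z i) /\ exists2 p, walk (avoiding w) (z i) p (y i) & (size p <= n)%N
    & forall u, finite_set [set i | J i /\ z i = u]].
Proof.
move=> yi; elim: n v I => [|n IH] v I iI hI.
  have [|i [j [Ii Ij ij E]]] := @infinite_pair _ _ _ y [:: v] iI.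
    by move=> i /hI[[|a p] [wp _ //]]; left.
  by case: ij; apply: yi.
pose I1 := [set i | I i /\ y i <> v].
have iI1 : infinite_set I1.
  suff fv : finite_set [set i | y i = v].
    by apply: infinite_sub (infinite_setD iI fv) => i [].
  have [[i0 E0]|no] := EM (exists i, y i = v).
    by apply/finite_listP; exists [:: i0] => i E; left; apply: yi; rewrite E0.
  by apply/finite_listP; exists nil => i E; apply: no; exists i.
have [z hz] : {z : nat -> K & forall i, I1 i -> adj v (z i) /\
    exists p, [/\ walk adj (z i) p (y i), NoDup (v :: z i :: p) & (size p <= n)%N]}.
  apply: (@choice _ _ (fun i z => I1 i -> adj v z /\
    exists p, [/\ walk adj z p (y i), NoDup (v :: z :: p) & (size p <= n)%N])) => i.
  have [[Ii yv]|no] := EM (I1 i); last by exists v => Ii; case: no.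
  have [[|z p] [wp np sp]] := hI i Ii; first by case: yv.
  by exists z => _; case: wp => vz wp; split=> //; exists p.
have [fz|] := EM (forall u, finite_set [set i | I1 i /\ z i = u]).
  exists v, I1, z; split=> // i /hz[vz [p [wp np sp]]]; split=> //.
  exists p; last exact: leqW.
  by apply: walk_avoiding wp _; inversion np.
move=> /existsNP[u iu].
have [|w [J [z' [iJ hJ fJ]]]] := IH u _ iu.
  by move=> i [/hz[_ [p [wp np sp]]] <-]; exists p; split=> //; inversion np.
exists w, J, z'; split=> // i /hJ[wz [p wp sp]]; split=> //; exists p => //; exact: leqW.
Qed.

(* A bounded infinite orbit accumulates at a vertex [w], in the sense that
   short paths from [w] to infinitely many of its points leave [w] along
   different edges; fineness forces [w] to be fixed. *)
Lemma bounded_orbit_fixes (x : K) h B : (forall k, (d x (act (h ^+ k) x) <= B)%N) ->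
  exists2 n, (0 < n)%N & exists v : K, act (h ^+ n) v = v.
Proof.
move=> hB; apply: contrapT => no.
have nofix n (v : K) : (0 < n)%N -> act (h ^+ n) v <> v by move=> n0 E; apply: no; exists n => //; exists v.
have inj (t : K) i j : act (h ^+ i) t = act (h ^+ j) t -> i = j.
  wlog ij : i j / (i <= j)%N.
    by move=> W; have [/W//|/ltnW/W h1 E] := leqP i j; rewrite h1.
  move: ij; rewrite leq_eqVlt => /orP[/eqP//|ij] E; exfalso.
  apply: (nofix (j - i)%N t); first by rewrite subn_gt0.
  apply: (can_inj (actK (h ^+ i))); rewrite -actM -expgnDr subnKC; [by rewrite E|exact: ltnW].
pose y i := act (h ^+ i) x.
have [|w [J [z [iJ hJ fJ]]]] := @branch_vertex y B x setT (inj x) infinite_nat.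
  move=> i _; have [p [wp _] sp] := geodesic_exists conn x (y i).
  have [q [wq nq sq _]] := walk_simple wp; exists q; split=> //.
  by apply: leq_trans sq _; rewrite sp; apply: hB.
have hw : act h w <> w by have := nofix 1%N w; rewrite expg1; apply.
have [cl wcl] := conn x (act h x).
(* Since [h ^ i t = w] determines [i], for almost all [i] the translated path from [y i] to [y i.+1]
   avoids [w]. *)
have fbad : finite_set [set i | exists2 t, In t (x :: cl) & act (h ^+ i) t = w].
  apply: (@finite_cover _ _ (x :: cl) (fun t i => act (h ^+ i) t = w)); last by move=> i [t ? ?]; exists t.
  move=> t; have [[i0 E0]|none] := EM (exists i, act (h ^+ i) t = w).
    by apply/finite_listP; exists [:: i0] => i E; left; apply: (inj t); rewrite E0.
  by apply/finite_listP; exists nil => i E; apply: none; exists i.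
have iJ2 := infinite_setD iJ fbad; set J2 := [set x | _] in iJ2.
have [q hq] : {q : nat -> seq K & forall i, J i -> walk (avoiding w) (z i) (q i) (y i) /\ (size (q i) <= B)%N}.
  apply: (@choice _ _ (fun i q => J i -> walk (avoiding w) (z i) q (y i) /\ (size q <= B)%N)) => i.
  have [Ji|Ji] := EM (J i); last by exists nil.
  by have [_ [p ? ?]] := hJ i Ji; exists p.
have zw i : J i -> z i <> w.
  by move=> Ji E; have [wz _] := hJ i Ji; rewrite E in wz; apply: adj_irr wz.
have yS i : act h (y i) = y i.+1 by rewrite /y -actM -expgS.
(* The image under [h] of the arc to [y i] starts next to [h w]. If it meets [w], it contains an arc
   from [h w] to [w]; if not, it completes the original arc to one from [w] to [h w]. Each
   possibility allows finitely many [i]. *)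
pose through i := In w [seq act h a | a <- z i :: q i].
have wh i : J i -> walk (avoiding (act h w)) (act h (z i)) [seq act h a | a <- q i] (y i.+1).
  move=> Ji; have [wq _] := hq i Ji; rewrite -yS; apply: walk_map wq => a b [ab [aw bw]].
  by split; [exact: act_adj|split=> /(can_inj (actK h))].
have fA : finite_set [set i | J2 i /\ ~ through i].
  have ww : w <> act h w by move=> E; apply: hw.
  have [l hl] := (finite_listP _).1 (finitely_many_arcs (B + size cl + B + 1) ww).
  apply: contrapT => iA; have [|u _ []] := @infinite_fiber _ _ z l _ iA; last first.
    by apply: sub_finite_set (fJ u) => i [[[Ji _] _] zi].
  move=> i [[Ji nbad] nt]; apply: hl; split; first by have [] := hJ i Ji.
  have [wq sq] := hq i Ji.
  have wc : walk (avoiding w) (y i) [seq act (h ^+ i) a | a <- cl] (y i.+1).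
    have E : y i.+1 = act (h ^+ i) (act h x) by rewrite -actM -expgSr.
    rewrite E; apply: walk_avoiding; first exact: walk_act.
    move=> hin; have [t [Et ht]] := (in_map_iff (act (h ^+ i)) (x :: cl) w).1 hin.
    by apply: nbad; exists t.
  have wr0 : walk (avoiding w) (act h (z i)) [seq act h a | a <- q i] (y i.+1).
    apply: walk_avoiding => //; first by apply: walk_sub (wh i Ji) => a b [].
  have [r [wr sr _]] := walk_rev (@avoiding_sym w) wr0.
  exists (q i ++ [seq act (h ^+ i) a | a <- cl] ++ r ++ [:: act h w]).
    apply: walk_trans wq _; apply: walk_trans wc _; apply: walk_rcons wr _.
    split; first by apply: adj_sym; apply: act_adj; have [] := hJ i Ji.
    by split=> // E; apply: nt; left.
  by rewrite !size_cat sr !size_map /=; lia.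
have fB : finite_set [set i | J2 i /\ through i].
  have [l hl] := (finite_listP _).1 (finitely_many_arcs B hw).
  apply: contrapT => iB; have [|u _ []] := @infinite_fiber _ _ (fun i => act h (z i)) l _ iB; last first.
    apply: sub_finite_set (fJ (act h^-1 u)) => i [[[Ji _] _] zi]; split=> //.
    by rewrite -zi actK.
  move=> i [[Ji nbad] ti]; apply: hl; split; first by apply: act_adj; have [] := hJ i Ji.
  have wadj : walk adj (act h (z i)) [seq act h a | a <- q i] (y i.+1).
    by apply: walk_sub (wh i Ji) => a b [].
  have hz0 : act h (z i) <> act h w by move=> /(can_inj (actK h)); apply: zw.
  have [q1 [q2 [w1 w2 E]]] := walk_mem (wh i Ji) ti.
  exists q1 => //; have [_] := hq i Ji; move: E; rewrite size_map; lia.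
apply: iJ2; apply: (@sub_finite_set _ _ ([set i | J2 i /\ ~ through i] `|` [set i | J2 i /\ through i])).
  by move=> i Ji; have [ti|ti] := EM (through i); [right|left].
by rewrite finite_setU.
Qed.

End FineGraphs.

(** * Maximal elementary subgroups *)

Section Cosets.
Variable G : groupType.
Implicit Types (P T : set G) (g h : G).

(** Elements of [P] in distinct cosets are chosen greedily; if no finite set met all cosets, the
    choice could be continued past [N]. *)
Lemma finitely_many_cosets P h N :
  (forall s : seq G, uniq s -> (N < size s)%N -> (forall g, g \in s -> P g) ->
    exists g g' z, [/\ g \in s, g' \in s, g <> g' & g' * g^-1 = zexp h z]) ->
  exists2 T : set G, finite_set T & forall g, P g -> exists z, T (zexp h z * g).
Proof.
move=> hN; apply: contrapT => no.
have grow n : exists s : seq G, [/\ uniq s, size s = n, forall g, g \in s -> P g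
   & forall g g' z, g \in s -> g' \in s -> g <> g' -> g' * g^-1 <> zexp h z].
  elim: n => [|n [s [us ss sP sne]]]; first by exists nil.
  have [g Pg ng] : exists2 g, P g & forall z, zexp h z * g \notin s.
    apply: contrapT => nog; apply: no; exists [set g | g \in s].
      by apply/finite_listP; exists s => g /In_mem.
    move=> g Pg; apply: contrapT => nz; apply: nog; exists g => // z.
    by apply/negP => zs; apply: nz; exists z.
  exists (g :: s); split=> //=.
  - by rewrite us andbT -[g]mul1g -(zexp0 h).
  - by rewrite ss.
  - by move=> g'; rewrite inE => /orP[/eqP ->|/sP].
  - move=> a b z; rewrite !inE => /orP[/eqP->|sa] /orP[/eqP->|sb] ab E //.
    + by move: (ng z); rewrite -E mulgVK sb.
    + move: (ng (- z)%R); rewrite zexpN -E invgM invgK mulgVK.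
      by rewrite sa.
    + exact: sne E.
have [s [us ss sP sne]] := grow N.+1.
have [|g [g' [z [gs g's gg' E]]]] := hN s us _ sP; first by rewrite ss.
exact: sne E.
Qed.

(** The elementary closure of a loxodromic [h], usually called [E(h)]; the elements inverting a
    power of [h] are those exchanging its two limit points. *)
Definition reversing_normalizer h : set G :=
  [set g | exists2 n, (0 < n)%N & (h ^+ n) ^ g = h ^+ n \/ (h ^+ n) ^ g = (h ^+ n)^-1].

Lemma conj_expM g h n k : (h ^+ n) ^ g = h ^+ n \/ (h ^+ n) ^ g = (h ^+ n)^-1 ->
  (h ^+ (n * k)) ^ g = h ^+ (n * k) \/ (h ^+ (n * k)) ^ g = (h ^+ (n * k))^-1.
Proof.
rewrite expgnA => E.
have -> : ((h ^+ n) ^+ k) ^ g = ((h ^+ n) ^ g) ^+ k by exact/esym/(zexpJ _ _ (Posz k)).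
by case: E => ->; [left|right; rewrite expVgn].
Qed.

Lemma reversing_normalizer_subgroup h : subgroup (reversing_normalizer h).
Proof.
split=> [|x y [n n0 hn] [m m0 hm]|x [n n0 hn]].
- by exists 1%N => //; left; rewrite conjg1.
- exists (n * m)%N; first by rewrite muln_gt0 n0.
  have {}hm := conj_expM n hm; rewrite mulnC in hm.
  rewrite conjgM; case: (conj_expM m hn) => ->; first exact: hm.
  rewrite conjVg; case: hm => ->; [by right|by left; rewrite invgK].
- exists n => //; case: hn => E; first by left; rewrite -{1}E conjgK.
  by right; rewrite -[X in X ^ _]invgK -E conjVg conjgK.
Qed.

(** The elements commuting with a power of [h] have index at most two: the quotient of two reversing
    elements commutes with a common power. *)
Lemma reversing_normalizer_finite h T :
  finite_set T -> (forall g, (exists2 n, (0 < n)%N & commute g (h ^+ n)) ->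
    exists z, T (zexp h z * g)) ->
  exists2 T' : set G, finite_set T' & forall g, reversing_normalizer h g -> exists z, T' (zexp h z * g).
Proof.
move=> fT hT.
have com g n : commute g (h ^+ n) <-> (h ^+ n) ^ g = h ^+ n.
  rewrite conjgE; split=> [E|E]; first by rewrite -E mulKg.
  by rewrite /commute -{1}E mulVKg.
have [[e0 [n0 n00 E0] ne0]|none] := EM (exists2 e, reversing_normalizer h e &
    ~ exists2 n, (0 < n)%N & commute e (h ^+ n)); last first.
  exists T => // g rg; apply: hT; apply: contrapT => ng; apply: none; by exists g.
have /finite_listP[l hl] := fT.
exists (T `|` [set x | T (x * e0^-1)]).
  rewrite finite_setU; split=> //; apply/finite_listP; exists (List.map (fun t => t * e0) l).
  by move=> x /hl ?; apply/in_map_iff; exists (x * e0^-1); rewrite mulgVK.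
move=> g [m m0 Em].
have [cg|ng] := EM (exists2 n, (0 < n)%N & commute g (h ^+ n)).
  by have [z Tz] := hT g cg; exists z; left.
have [|z Tz] := hT (g * e0^-1); last by exists z; right; rewrite /= -mulgA.
exists (m * n0)%N; first by rewrite muln_gt0 m0.
apply/com; rewrite conjgM.
have F : (h ^+ (m * n0)) ^ g = (h ^+ (m * n0))^-1.
  case: (conj_expM n0 Em) => // E; case: ng; exists (m * n0)%N; last exact/com.
  by rewrite muln_gt0 m0.
have F0 : (h ^+ (m * n0)) ^ e0 = (h ^+ (m * n0))^-1.
  have := conj_expM m E0; rewrite mulnC => -[E|//]; case: ne0; exists (m * n0)%N; last exact/com.
  by rewrite muln_gt0 m0.
by rewrite F -F0 conjgK.
Qed.

End Cosets.

Section Hulls.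
Variables (G : groupType) (n : nat) (H : 'I_n -> set G).
Implicit Types (A B C E : set G) (g h : G).

(** The fourth clause makes the hull the stabilizer of its cylinder; the last one separates the two
    ways of finding fixed points in trees. *)
Definition is_hull E := [/\ infinite_set E, elementary H E,
  forall C, elementary H C -> infinite_set (E `&` C) -> C `<=` E,
  forall g, conjs E g = E -> E g
  & (exists h, virtually_gen E h) \/ (exists i g, E = conjs (H i) g)].

Lemma conjs_mul A g h : conjs A (g * h) = conjs (conjs A g) h.
Proof. by apply/seteqP; split=> x; rewrite !conjsE invgM conjgM. Qed.

Lemma subgroupI A B : subgroup A -> subgroup B -> subgroup (A `&` B).
Proof.
move=> [A1 AM AV] [B1 BM BV]; split=> [//|x y [? ?] [? ?]|x [? ?]]; split; auto.
Qed.

(** In the two-ended case an infinite [B] meets the powers of a generator nontrivially and is thus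
    virtually cyclic itself, hence again two-ended. *)
Lemma elementary_sub A B : elementary H A -> subgroup B -> B `<=` A -> elementary H B.
Proof.
move=> [sA eA] sB BA; split=> //.
have [fB|iB] := EM (finite_set B); first by apply: Or31.
case: eA => [fA|/two_ended_virtually_gen[h vA]|[_ [i [g Ag]]]].
- by case: iB; apply: sub_finite_set fA.
- have [h' vB] := vgen_sub sA vA sB iB BA.
  by apply: Or32; apply: two_ended_vgen vB.
- by apply: Or33; split=> //; exists i, g => x /BA/Ag.
Qed.

Lemma vgen_elementary A h : subgroup A -> virtually_gen A h -> elementary H A.
Proof. by move=> sA vA; split=> //; apply: Or32; apply: two_ended_vgen vA. Qed.

Lemma vgen_infinite A h : subgroup A -> virtually_gen A h -> infinite_set A.
Proof.
move=> sA [Ah ih _]; apply: infinite_sub (infinite_powers ih) => x [z ->].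
exact: zexp_subgroup.
Qed.

Lemma vstab_subgroup (T : gGraph G) (v : T) : subgroup (vstab v).
Proof.
split=> [|x y|x]; rewrite /vstab /=; first exact: act1.
  by move=> hx hy; rewrite actM hy.
by move=> hx; rewrite -{1}hx actK.
Qed.

Section Model.
Variable K : gGraph G.
Hypotheses (x0 : K) (conn : connected_graph (@adj G K)).
Hypotheses (hyp : hyperbolic_graph (@adj G K)) (fine : fine_graph (@adj G K)).
Hypothesis finE : forall u v : K, adj u v -> finite_set (estab u v).
Hypothesis cofin : exists E : set (K * K), finite_set E /\
          forall u v : K, adj u v ->
            exists g e, [/\ E e, u = act g e.1 & v = act g e.2].
Hypothesis par : forall A : set G,
          (infinite_set A /\ exists v : K, A = vstab v) <->
          exists i g, A = conjs (H i) g.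

Lemma parabolic_vstab A : parabolic H A -> exists v : K, A `<=` vstab v.
Proof.
move=> [_ [i [g Ag]]].
have [|_ [v Ev]] := (par (conjs (H i) g)).2; first by exists i, g.
by exists v; rewrite -Ev.
Qed.

Lemma elementary_cases A : elementary H A -> infinite_set A ->
  (exists v : K, A `<=` vstab v) \/ (exists h, virtually_gen A h).
Proof.
move=> [sA [fA|tA|pA]] iA //; first by right; apply: two_ended_virtually_gen.
by left; apply: parabolic_vstab.
Qed.

Lemma infinite_fixed_vertex A (u v : K) : infinite_set A -> A `<=` vstab u -> A `<=` vstab v -> u = v.
Proof.
move=> iA Au Av; apply: contrapT => /(vstab_pair_finite conn fine finE cofin) fin.
by apply: iA; apply: sub_finite_set fin => x Ax; split; [apply: Au|apply: Av].
Qed.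

(** The powers of [h ^ (m * N)] fix both [v] and [c v], and an infinite set fixes at most one
    vertex. *)
Lemma fixed_by_conj (v : K) h N m c : infinite_order h -> (0 < N)%N -> (0 < m)%N ->
  act (h ^+ N) v = v -> (h ^+ m) ^ c = h ^+ m \/ (h ^+ m) ^ c = (h ^+ m)^-1 -> act c v = v.
Proof.
move=> ih N0 m0 hv hc; have sv := vstab_subgroup v.
pose x := h ^+ (m * N).
have xv : vstab v x.
  by rewrite /x mulnC expgnA; apply: (@zexp_subgroup _ _ (h ^+ N) (Posz m)).
have ix : infinite_order x by apply: (@infinite_order_pow _ h (Posz (m * N)) ih); lia.
have xc : vstab v (x ^ c).
  by case: (conj_expM N hc) => ->; [exact: xv|case: sv => _ _; apply].
symmetry; apply: (infinite_fixed_vertex (infinite_powers ix)) => y [z ->].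
  exact: zexp_subgroup.
apply: zexp_subgroup; first exact: vstab_subgroup.
by rewrite vstab_act; apply/conjsE; rewrite invgK.
Qed.

Lemma vgen_fixed A h (v : K) N : subgroup A -> virtually_gen A h -> (0 < N)%N ->
  act (h ^+ N) v = v -> A `<=` vstab v.
Proof.
move=> sA vA N0 hv a Aa; have [Ah ih _] := vA.
have [m m0 hm] := vgen_conj sA vA Ah ih Aa.
exact: fixed_by_conj ih N0 m0 hv hm.
Qed.

(** If an elementary [C] shares an infinite set with it, either [C] fixes a vertex, which must be
    [v], or [C] is virtually cyclic with a power of its generator fixing [v], so [vgen_fixed]
    applies. Uniqueness of [v] also gives self-normalization. *)
Lemma vstab_hull (v : K) : infinite_set (vstab v) -> is_hull (vstab v).
Proof.
move=> iv; have sv := vstab_subgroup v.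
have [i [g Eg]] := (par (vstab v)).1 (conj iv (ex_intro _ v erefl)).
split=> //.
- by split=> //; apply: Or33; split=> //; exists i, g; rewrite Eg.
- move=> C eC iC; have iC' : infinite_set C by apply: infinite_sub iC => x [].
  case: (elementary_cases eC iC') => [[w Cw]|[h vC]].
    have -> // : v = w by apply: (infinite_fixed_vertex iC) => [x []|x [_ Cx]]; last exact: Cw.
  have [sC _] := eC.
  have [|N N0 [hv _]] := vgen_meet vC (subgroupI sv sC) iC; first by move=> x [].
  exact: vgen_fixed vC N0 hv.
- move=> g' E; apply/esym; apply: (infinite_fixed_vertex iv) => // x vx.
  by rewrite vstab_act -E conjsK.
- by right; exists i, g.
Qed.

Lemma reversing_normalizer_vgen h : (forall N (v : K), (0 < N)%N -> act (h ^+ N) v <> v) ->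
  virtually_gen (reversing_normalizer h) h.
Proof.
move=> nofix; have [c fp] := hyperbolic_four_point (@adj_sym G K) conn hyp.
have unb b : exists k, (b <= dist adj x0 (act (h ^+ k) x0))%N.
  apply: contrapT => no.
  have [|N N0 [v hv]] := bounded_orbit_fixes conn fine cofin (x := x0) (h := h) (B := b).
    by move=> k; rewrite leqNgt; apply/negP => lt; apply: no; exists k; apply: ltnW.
  exact: nofix hv.
have [N hN] := centralizer_cosets conn fp fine finE cofin unb.
have [T fT hT] := @finitely_many_cosets G (fun g => exists2 n, (0 < n)%N & commute g (h ^+ n)) h N hN.
have [T' fT' hT'] := reversing_normalizer_finite fT hT.
split.
- by exists 1%N => //; left; rewrite conjgE mulKg.
- by move=> k k0 E; apply: (nofix k x0 k0); rewrite E act1.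
- by exists T'.
Qed.

(** An elementary [C] with infinite intersection contains a power of [h], so it fixes no vertex and
    is virtually cyclic; by [vgen_conj] its elements preserve or invert a further power. *)
Lemma reversing_normalizer_hull h : (forall N (v : K), (0 < N)%N -> act (h ^+ N) v <> v) ->
  is_hull (reversing_normalizer h).
Proof.
move=> nofix; have vE := reversing_normalizer_vgen nofix.
set E := reversing_normalizer h in vE *.
have sE : subgroup E := reversing_normalizer_subgroup h.
have [Eh ih _] := vE.
split.
- exact: vgen_infinite vE.
- exact: vgen_elementary vE.
- move=> C eC iC; have iC' : infinite_set C by apply: infinite_sub iC => x [].
  have [sC _] := eC.
  have [|N N0 [_ CN]] := vgen_meet vE (subgroupI sE sC) iC; first by move=> x [].
  case: (elementary_cases eC iC') => [[w Cw]|[k vC]]; first by case: (nofix N w N0); apply: Cw.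
  have iN : infinite_order (h ^+ N) by apply: (@infinite_order_pow _ h (Posz N) ih); lia.
  move=> a Ca; have [m m0] := vgen_conj sC vC CN iN Ca.
  by rewrite -!expgnA => hm; exists (N * m)%N => //; rewrite muln_gt0 N0.
(* The conjugates of [h] by powers of [g] stay in [E]; this is all that [conj_exponent] asks of
   [g]. *)
- move=> g Eg.
  have Ek k : conjs E (g ^+ k) = E.
    elim: k => [|k IH]; last by rewrite expgS conjs_mul Eg.
    by apply/seteqP; split=> x; rewrite conjsE invg1 conjg1.
  have Ehk k : E (h ^ (g ^+ k)) /\ E (h ^ (g ^+ k)^-1).
    split; first by rewrite -(Ek k); apply/conjsE; rewrite conjgK.
    by have : E h by []; rewrite -{1}(Ek k) => /conjsE.
  have [M M0 hM] := vgen_uniform_exponent sE vE.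
  have [b hb] := hM _ (Ehk 1%N).1; rewrite expg1 in hb.
  have Eb : zexp h (Posz M) ^ g = zexp h b by rewrite -hb -zexpJ.
  have b0 : b <> 0%R by move=> b0; apply: (@infinite_orderJ _ h g ih _ M0); rewrite hb b0.
  have M0' : Posz M <> 0%R by lia.
  exists M => //; case: (conj_exponent ih M0 hM Ehk M0' b0 Eb) => F.
    by left; rewrite -[h ^+ M]/(zexp h (Posz M)) Eb F.
  by right; rewrite -[h ^+ M]/(zexp h (Posz M)) Eb -zexpN; congr zexp; lia.
- by left; exists h.
Qed.

Lemma hull_exists_model A : infinite_elementary H A -> exists2 E, is_hull E & A `<=` E.
Proof.
move=> [iA eA]; have [sA _] := eA.
have fixed (v : K) : A `<=` vstab v -> exists2 E, is_hull E & A `<=` E.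
  by move=> Av; exists (vstab v) => //; apply: vstab_hull; apply: infinite_sub iA.
case: (elementary_cases eA iA) => [[v /fixed//]|[h vA]].
have [[N [v [N0 hv]]]|no] := EM (exists N (v : K), (0 < N)%N /\ act (h ^+ N) v = v).
  by apply: (fixed v); apply: vgen_fixed vA N0 hv.
exists (reversing_normalizer h).
  by apply: reversing_normalizer_hull => N v N0 hv; apply: no; exists N, v.
by move=> a Aa; have [Ah ih _] := vA; apply: vgen_conj vA Ah ih Aa.
Qed.

Lemma peripheral_hull_model i g : is_hull (conjs (H i) g).
Proof.
have [|iP [v Ev]] := (par (conjs (H i) g)).2; first by exists i, g.
by rewrite Ev in iP *; apply: vstab_hull.
Qed.

End Model.

Hypothesis hrel : relatively_hyperbolic H.

Lemma hull_exists A : infinite_elementary H A -> exists2 E, is_hull E & A `<=` E.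
Proof.
have [K [[[x0] conn hyp fine] [finE cofin par]]] := hrel.
exact: (hull_exists_model x0 conn hyp fine finE cofin par).
Qed.

Lemma peripheral_hull i g : is_hull (conjs (H i) g).
Proof.
have [K [[[x0] conn hyp fine] [finE cofin par]]] := hrel.
exact: (peripheral_hull_model conn fine finE cofin par).
Qed.

Lemma hull_subgroup E : is_hull E -> subgroup E.
Proof. by case=> _ []. Qed.

Lemma hull_uniq E E' A : is_hull E -> is_hull E' -> infinite_set A -> A `<=` E -> A `<=` E' -> E = E'.
Proof.
move=> [iE eE mE _ _] [iE' eE' mE' _ _] iA AE AE'.
have i1 : infinite_set (E `&` E') by apply: infinite_sub iA => x Ax; split; auto.
by apply/seteqP; split; [apply: mE' => //; rewrite setIC|apply: mE].
Qed.

Lemma hull_conj E g : is_hull E -> is_hull (conjs E g).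
Proof.
move=> [iE eE mE nE cE]; split.
- exact: conjs_infinite.
- exact: conjs_elementary.
- move=> C eC iC; rewrite -(conjsKV C g); apply: conjs_mono; apply: mE; first exact: conjs_elementary.
  move=> /(@conjs_finite _ _ g); apply: contra_not iC; apply: sub_finite_set.
  by move=> x [Ex Cx]; apply/conjsE; split; [exact/conjsE|apply/conjsE; rewrite invgK conjgKV].
- move=> k Ek; apply/conjsE/nE.
  by rewrite conjgE invgK !conjs_mul Ek conjsK.
- case: cE => [[h [Eh ih [T fT hT]]]|[i [k ->]]]; last by right; exists i, (k * g); rewrite conjs_mul.
  left; exists (h ^ g); split; first by exists h.
    exact: infinite_orderJ.
  exists (conjs T g); first exact: conjs_finite.
  move=> a /conjsE/hT[z Tz]; exists z; apply/conjsE.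
  by rewrite conjMg zexpJ conjgK.
Qed.

(** This turns co-elementarity into an inclusion: the maximality of the hull of [A] captures
    [<A, B>], and subgroups of a hull are elementary. *)
Lemma coelementary_hull E A B : is_hull E -> infinite_set A -> A `<=` E ->
  subgroup B -> (coelementary H A B <-> B `<=` E).
Proof.
move=> [iE eE mE nE cE] iA AE sB; split=> [eAB|BE].
  have h : gen (A `|` B) `<=` E.
    by apply: mE => //; apply: infinite_sub iA => x Ax; split; [exact: AE|apply: gen_sub; left].
  by move=> x Bx; apply: h; apply: gen_sub; right.
apply: elementary_sub (eE) (gen_subgroup _) _; apply: gen_min; first by case: eE.
by move=> x [/AE|/BE].
Qed.

End Hulls.

(** * Group actions on trees *)

Section Trees.
Variables (G : groupType) (T : gGraph G).
Hypothesis conn : connected_graph (@adj G T).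
Hypothesis acyclic : forall (x : T) p, ~ circuit adj x p.
Implicit Types (u v w x y z a b : T) (g h : G) (P A B : set G).

Definition off_edge u v a b := adj a b /\ ~ ((a = u /\ b = v) \/ (a = v /\ b = u)).

(* The half-tree beyond the oriented edge from [u] to [v]. *)
Definition side u v : set T := [set z | exists p, walk (off_edge u v) v p z].

Lemma side_refl u v : side u v v. Proof. by exists nil. Qed.

Lemma side_source u v : adj u v -> ~ side u v u.
Proof.
move=> uv [p0 wp0]; have [p [wp np _ _]] := walk_simple wp0.
apply: (@acyclic u (v :: p)); split=> //.
  by split=> //; apply: walk_sub wp => a b [].
case: p wp {np} => [|a [|b p]] //=; first by move=> E; case: (@adj_irr _ _ u); rewrite -{2}E.
by move=> [[_ h] E]; case: h; right; rewrite E.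
Qed.

Lemma side_step u v z z' : adj u v -> adj z z' -> side u v z -> ~ side u v z' -> z = v /\ z' = u.
Proof.
move=> uv zz' sz nz'; have [h|h] := EM ((z = u /\ z' = v) \/ (z = v /\ z' = u)).
  by case: h => [[E _]|//]; case: (side_source uv); rewrite -{2}E.
by case: nz'; case: sz => p wp; exists (p ++ [:: z']); apply: walk_rcons wp _.
Qed.

Lemma side_or u v z : adj u v -> side u v z \/ side v u z.
Proof.
move=> uv; have [p wp] := conn v z.
suff h x q : walk adj x q z -> side u v x \/ side v u x -> side u v z \/ side v u z.
  by apply: (h v p wp); left; apply: side_refl.
elim: q x => [|a q IH] x /= => [->//|[xa wq] hx]; apply: (IH a) => //.
case: hx => sx.
  have [sa|sa] := EM (side u v a); first by left.
  by have [_ ->] := side_step uv xa sx sa; right; apply: side_refl.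
have [sa|sa] := EM (side v u a); first by right.
by have [_ ->] := side_step (adj_sym uv) xa sx sa; left; apply: side_refl.
Qed.

Lemma off_edge_sym u v a b : off_edge u v a b -> off_edge u v b a.
Proof. by move=> [ab h]; split; [exact: adj_sym|tauto]. Qed.

Lemma off_edgeC u v a b : off_edge u v a b -> off_edge v u a b.
Proof. by move=> [ab h]; split=> //; tauto. Qed.

Lemma side_disjoint u v z : adj u v -> side u v z -> ~ side v u z.
Proof.
move=> uv [p wp] [q wq]; apply: (side_source uv).
have [r [wr _ _]] := walk_rev (@off_edge_sym v u) wq.
by exists (p ++ r); apply: walk_trans wp _; apply: walk_sub wr => a b; apply: off_edgeC.
Qed.

Lemma sideN u v z : adj u v -> ~ side u v z -> side v u z.
Proof. by move=> uv; case: (side_or z uv). Qed.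

Lemma side_act g u v z : side (act g u) (act g v) (act g z) <-> side u v z.
Proof.
have h k u' v' z' : side u' v' z' -> side (act k u') (act k v') (act k z').
  move=> [p wp]; exists [seq act k a | a <- p]; apply: walk_map wp => a b [ab nab].
  split; first exact: act_adj.
  by move=> [[/(can_inj (actK k)) ? /(can_inj (actK k)) ?]|[/(can_inj (actK k)) ? /(can_inj (actK k)) ?]];
    apply: nab; [left|right].
by split=> [/(h g^-1)|/h//]; rewrite !actK.
Qed.

Lemma walk_side u v p x z : walk (off_edge u v) x p z -> side u v x -> side u v z.
Proof. by move=> w [q wq]; exists (q ++ p); apply: walk_trans wq w. Qed.

(** A path inside the half-tree beyond [uv] cannot use the edge [ab], one end of which lies outside;
    starting at [v], it stays beyond [ba]. *)
Lemma side_nested u v a b : adj u v -> ~ (side u v a /\ side u v b) ->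
  side b a v -> side u v `<=` side b a.
Proof.
move=> uv nab sv z [p wp].
suff h x q : side u v x -> side b a x -> walk (off_edge u v) x q z -> side b a z.
  by apply: (h v p) => //; apply: side_refl.
elim: q x => [|y q IH] x su sx /= => [<-//|[xy wq]].
have suy : side u v y by apply: (@walk_side u v [:: y] x y) => //=.
apply: (IH y) => //; apply: (@walk_side b a [:: y] x y) => //=; split=> //.
split; first by case: xy.
by move=> [[E1 E2]|[E1 E2]]; apply: nab; rewrite -E1 -E2.
Qed.

Lemma simple_first y b p z w : walk adj y (b :: p) z -> NoDup (y :: b :: p) ->
  w <> b -> side w y z.
Proof.
move=> [yb wp] nd wb; have ny : ~ In y (b :: p) by inversion nd.
exists (b :: p); split.
  split=> // -[[E1 E2]|[_ E2]]; last by apply: wb; rewrite E2.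
  by apply: ny; left; rewrite E2.
apply: walk_sub (walk_within (P := fun t => t <> y) wp _).
  by move=> s t [st [sy ty]]; split=> // -[[_ E]|[E _]].
by move=> t ht E; apply: ny; rewrite -E.
Qed.

Lemma simple_beyond y b p z : walk adj y (b :: p) z -> NoDup (y :: b :: p) -> side y b z.
Proof.
move=> [yb wp] nd; have ny : ~ In y (b :: p) by inversion nd.
exists p; apply: walk_sub (walk_within (P := fun t => t <> y) wp _).
  by move=> s t [st [sy ty]]; split=> // -[[E _]|[_ E]].
by move=> t ht E; apply: ny; rewrite -E.
Qed.

(** Simple paths with different first edges end in disjoint half-trees. *)
Lemma simple_uniq x p q y : walk adj x p y -> walk adj x q y ->
  NoDup (x :: p) -> NoDup (x :: q) -> p = q.
Proof.
elim: p x q => [|u p IH] x [|v q] //.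
- move=> /= -> wq _ nq; have [ny _] := (NoDup_cons_iff y (v :: q)).1 nq.
  by case: ny; apply: walk_end wq.2.
- move=> wp /= E np _; subst y; have [nx _] := (NoDup_cons_iff x (u :: p)).1 np.
  by case: nx; apply: walk_end wp.2.
move=> wp wq np nq; have [uv|uv] := EM (u = v).
  subst v; congr cons; apply: (IH u) => //; [by case: wp|by case: wq| |].
    by inversion np.
  by inversion nq.
have s1 := simple_beyond wq nq; have s2 := simple_first wp np (nesym uv).
by case: (side_disjoint (wq.1) s1 s2).
Qed.

Lemma crossing u v a p b : adj u v -> walk adj a p b -> ~ side u v a -> side u v b ->
  In u (a :: p) /\ In v p.
Proof.
move=> uv wp na sb; have [|z [z' [zz nz sz' iz iz']]] := @walk_cross _ _ (fun z => ~ side u v z) _ _ _ wp na.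
  exact.
have [E1 E2] := side_step uv (adj_sym zz) (contrapT sz') nz.
by rewrite -E1 -E2.
Qed.

Lemma fixed_segment g a p b : walk adj a p b -> NoDup (a :: p) -> act g a = a -> act g b = b ->
  forall z, In z (a :: p) -> act g z = z.
Proof.
move=> wp np ga gb.
have E : [seq act g z | z <- p] = p.
  apply: (@simple_uniq a _ p b) => //; first by rewrite -{1}ga -gb; apply: walk_act.
  rewrite -{1}ga; apply: (@FinFun.Injective_map_NoDup _ _ (act g) (a :: p)) np.
  exact: can_inj (actK g).
move=> z [<-//|]; move: E; clear; elim: p => //= y p IH [E1 E2] [<-//|]; exact: IH.
Qed.

Lemma fixed_separating g a b u v : adj u v -> ~ side u v a -> side u v b ->
  act g a = a -> act g b = b -> act g u = u /\ act g v = v.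
Proof.
move=> uv na sb ga gb; have [p0 wp0] := conn a b.
have [p [wp np _ _]] := walk_simple wp0.
have [iu iv] := crossing uv wp na sb; have fx := fixed_segment wp np ga gb.
by split; apply: fx => //; right.
Qed.

(** If [h] separates the images of [a] and [b], it maps some edge of a fixed path between them onto
    [uv]; for each such edge, the possible [h] form a coset of the finite stabilizer in [P]. *)
Lemma crossing_finite P u v a b : adj u v -> subgroup P -> finite_set (P `&` estab u v) ->
  finite_set [set h | P h /\ ~ (side u v (act h a) <-> side u v (act h b))].
Proof.
move=> uv [_ PM PV] /finite_listP[l hl]; have [p wp] := conn a b.
pose J := List.list_prod (a :: p) (a :: p).
apply: (@finite_cover _ _ J (fun e h => [/\ P h, act h e.1 = u & act h e.2 = v])).
  move=> [z z']; have [[h0 [P0 hz hz']]|no] := EM (exists h, [/\ P h, act h z = u & act h z' = v]).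
    apply/finite_listP; exists (List.map (fun t => t * h0) l) => h [/= Ph h1 h2].
    apply/in_map_iff; exists (h * h0^-1); split; first by rewrite mulgVK.
    apply: hl; split; first by apply: PM => //; apply: PV.
    by split; rewrite /vstab /= actM -?hz -?hz' actK ?hz ?hz'.
  by apply/finite_listP; exists nil => h hh; apply: no; exists h.
have key h c q e : P h -> walk adj c q e -> ~ side u v (act h c) -> side u v (act h e) ->
    exists z z', [/\ In z (c :: q), In z' (c :: q), act h z = u & act h z' = v].
  move=> Ph wq nc se; have [iu iv] := crossing uv (walk_act h wq) nc se.
  have [z [Ez iz]] := (in_map_iff (act h) (c :: q) u).1 iu.
  have [z' [Ez' iz']] := (in_map_iff (act h) q v).1 iv.
  by exists z, z'; split=> //; right.
move=> h [Ph nh]; have [sa|sa] := EM (side u v (act h a)); have [sb|sb] := EM (side u v (act h b)).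
- by case: nh.
- have [q [wq _ hq]] := walk_rev (@adj_sym G T) wp.
  have [z [z' [iz iz' E E']]] := key h b q a Ph wq sb sa.
  by exists (z, z') => //; apply/in_prod; apply/hq.
- have [z [z' [iz iz' E E']]] := key h a p b Ph wp sa sb.
  by exists (z, z') => //; apply/in_prod.
- by case: nh.
Qed.

(** * One-ended groups acting on trees *)

Section OneEnded.
Variable P : set G.
Hypotheses (sP : subgroup P) (oP : one_ended P).

(** By [crossing_finite], for each generator [s] only finitely many [h] have [h a] and [h (s a)] on
    different sides. So the set of [h] with [h a] beyond [uv] has finite boundary, and one end makes
    it finite or cofinite. *)
Lemma one_ended_side u v a : adj u v -> finite_set (P `&` estab u v) ->
  finite_set [set h | P h /\ side u v (act h a)] \/ finite_set [set h | P h /\ side v u (act h a)].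
Proof.
move=> uv fe; have [S [fS gS _ n2]] := oP.
have [_ PM PV] := sP; have [lS hlS] := (finite_listP _).1 fS.
have SP s : S s -> P s by move=> Ss; rewrite -gS; apply: gen_sub.
set X := [set h | P h /\ side u v (act h a)].
have [||fX|fX] := one_ended_bdry fS gS n2 (X := X).
- by move=> h [].
- apply: (@finite_cover _ _ (List.flat_map (fun s => [:: s; s^-1]) lS)
    (fun s h => P h /\ ~ (side u v (act h a) <-> side u v (act h (act s a))))).
    by move=> s; apply: crossing_finite.
  move=> h [k [Ph Pk _ [s Ss E]] hX].
  have ne t : k = h * t -> P h /\ ~ (side u v (act h a) <-> side u v (act h (act t a))).
    move=> Ek; split=> // hs; rewrite -actM -Ek in hs.
    have [Xh|Xh] := EM (X h); first by apply: (hX.1 Xh); split=> //; apply/hs; case: Xh.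
    by have [_ /hs] : X k := contrapT (contra_not hX.2 Xh) => sh; apply: Xh.
  case: E => E.
    by exists s; [apply/in_flat_map; exists s; split; [exact: hlS|left]|exact: ne].
  exists s^-1; first by apply/in_flat_map; exists s; split; [exact: hlS|right; left].
  by apply: ne; rewrite E mulgK.
- by left.
- right; apply: sub_finite_set fX => h [Ph sh]; split=> // -[_ sh'].
  exact: side_disjoint sh' sh.
Qed.

(** If the stabilizer were finite, the side of [h a] would not depend on [h] in [P], because each
    value is taken on an infinite coset of [A]; likewise for [b]. So every [h] in [P] would separate
    [a] and [b], against [crossing_finite]. *)
Lemma one_ended_segment A B a b u v : adj u v -> A `<=` P -> B `<=` P ->
  infinite_set A -> infinite_set B -> A `<=` vstab a -> B `<=` vstab b ->
  ~ side u v a -> side u v b -> infinite_set (P `&` estab u v).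
Proof.
move=> uv AP BP iA iB Aa Bb na sb fe.
have [P1 PM PV] := sP; have iP := one_ended_infinite oP.
have const C c : C `<=` P -> infinite_set C -> C `<=` vstab c ->
    forall h k, P h -> P k -> side u v (act h c) -> side u v (act k c).
  move=> CP iC Cc h k Ph Pk sh; apply: contrapT => nk.
  have inf (Q : T -> Prop) l : P l -> Q (act l c) -> infinite_set [set h | P h /\ Q (act h c)].
    move=> Pl Ql fQ; apply: iC; apply: sub_finite_set (translate_finite l^-1 fQ).
    move=> x Cx; rewrite /translate /= invgK; split; first by apply: PM => //; apply: CP.
    by rewrite actM (Cc x Cx).
  have sk := sideN uv nk.
  by case: (one_ended_side c uv fe); [exact: (inf _ h)|exact: (inf (side v u) k)].
apply: iP; apply: sub_finite_set (crossing_finite a b uv sP fe) => h Ph; split=> // E.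
apply: na; rewrite -(act1 a); apply: (const A a AP iA Aa h) => //.
by apply/E; apply: (const B b BP iB Bb 1) => //; rewrite act1.
Qed.

(* Each edge points to its side containing almost all of the orbit; either there
   is a sink, or the edges point to an end, along which the generators cannot
   translate. *)
Lemma one_ended_elliptic a : (forall u v, adj u v -> finite_set (P `&` estab u v)) ->
  exists v, P `<=` vstab v.
Proof.
move=> fE; have iP := one_ended_infinite oP; have [P1 PM PV] := sP.
(* The edge points to [v] when all but finitely many [h] send [a] to that side. Each edge has
   exactly one direction, and each vertex at most one outgoing edge. *)
pose out u v := adj u v /\ finite_set [set h | P h /\ side v u (act h a)].
have out_or u v : adj u v -> out u v \/ out v u.
  by move=> uv; case: (one_ended_side a uv (fE _ _ uv)) => f; [right; split=> //; exact: adj_sym|left].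
have cover Q R : (forall h, P h -> Q h \/ R h) -> finite_set [set h | P h /\ Q h] ->
    finite_set [set h | P h /\ R h] -> False.
  move=> QR fQ fR; apply: iP; apply: (@sub_finite_set _ _ ([set h | P h /\ Q h] `|` [set h | P h /\ R h])).
    by move=> h Ph; case: (QR h Ph); [left|right].
  by rewrite finite_setU.
have out_asym u v : out u v -> ~ out v u.
  by move=> [uv f1] [_ f2]; apply: cover f1 f2 => h Ph; apply: side_or; apply: adj_sym.
have out_fun u v w : out u v -> out u w -> v = w.
  move=> [uv f1] [uw f2]; apply: contrapT => vw; apply: cover f1 f2 => h Ph.
  have [s|s] := EM (side v u (act h a)); [by left|right].
  have := sideN (adj_sym uv) s; apply: side_nested => //.
    by move=> [/(side_source uv)].
  by exists [:: v]; split=> //; split=> // -[[E _]|[_ E]]; [by rewrite -E in uw; case: (@adj_irr _ _ _ uw)|exact: vw].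
have out_act g u v : P g -> out u v -> out (act g u) (act g v).
  move=> Pg [uv f]; split; first exact: act_adj.
  apply: sub_finite_set (translate_finite g f) => h [Ph sh].
  split; first by apply: PM => //; apply: PV.
  by rewrite actM; apply/(side_act g); rewrite actKV.
have [[v hv]|no] := EM (exists v, forall w, ~ out v w).
  exists v => g Pg; rewrite /vstab /=; apply: contrapT => gv.
  have hgv w : ~ out (act g v) w.
    by move=> /(out_act g^-1 _ _ (PV _ Pg)); rewrite actK; apply: hv.
  have [p0 wp0] := conn v (act g v); have [p [wp np _ _]] := walk_simple wp0.
  (* Along a simple path issued from a sink all edges point back to it, so another vertex cannot be
     a sink. *)
  suff push x q y : walk adj x q y -> NoDup (x :: q) -> x <> y ->
      (forall w, q = w :: behead q -> out w x) -> exists w, out y w.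
    have [|w] := push v p (act g v) wp np (nesym gv); last exact: hgv.
    by move=> w E; rewrite E in wp; case: wp => /out_or[/hv|].
  elim: q x => [|u q IH] x //= [xu wq] nq xy hout.
  have ux : out u x by apply: hout.
  case: q IH wq nq hout => [|t q] IH wq nq hout; first by exists x; rewrite -wq.
  apply: (IH u) => //.
  + by inversion nq.
  + move=> E; have [_ nu] := (NoDup_cons_iff x (u :: t :: q)).1 nq.
    have [nu' _] := (NoDup_cons_iff u (t :: q)).1 nu; apply: nu'.
    by rewrite E; apply: walk_end wq.2.
  + move=> w [<-]; case: wq => ut _; case: (out_or _ _ ut) => // /(out_fun _ _ _ ux) E.
    have [nx _] := (NoDup_cons_iff x (u :: t :: q)).1 nq.
    by case: nx; right; left.
have [f hf] : {f : T -> T & forall v, out v (f v)}.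
  by apply: choice => v; apply: contrapT => nv; apply: no; exists v => w ow; apply: nv; exists w.
have fact g v : P g -> f (act g v) = act g (f v).
  by move=> Pg; apply: out_fun (hf _) _; apply: out_act.
have iact g v m : P g -> iter m f (act g v) = act g (iter m f v).
  by move=> Pg; elim: m => //= m ->; apply: fact.
have fadj x y : adj x y -> f x = y \/ f y = x.
  by move=> /out_or[/out_fun h|/out_fun h]; [left|right]; apply/esym/h.
have meet x y : exists m k, iter m f x = iter k f y.
  have [p wp] := conn x y; elim: p x wp => [|z p IH] x /=; first by move=> ->; exists 0%N, 0%N.
  move=> [xz /IH[m [k E]]]; case: (fadj _ _ xz) => Ez.
    by exists m.+1, k; rewrite iterSr Ez.
  by exists m, k.+1; rewrite /= -E -iterS iterSr Ez.
have stay v w m : side v (f v) w -> side v (f v) (iter m f w).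
  move=> sw; elim: m => //= m IH; apply: contrapT => ns.
  have [vf _] := hf v; have [wf _] := hf (iter m f w).
  have [E1 E2] := side_step vf wf IH ns.
  by apply: (out_asym _ _ (hf v)); rewrite -{2}E2 E1.
have nocycle v m : iter m.+1 f v <> v.
  move=> E; have [vf _] := hf v; apply: (side_source vf); rewrite -{3}E iterSr.
  by apply: stay; apply: side_refl.
(* Such an [s] has infinite order, and its negative powers keep [v] behind the edge from [v] to
   [f v]; then infinitely many [h a] would lie there. *)
have notrans s v j : P s -> act s v = iter j.+1 f v -> False.
  move=> Ps E; have Pn n : P (s ^+ n) by apply: (@zexp_subgroup _ P s (Posz n)).
  have En n : act (s ^+ n) v = iter (n * j.+1) f v.
    elim: n => [|n IH]; first by rewrite act1.
    by rewrite expgS actM IH -iact // E -iterD mulSn addnC.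
  have is' : infinite_order s.
    move=> [//|n] _ E1; have := En n.+1; rewrite E1 act1 => /esym.
    have -> : (n.+1 * j.+1 = (n * j.+1 + j).+1)%N by lia.
    exact: nocycle.
  have [vf fv] := hf v.
  have back n : side (f v) v (act (s ^+ n)^-1 v).
    apply: (sideN vf) => /(stay _ _ (n * j.+1)%N); rewrite iact; last exact: PV.
    by rewrite -En actK; apply: side_source.
  have fin := crossing_finite a v (adj_sym vf) sP (fE _ _ (adj_sym vf)).
  apply: (@infinite_sub _ (range (fun n => zexp s (- Posz n)%R)) _ _
    (infinite_nat_injection _) (_ : finite_set ([set h | P h /\ side (f v) v (act h a)] `|`
     [set h | P h /\ ~ (side (f v) v (act h a) <-> side (f v) v (act h v))]))).
  - move=> h [n _ <-]; have Pz : P (zexp s (- Posz n)%R) by apply: zexp_subgroup.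
    have bn := back n; rewrite -[s ^+ n]/(zexp s (Posz n)) -zexpN in bn.
    have [sa|sa] := EM (side (f v) v (act (zexp s (- Posz n)%R) a)); first by left.
    by right; split=> // sav; apply: sa; apply/sav.
  - by move=> m n /(zexp_inj is'); lia.
  - by rewrite finite_setU.
(* The rays from [a] and [s a] merge, and [notrans] makes them merge after equally many steps; so
   [s] fixes a vertex of the ray. Finitely many generators then share one. *)
have same s : P s -> exists m, iter m f (act s a) = iter m f a.
  move=> Ps; have [m [k E]] := meet (act s a) a; rewrite iact // in E.
  have [lt|gt|eq] := ltngtP m k.
  - exfalso; apply: (@notrans s (iter m f a) (k - m).-1 Ps).
    by rewrite E -iterD; congr iter; lia.
  - exfalso; apply: (@notrans s^-1 (iter k f a) (m - k).-1 (PV _ Ps)).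
    by rewrite -{1}E actK -iterD; congr iter; lia.
  - by exists m; rewrite iact // E eq.
have [S [fS gS _ _]] := oP; have [l hl] := (finite_listP _).1 fS.
have SP s : S s -> P s by move=> Ss; rewrite -gS; apply: gen_sub.
have [N hN] : exists N, forall s, In s l -> P s -> iter N f (act s a) = iter N f a.
  elim: l {hl} => [|s l [N hN]]; first by exists 0%N.
  have [Ps|nPs] := EM (P s); last by exists N => t [<-|]//; apply: hN.
  have [m Em] := same s Ps; exists (N + m)%N => t [<- _|tl Pt].
    by rewrite !iterD Em.
  by rewrite addnC !iterD hN.
exists (iter N f a); rewrite -gS; apply: gen_min; first exact: vstab_subgroup.
move=> s Ss; have Ps := SP s Ss; rewrite /vstab /= -iact //.
by apply: hN => //; apply: hl.
Qed.

End OneEnded.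

End Trees.

(** * Ping-pong with two products of two elements *)

Section PingPong.
Variables (G : groupType) (T : gGraph G).
Implicit Types (P : set G).

Variables (L : set T) (a a' b b' : G) (P : set G).
Hypotheses (sP : subgroup P) (Pa : P a) (Pa' : P a') (Pb : P b) (Pb' : P b').
Hypotheses (L0 : L !=set0) (R0 : ~` L !=set0).
Let toL g := forall z : T, ~ L z -> L (act g z).
Let toR g := forall z : T, L z -> ~ L (act g z).
Hypotheses (aL : toL a) (a'L : toL a') (aaL : toL (a^-1 * a')).
Hypotheses (bVR : toR b^-1) (b'VR : toR b'^-1) (bbR : toR (b * b'^-1)).
Let x := a * b.
Let y := a' * b'.

(** Attracting sets of [x], [x^-1], [y], [y^-1]: the images of the complement of [L] under [a] and
    [a'], inside [L], and those of [L] under [b^-1] and [b'^-1], outside [L]. The conditions on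
    [a^-1 * a'] and [b * b'^-1] make them pairwise disjoint. *)
Let attr (l : bool * bool) : set T :=
  match l with
  | (true, true) => [set z | ~ L (act a^-1 z)]
  | (true, false) => [set z | L (act b z)]
  | (false, true) => [set z | ~ L (act a'^-1 z)]
  | (false, false) => [set z | L (act b' z)]
  end.
Let val (l : bool * bool) := let g := if l.1 then x else y in if l.2 then g else g^-1.
Let flip (l : bool * bool) := (l.1, ~~ l.2).

Let attr_side l z : attr l z -> if l.2 then L z else ~ L z.
Proof.
case: l => [[] []] /= h.
- by rewrite -(actKV a z); apply: aL.
- by rewrite -(actK b z); apply: bVR.
- by rewrite -(actKV a' z); apply: a'L.
- by rewrite -(actK b' z); apply: b'VR.
Qed.

Let attr_disjoint l m z : attr l z -> attr m z -> l = m.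
Proof.
move=> hl hm; have sl := attr_side hl; have sm := attr_side hm.
case: l m hl hm sl sm => [[] []] [[] []] //= hl hm sl sm; exfalso; try by [].
- have := aaL hm; rewrite -actM -mulgA mulgV mulg1; exact: hl.
- have := bbR hm; rewrite -actM -mulgA mulVg mulg1; apply; exact: hl.
- have := aaL hl; rewrite -actM -mulgA mulgV mulg1; exact: hm.
- have := bbR hl; rewrite -actM -mulgA mulVg mulg1; apply; exact: hm.
Qed.

Let attr_val l z : ~ attr (flip l) z -> attr l (act (val l) z).
Proof.
case: l => [[] []] /= h; rewrite /val /x /y /=.
- by rewrite -actM mulKg.
- by rewrite invgM -actM mulVKg; apply: contrapT.
- by rewrite -actM mulKg.
- by rewrite invgM -actM mulVKg; apply: contrapT.
Qed.

Let attr_neq0 l : attr l !=set0.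
Proof.
have [z Lz] := L0; have [t Rt] := R0.
case: l => [[] []].
- by exists (act a t); rewrite /= actK.
- by exists (act b^-1 z); rewrite /= actKV.
- by exists (act a' t); rewrite /= actK.
- by exists (act b'^-1 z); rewrite /= actKV.
Qed.

Let xy : x <> y.
Proof.
move=> E; have [z hz] := attr_neq0 (true, true).
have h1 : attr (true, true) (act x z).
  have h : ~ attr (true, false) z by move=> h; have := attr_disjoint hz h.
  exact: (attr_val (l := (true, true)) h).
have h2 : attr (false, true) (act x z).
  have h : ~ attr (false, false) z by move=> h; have := attr_disjoint hz h.
  by rewrite E; exact: (attr_val (l := (false, true)) h).
by have := attr_disjoint h1 h2.
Qed.

Let code (l : G * bool) : bool * bool := (`[< l.1 = x >], l.2).

Let letter_code l : l.1 = x \/ l.1 = y -> letter_val l = val (code l).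
Proof.
case: l => g c /= h; rewrite /letter_val /val /code /=.
have [->|gx] := EM (g = x); first by have -> : `[< x = x >] by apply/asboolP.
have -> : `[< g = x >] = false by apply/asboolPn.
by case: h => // ->.
Qed.

Let word_attr l w : (forall m, In m (l :: w) -> m.1 = x \/ m.1 = y) -> reduced (l :: w) ->
  exists m, forall z, ~ attr (flip m) z -> attr (code l) (act (word_val (l :: w)) z).
Proof.
elim: w l => [|k w IH] l hX.
  move=> _; exists (code l) => z hz; rewrite /= mulg1 letter_code; last by apply: hX; left.
  exact: attr_val.
move=> [lk rw]; have [|m hm] := IH k _ rw; first by move=> m ml; apply: hX; right.
exists m => z hz; have hk := hm z hz.
rewrite [word_val _]/(letter_val l * word_val (k :: w)) actM letter_code; last by apply: hX; left.
apply: attr_val => hf; apply: lk; have [E1 E2] := attr_disjoint hf hk.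
have Xl : l.1 = x \/ l.1 = y by apply: hX; left.
have Xk : k.1 = x \/ k.1 = y by apply: hX; right; left.
split; last by rewrite -E2; case: (l.2).
have [lx|lx] := EM (l.1 = x).
  have /asboolP kx : `[< k.1 = x >] by rewrite -E1; apply/asboolP.
  by rewrite lx kx.
have kx : k.1 <> x by apply/asboolPn; rewrite -E1; apply/asboolPn.
by case: Xl => // ->; case: Xk => // ->.
Qed.

Let word_neq1 w : w <> nil -> (forall m, In m w -> m.1 = x \/ m.1 = y) -> reduced w ->
  word_val w <> 1.
Proof.
case: w => // l w _ hX rw E; have [m hm] := word_attr hX rw.
(* With four letters a third one is available: its attracting set would be mapped by the word into a
   set disjoint from it. *)
have [t [tl tm]] : exists t, t <> code l /\ t <> flip m.
  case: (code l) (flip m) => [[] []] [[] []]; solve [by exists (true, true)|by exists (true, false)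
    |by exists (false, true)|by exists (false, false)].
have [z hz] := attr_neq0 t; apply: tl; apply: attr_disjoint (hz) _.
rewrite -(act1 z) -E; apply: hm => h; apply: tm; exact: attr_disjoint hz h.
Qed.

Lemma ping_pong_not_small : ~ small P.
Proof.
have Px : P x by case: sP => _ PM _; apply: PM.
have Py : P y by case: sP => _ PM _; apply: PM.
apply; exists (gen [set g | g = x \/ g = y]); split.
- split; first exact: gen_subgroup.
  exists [set g | g = x \/ g = y]; split=> // w w0 hX rw; exact: word_neq1.
- by apply: gen_min => // g [->|->].
- move=> ab.
  have Exy : x * y = y * x by apply: ab; apply: gen_sub; [left|right].
  apply: (@word_neq1 [:: (x, true); (y, true); (x, false); (y, false)]) => //.
  + by move=> m /= [<-|[<-|[<-|[<-|[]]]]] /=; [left|right|left|right].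
  + by rewrite /=; do !split; move=> // -[E _]; [exact: xy|exact: xy|exact: xy].
  + have E : x * (y * (x^-1 * y^-1)) = 1 by rewrite -invgM -Exy mulgA mulgV.
    by rewrite /= /letter_val /= mulg1.
Qed.

End PingPong.

(** * Bounded orbits and small groups acting on trees *)

Section FixedPoints.
Variables (G : groupType) (T : gGraph G).
Hypothesis conn : connected_graph (@adj G T).
Hypothesis acyclic : forall (x : T) p, ~ circuit adj x p.
Hypothesis noinv : without_inversions T.
Implicit Types (u v w x y z : T) (g h : G) (P A B : set G).
Local Notation d := (dist (@adj G T)).
Let dS := dist_sym (@adj_sym G T) conn.
Let dT := dist_tri conn.

Lemma dist_through u v x z : adj u v -> ~ side u v x -> side u v z ->
  (d x u + d u z <= d x z)%N /\ (d x v + d v z <= d x z)%N.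
Proof.
move=> uv nx sz; have [p [wp gp] sp] := geodesic_exists conn x z.
have [iu iv] := crossing acyclic uv wp nx sz.
by split; apply: (geodesic_mem conn (conj wp gp)) => //; right.
Qed.

Lemma dist_adj1 u v : adj u v -> d u v = 1%N.
Proof.
move=> uv; have := dist_adj conn uv; case E : (d u v) => [|[|?]] // _.
by have F := dist_eq0 conn E; case: (@adj_irr _ _ u); rewrite {2}F.
Qed.

(* The centre of a bounded orbit is a vertex or an edge. *)
Lemma bounded_orbit_elliptic P x (B : nat) : subgroup P -> (forall h, P h -> (d x (act h x) <= B)%N) ->
  exists v, P `<=` vstab v.
Proof.
move=> [P1 PM PV] hB.
pose M R := [set c : T | forall h, P h -> (d c (act h x) <= R)%N].
have ex : exists R, `[< exists c, M R c >] by exists B; apply/asboolP; exists x.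
case: (ex_minnP ex) => R /asboolP[c0 Mc0] minR.
have inv c g : P g -> M R c -> M R (act g c).
  move=> Pg Mc h Ph; rewrite -(dist_act conn g^-1) actK -actM; apply: Mc.
  by apply: PM => //; apply: PV.
(* If two centres of minimal radius were not adjacent, a neighbour [m] of [c] on the way to [c']
   would be strictly closer to every point of the orbit than one of them, lowering the radius. *)
have near c c' : M R c -> M R c' -> c <> c' -> adj c c'.
  move=> Mc Mc' cc'; have [p [wp gp] sp] := geodesic_exists conn c c'.
  have [q [wq nq sq _]] := walk_simple wp.
  case: q wq nq sq => [//|m q] wq nq sq; have cm := wq.1.
  case: q wq nq sq => [|t q] wq nq sq; first by case: wq => ? <-.
  exfalso; have d2 : (2 <= d c c')%N by apply: leq_trans _ (leq_trans sq _); [|rewrite sp].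
  have sc' := simple_beyond wq nq.
  have lt z : (d m z < maxn (d c z) (d c' z))%N.
    have [sz|sz] := EM (side c m z).
      have [_] := dist_through cm (side_source acyclic cm) sz.
      by rewrite (dist_adj1 cm); lia.
    have [h1 _] := dist_through cm sz sc'.
    by have := dT c m z; rewrite [d m c]dS (dist_adj1 cm) [d c' z]dS; have := dS c z; lia.
  have R0 : (0 < R)%N.
    by have := lt (act 1 x); have := Mc 1 P1; have := Mc' 1 P1; lia.
  suff : (R <= R.-1)%N by lia.
  apply: minR; apply/asboolP; exists m => h' Ph'.
  by have := lt (act h' x); have := Mc h' Ph'; have := Mc' h' Ph'; lia.
exists c0 => h Ph; rewrite /vstab /=; apply: contrapT => hc.
have M1 := inv _ _ Ph Mc0; have M2 := inv _ _ Ph M1.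
have a1 : adj c0 (act h c0) by apply: near => // E; apply: hc.
have a2 : adj (act h c0) (act h (act h c0)) by apply: act_adj.
(* The vertices [c0], [h c0], [h (h c0)] give either an inversion or a triangle. *)
have [E|ne] := EM (act h (act h c0) = c0); first exact: (noinv (g := h) a1 (conj erefl E)).
have a3 : adj (act h (act h c0)) c0 by apply: near.
apply: (@acyclic c0 [:: act h c0; act h (act h c0); c0]); split=> //.
have n1 : act h c0 <> act h (act h c0) by move=> E; rewrite -E in a2; exact: adj_irr a2.
constructor; first by move=> /= [/esym//|[/esym|]].
constructor; first by move=> /= [/esym|].
by constructor=> //; constructor.
Qed.

Lemma edge_at_distance x z u v u' v' : adj u v -> adj u' v' ->
  ~ side u v x -> side u v z -> ~ side u' v' x -> side u' v' z -> d x u = d x u' ->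
  u = u' /\ v = v'.
Proof.
move=> uv uv' nx sz nx' sz' E; have [f [f0 fe fa fd]] := geodesic_fun conn x z.
have cross s t : adj s t -> ~ side s t x -> side s t z ->
    s = f (d x s) /\ t = f (d x s).+1.
  move=> st nsx ssz.
  have [|p [wp _ hp]] := @walk_of_fun _ (fun c e => exists i, [/\ (i < d x z)%N, c = f i & e = f i.+1]) f 0 (d x z).
    by move=> i hi; exists i; split=> //; lia.
  rewrite add0n f0 fe in wp.
  have [|c [e [[i [hi -> ->]] nc se _ _]]] := @walk_cross _ _ (fun z => ~ side s t z) _ _ _ wp nsx.
    by move=> h; apply: h.
  have [E1 E2] := side_step acyclic st (adj_sym (fa _ hi)) (contrapT se) nc.
  have Ei : d x s = i by rewrite -E2 -{1}f0 fd ?subn0 //; lia.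
  by rewrite Ei E1 E2.
by have [-> ->] := cross _ _ uv nx sz; have [-> ->] := cross _ _ uv' nx' sz'; rewrite E.
Qed.

Lemma almost_acylindrical_pair k x y : almost_k_acylindrical k T -> (k < d x y)%N ->
  finite_set (vstab x `&` vstab y).
Proof.
move=> ak kd; have [p0 wp0] := conn x y; have [p [wp np _ _]] := walk_simple wp0.
have kp : (k < size p)%N by apply: leq_trans kd (dist_le conn wp).
apply: sub_finite_set (ak x p y wp np kp) => g [gx gy] v.
exact: (fixed_segment acyclic wp np gx gy).
Qed.

(* If the orbit of a fixed point [x] of [A] is unbounded then [A] and a conjugate
   play ping-pong on both sides of the middle edge of a long segment [x, g x],
   whose stabilizers in [A] and in the conjugate are finite. *)
Lemma small_elliptic P A x k : subgroup P -> small P -> almost_k_acylindrical k T ->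
  subgroup A -> A `<=` P -> infinite_set A -> A `<=` vstab x -> exists v, P `<=` vstab v.
Proof.
move=> sP smP ak sA AP iA Ax; have [P1 PM PV] := sP.
have [bnd|unb] := EM (exists m : nat, forall h, P h -> (d x (act h x) <= m)%N).
  by case: bnd => B hB; apply: bounded_orbit_elliptic hB.
(* This length leaves an edge [uv] with more than [k] edges of the segment on either side. *)
exfalso; have [g Pg hg] : exists2 g, P g & (2 * k + 3 <= d x (act g x))%N.
  apply: contrapT => no; apply: unb; exists (2 * k + 3)%N => h Ph.
  by rewrite leqNgt; apply/negP => lt; apply: no; exists h => //; apply: ltnW.
set y := act g x in hg.
pose B := conjs A g^-1.
have sB : subgroup B by apply: conjs_subgroup.
have iB : infinite_set B by apply: conjs_infinite.
have BP : B `<=` P.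
  move=> b /conjsE; rewrite invgK => /AP Pb; rewrite -(conjgK g b) conjgE.
  by apply: (PM); [rewrite invgK|apply: PM => //; apply: PV].
have By : B `<=` vstab y.
  by move=> b Bb; rewrite vstab_act; apply: conjs_mono Bb.
have [f [f0 fe fa fd]] := geodesic_fun conn x y.
pose u := f k.+1; pose v := f k.+2.
have uv : adj u v by apply: fa; lia.
have dxu : d x u = k.+1 by rewrite -{1}f0 fd ?subn0 //; lia.
have dxv : d x v = k.+2 by rewrite -{1}f0 fd ?subn0 //; lia.
have dyv : (k < d y v)%N by rewrite dS -{1}fe fd; lia.
have dyu : d y u = (d y v).+1.
  by rewrite ![d y _]dS -{1}fe fd; [rewrite -{2}fe fd|]; lia.
have nsx : ~ side u v x.
  move=> sx; have [_] := dist_through uv (side_source acyclic uv) sx.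
  by rewrite (dist_adj1 uv) ![d _ x]dS; lia.
have sy : side u v y.
  apply: contrapT => ny; have sy' := sideN conn acyclic uv ny.
  have nvy : ~ side v u v by apply: side_source => //; apply: adj_sym.
  have [_] := dist_through (adj_sym uv) nvy sy'.
  by rewrite (dist_adj1 (adj_sym uv)) ![d _ y]dS; lia.
(* If some point beyond [st] stayed beyond it, then [st] and its image under [c] would be edges of
   one geodesic at the same distance from the fixed point [e], so [c] would fix [st]. *)
have half C e c s t : adj s t -> C `<=` vstab e -> ~ side s t e -> C c -> ~ estab s t c ->
    forall z, side s t z -> ~ side s t (act c z).
  move=> st Ce ne Cc nc z sz scz; apply: nc.
  have ce : act c e = e := Ce c Cc.
  have n1 : ~ side (act c s) (act c t) e by rewrite -{1}ce side_act.
  have s1 : side (act c s) (act c t) (act c z) by apply/side_act.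
  have E : d e (act c s) = d e s by rewrite -{1}ce (dist_act conn).
  by have [E1 E2] := edge_at_distance (act_adj c st) st n1 s1 ne scz E.
have fA : finite_set (A `&` estab u v).
  apply: sub_finite_set (almost_acylindrical_pair ak (x := x) (y := u) _); last by rewrite dxu.
  by move=> c [Ac [cu _]]; split=> //; apply: Ax.
have fB : finite_set (B `&` estab u v).
  apply: sub_finite_set (almost_acylindrical_pair ak (x := y) (y := v) _); last by [].
  by move=> c [Ac [_ cv]]; split=> //; apply: By.
have [A1 AM AV] := sA; have [B1 BM BV] := sB.
have sE : subgroup (estab u v) by apply: subgroupI; apply: vstab_subgroup.
have [_ EM' EV] := sE.
have [a [Aa na] _] := infinite_notin nil (infinite_setD iA fA).
have [a' [Aa' na'] naa] : exists2 a', A a' /\ ~ (A `&` estab u v) a' & ~ (A `&` estab u v) (a^-1 * a').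
  have [l hl] := (finite_listP _).1 fA.
  have [a' h1 h2] := infinite_notin (List.map (fun e => a * e) l) (infinite_setD iA fA).
  by exists a' => // /hl ?; apply: h2; apply/in_map_iff; exists (a^-1 * a'); rewrite mulVKg.
have [b [Bb nb] _] := infinite_notin nil (infinite_setD iB fB).
have [b' [Bb' nb'] nbb] : exists2 b', B b' /\ ~ (B `&` estab u v) b' & ~ (B `&` estab u v) (b * b'^-1).
  have [l hl] := (finite_listP _).1 fB.
  have [b' h1 h2] := infinite_notin (List.map (fun e => e^-1 * b) l) (infinite_setD iB fB).
  exists b' => // /hl ?; apply: h2; apply/in_map_iff; exists (b * b'^-1); split=> //.
  by rewrite invgM invgK -mulgA mulVg mulg1.
have out C c : subgroup C -> C c -> ~ (C `&` estab u v) c -> C c^-1 /\ ~ (C `&` estab u v) c^-1.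
  move=> [_ _ CV] Cc nc; split; first exact: CV.
  by move=> [_ /EV]; rewrite invgK => ?; apply: nc.
have toL c : A c -> ~ (A `&` estab u v) c -> forall z, ~ side v u z -> side v u (act c z).
  move=> Ac nc z sz; apply: sideN => //; apply: (half A x c u v) => //.
    by move=> ec; apply: nc.
  by apply: sideN => //; apply: adj_sym.
have toR c : B c -> ~ (B `&` estab u v) c -> forall z, side v u z -> ~ side v u (act c z).
  move=> Bc nc; apply: (half B y c v u) => //; first exact: adj_sym.
    exact: side_disjoint sy.
  by move=> [cv cu]; apply: nc.
have [AVa naV] := out A a sA Aa na.
have [BVb nbV] := out B b sB Bb nb; have [BVb' nbV'] := out B b' sB Bb' nb'.
apply: (@ping_pong_not_small _ T (side v u) a a' b b' P) => //.
- exact: AP. - exact: AP. - exact: BP. - exact: BP.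
- by exists u; apply: side_refl.
- by exists v; apply: side_source => //; apply: adj_sym.
- exact: toL. - exact: toL.
- by apply: toL => //; apply: AM.
- exact: toR. - exact: toR.
- by apply: toR => //; apply: BM.
Qed.

End FixedPoints.

(** * The tree of cylinders *)

Lemma circuit_rotate (V : Type) (r : V -> V -> Prop) x y q :
  circuit r x (y :: q) -> circuit r y (q ++ [:: y]).
Proof.
move=> [[xy wq] /(NoDup_cons_iff y q)[ny nq] s]; split.
- exact: walk_rcons wq xy.
- apply: NoDup_app => //; first by constructor=> //; constructor.
  by move=> a aq [E|[]]; apply: ny; rewrite E.
- by rewrite size_cat addn1.
Qed.

Lemma side_distinct (G : groupType) (T : gGraph G) (x b w : T) : (forall (x : T) p, ~ circuit adj x p) ->
  adj x b -> adj x w -> b <> w -> side x b `<=` side w x.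
Proof.
move=> acyclic xb xw bw; apply: side_nested => //.
  by move=> [/(side_source acyclic xb)].
exists [:: b]; split=> //; split=> // -[[E _]|[_ E]]; last exact: bw.
by rewrite -E in xw; case: (@adj_irr _ _ _ xw).
Qed.

(** [C] contains a power of [h], which fixes [x] and has finitely many cosets in [A]; so the orbit
    of [x] is finite. *)
Lemma vgen_elliptic (G : groupType) (T : gGraph G) (A C : set G) h (x : T) : is_gtree T ->
  subgroup A -> virtually_gen A h -> subgroup C -> infinite_set C -> C `<=` A ->
  C `<=` vstab x -> elliptic T A.
Proof.
move=> [_ conn acyclic noinv] sA vA sC iC CA Cx.
have [n n0 Cn] := vgen_meet vA sC iC CA.
have [|_ _ [F /finite_listP[l hl] hF]] := @vgen_pow _ _ _ (Posz n) sA vA; first by lia.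
have [_ _ AV] := sA.
apply: (@bounded_orbit_elliptic _ _ conn acyclic noinv A x
  (\max_(t <- l) dist adj x (act t^-1 x))%N sA) => a Aa.
have [z Fz] := hF _ (AV _ Aa).
have -> : act a x = act (zexp (zexp h (Posz n)) z * a^-1)^-1 x.
  rewrite invgM invgK actM -zexpN; congr act; apply/esym.
  apply: (@zexp_subgroup _ (vstab x) (h ^+ n)); first exact: vstab_subgroup.
  exact: Cx.
apply: (leq_bigmax_seq (F := fun t => dist adj x (act t^-1 x))) => //.
by apply/In_mem; apply: hl.
Qed.

(** Fixed points are chosen at one representative per orbit and transported. The representative is
    picked from the orbit as a set, so equal orbits give equal picks. *)
Lemma equivariant_map (G : groupType) (T T' : gGraph G) :
  (forall p : T, elliptic T' (vstab p)) -> dominates T T'.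
Proof.
move=> /choice[phi hphi].
pose orbit (p : T) : set T := [set q | exists g, act g q = p].
have ex p : exists q, orbit p q by exists p, 1; rewrite act1.
pose pick (S : set T) (h : exists q, S q) := projT1 (cid h).
pose rep p := pick (orbit p) (ex p).
have repE g p : rep (act g p) = rep p.
  have E : orbit (act g p) = orbit p.
    apply/seteqP; split=> q [k Ek].
      by exists (g^-1 * k); rewrite actM Ek actK.
    by exists (g * k); rewrite actM Ek.
  rewrite /rep; move: (ex (act g p)) (ex p); rewrite E => e1 e2.
  by rewrite (Prop_irrelevance e1 e2).
have /choice[gam hgam] : forall p, exists g, act g (rep p) = p by move=> p; exact: (projT2 (cid (ex p))).
exists (fun p => act (gam p) (phi (rep p))) => g p; rewrite repE.
have : vstab (rep p) ((gam (act g p))^-1 * (g * gam p)).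
  by rewrite /vstab /= !actM hgam -{2}(hgam (act g p)) repE actK.
move=> /hphi; rewrite /vstab /= !actM => E.
by rewrite -{1}E actKV.
Qed.

Section Cylinders.
Variables (G : groupType) (n : nat) (H : 'I_n -> set G).
Hypothesis hsub : forall i, subgroup (H i).
Hypothesis hends : forall i, one_ended (H i).
Hypothesis hrel : relatively_hyperbolic H.
Variable T : gGraph G.
Hypothesis hT : is_gtree T.
Hypothesis hE : forall u v : T, adj u v -> infinite_elementary H (estab u v).
Implicit Types (A B C E : set G) (u v w x y z : T).
Let conn : connected_graph (@adj G T). Proof. by case: hT. Qed.
Let acyclic : forall (x : T) p, ~ circuit adj x p. Proof. by case: hT. Qed.
Local Notation Tc := (tree_of_cylinders H T).
Local Notation R := (coelementary H).

Lemma estab_subgroup (T' : gGraph G) (u v : T') : subgroup (estab u v).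
Proof. by apply: subgroupI; apply: vstab_subgroup. Qed.

Definition cylinder E : set (T * T) := [set e | adj e.1 e.2 /\ estab e.1 e.2 `<=` E].

Lemma cylinder_ofE E u v : is_hull H E -> adj u v -> estab u v `<=` E ->
  cylinder_of R u v = cylinder E.
Proof.
move=> hullE uv uvE; have [iuv _] := hE uv.
by apply/seteqP; split=> -[x y] /= [xy h]; split=> //;
  apply/(coelementary_hull hullE iuv uvE (estab_subgroup x y)).
Qed.

Lemma is_cylinderP Y : is_cylinder R Y -> exists E, [/\ is_hull H E, Y = cylinder E
  & exists u v, cylinder E (u, v)].
Proof.
move=> [u [v [uv ->]]]; have [E hullE uvE] := hull_exists hrel (hE uv).
by exists E; split=> //; [exact: cylinder_ofE|exists u, v].
Qed.

Lemma cylinder_is_cylinder E e : is_hull H E -> cylinder E e -> is_cylinder R (cylinder E).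
Proof. by move=> hullE [uv uvE]; exists e.1, e.2; split=> //; rewrite (cylinder_ofE hullE). Qed.

Lemma cylinder_inj E E' e : is_hull H E -> is_hull H E' -> cylinder E e -> cylinder E' e -> E = E'.
Proof. by move=> hE1 hE2 [uv h1] [_ h2]; have [i _] := hE uv; exact: (hull_uniq hE1 hE2 i h1 h2). Qed.

Lemma cylinder_sym E u v : cylinder E (u, v) -> cylinder E (v, u).
Proof. by move=> [uv h]; split; [exact: adj_sym|rewrite /= /estab setIC]. Qed.

Lemma act_cylinder g E : act_edges g (cylinder E) = cylinder (conjs E g^-1).
Proof.
apply/seteqP; split=> -[u v]; rewrite /act_edges /cylinder /=.
  move=> [/adj_actE uv h]; split=> //; rewrite estab_act invgK in h.
  by rewrite -(conjsK (estab u v) g); apply: conjs_mono.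
move=> [uv h]; split; first exact: act_adj.
by rewrite estab_act invgK -(conjsKV E g); apply: conjs_mono.
Qed.

Lemma cylinder_stabilizer E e g : is_hull H E -> cylinder E e ->
  (act_edges g (cylinder E) = cylinder E <-> E g).
Proof.
move=> hullE Ee; have [sE1 sEM sEV] := hull_subgroup hullE.
rewrite act_cylinder; split=> [h|Eg].
  have : cylinder (conjs E g^-1) e by rewrite h.
  move=> /(cylinder_inj (hull_conj _ hullE) hullE)/(_ Ee) => E1.
  by case: hullE => _ _ _ nE _; rewrite -[g]invgK; apply: sEV; apply: nE.
congr cylinder; apply/seteqP; split=> x.
  move=> /conjsE; rewrite invgK => h; rewrite -(conjgK g x) conjgE invgK.
  by apply: (sEM) => //; apply: sEM => //; apply: sEV.
move=> Ex; apply/conjsE; rewrite invgK conjgE.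
by apply: (sEM); [exact: sEV|apply: sEM].
Qed.

(** It suffices that [E] meets the edge stabilizer in an infinite set. In a virtually cyclic hull a
    common power lies in [A] and [B] and fixes the whole segment; in a conjugate of some [H i],
    one-endedness applies. *)
Lemma hull_segment E A B a b u v : is_hull H E -> subgroup A -> subgroup B ->
  infinite_set A -> infinite_set B -> A `<=` E -> B `<=` E ->
  A `<=` vstab a -> B `<=` vstab b -> adj u v -> ~ side u v a -> side u v b ->
  estab u v `<=` E.
Proof.
move=> hullE sA sB iA iB AE BE Aa Bb uv na sb; have [_ eE mE _ cE] := hullE.
have sE := hull_subgroup hullE; have [iuv euv] := hE uv.
apply: mE => //; case: cE => [[h vE]|[i [g Eg]]]; last first.
  apply: (one_ended_segment conn acyclic sE _ uv AE BE iA iB Aa Bb na sb).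
  by rewrite Eg; apply: conjs_has_ends; apply: hends.
have [p p0 Ap] := vgen_meet vE sA iA AE; have [q q0 Bq] := vgen_meet vE sB iB BE.
have [Eh ih _] := vE.
have ix : infinite_order (h ^+ (p * q)) by apply: (@infinite_order_pow _ h (Posz (p * q)) ih); lia.
apply: infinite_sub (infinite_powers ix) => x [z ->].
have Ax : A (zexp (h ^+ (p * q)) z).
  by apply: zexp_subgroup => //; rewrite expgnA; apply: (@zexp_subgroup _ A _ (Posz q)).
have Bx : B (zexp (h ^+ (p * q)) z).
  by apply: zexp_subgroup => //; rewrite mulnC expgnA; apply: (@zexp_subgroup _ B _ (Posz p)).
split; first exact: AE.
exact: (fixed_separating conn acyclic uv na sb (Aa _ Ax) (Bb _ Bx)).
Qed.

Lemma cylinder_convex E x y u v : is_hull H E -> on_cylinder x (cylinder E) ->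
  on_cylinder y (cylinder E) -> adj u v -> ~ side u v x -> side u v y -> cylinder E (u, v).
Proof.
move=> hullE [x' [xx hx]] [y' [yy hy]] uv nx sy; split=> //.
have [ix _] := hE xx; have [iy _] := hE yy.
apply: (hull_segment hullE (estab_subgroup x x') (estab_subgroup y y') ix iy hx hy _ _ uv nx sy).
  by move=> g [].
by move=> g [].
Qed.

Lemma first_edge x y : x <> y -> exists2 b, adj x b & side x b y.
Proof.
move=> xy; have [p0 wp0] := conn x y; have [p [wp np _ _]] := walk_simple wp0.
case: p wp np => [//|b p] wp np; exists b; first by case: wp.
exact: simple_beyond wp np.
Qed.

Lemma cylinder_first_edge E x y : is_hull H E -> on_cylinder x (cylinder E) ->
  on_cylinder y (cylinder E) -> x <> y -> exists2 b, cylinder E (x, b) & side x b y.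
Proof.
move=> hullE ox oy /first_edge[b xb sb]; exists b => //.
by apply: (cylinder_convex hullE ox oy xb _ sb); apply: side_source.
Qed.

(** At [x1] the path leaves the cylinder along [w], hence not towards [x]; so the edge at [x]
    pointing to [x1] also points to [y]. *)
Lemma extend_path E x x1 w y : is_hull H E -> on_cylinder x (cylinder E) ->
  on_cylinder x1 (cylinder E) -> x <> x1 -> adj x1 w -> ~ cylinder E (x1, w) -> side x1 w y ->
  exists2 b, cylinder E (x, b) & side x b y.
Proof.
move=> hullE ox ox1 xx1 x1w nw sy.
have [b Eb sb] := cylinder_first_edge hullE ox1 ox (nesym xx1).
have [c Ec sc] := cylinder_first_edge hullE ox ox1 xx1.
exists c => //; have [x1b _] := Eb; have [xc _] := Ec.
have bw : b <> w by move=> E1; apply: nw; rewrite -E1.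
have nx : ~ side x1 w x.
  by move=> sx; apply: (side_disjoint acyclic x1w sx); apply: side_distinct sb.
apply: (side_nested (u := x1) (v := w) (a := c) (b := x)) sy => //; first by move=> [].
apply: contrapT => nsw; have [E1 E2] := side_step acyclic xc x1w sc nsw.
by apply: nx; rewrite E2; apply: side_refl.
Qed.

Lemma on_cylinder_V1 (Y : V1 R T) : exists E, [/\ is_hull H E, proj1_sig Y = cylinder E
  & exists u v, cylinder E (u, v)].
Proof. by apply: is_cylinderP; case: Y. Qed.

Lemma V1_eq (Y Y' : V1 R T) : proj1_sig Y = proj1_sig Y' -> Y = Y'.
Proof. by case: Y Y' => [Y hY] [Y' hY'] /= E; apply: eq_exist. Qed.

Lemma V1_inj (Y Y' : V1 R T) e : proj1_sig Y e -> proj1_sig Y' e -> Y = Y'.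
Proof.
have [E [hullE EY _]] := on_cylinder_V1 Y; have [E' [hullE' EY' _]] := on_cylinder_V1 Y'.
rewrite EY EY' => h1 h2; apply: V1_eq.
by rewrite EY EY' (cylinder_inj hullE hullE' h1 h2).
Qed.

Lemma V0_eq (x y : V0 R T) : proj1_sig x = proj1_sig y -> x = y.
Proof. by case: x y => [x hx] [y hy] /= E; apply: eq_exist. Qed.

(** A simple path of T_c never backtracks in T: passing to a new cylinder at each intermediate
    vertex, it ends in the half-tree indicated by its first cylinder. The bound [m] allows steps of
    two edges. *)
Lemma Tc_path m p (x y : V0 R T) : (size p <= m)%N -> walk (@adj G Tc) (inl x) p (inl y) ->
  NoDup (inl x :: p) -> p <> nil ->
  exists Y p' b, [/\ p = inr Y :: p', proj1_sig Y (proj1_sig x, b) & side (proj1_sig x) b (proj1_sig y)].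
Proof.
elim: m p x => [|m IH] p x; first by case: p.
case: p => [//|[?|Y] p]; first by move=> _ [].
case: p => [|[x1|?] p]; [by move=> _ []| |by move=> _ [_ []]].
move=> sp [oxY [ox1Y wp]] np _.
have [E [hullE EY _]] := on_cylinder_V1 Y.
have xx1 : proj1_sig x <> proj1_sig x1.
  move=> /V0_eq E1; have [nx _] := (NoDup_cons_iff _ _).1 np; apply: nx.
  by right; left; rewrite E1.
have {}oxY : on_cylinder (proj1_sig x) (cylinder E) by rewrite -EY.
have {}ox1Y : on_cylinder (proj1_sig x1) (cylinder E) by rewrite -EY.
exists Y, (inl x1 :: p).
case: p wp np sp => [|q p] wp np sp.
  move: wp => /= [<-]; have [b Eb sb] := cylinder_first_edge hullE oxY ox1Y xx1.
  by exists b; split=> //; rewrite EY.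
have [_ np1] := (NoDup_cons_iff _ _).1 np; have [nY np2] := (NoDup_cons_iff _ _).1 np1.
have [||Y2 [p' [w [Eq Y2w sw]]]] := IH (q :: p) x1 _ wp np2 _;
  [by move: sp => /=; lia|by []|].
have [E2 [hullE2 EY2 _]] := on_cylinder_V1 Y2.
have x1w : adj (proj1_sig x1) w by move: Y2w; rewrite EY2 => -[].
have [|b Eb sb] := extend_path hullE oxY ox1Y xx1 x1w _ sw; last first.
  by exists b; split=> //; rewrite EY.
move=> Yw; apply: nY; right; rewrite Eq; left; congr inr.
by apply: V1_inj Y2w _; rewrite EY.
Qed.

(** On a circuit, two different cylinders at [x1] would both contain an edge at [x1] pointing to
    [x0]; these edges are distinct and their half-trees disjoint. *)
Lemma Tc_acyclic (x : Tc) p : ~ circuit (@adj G Tc) x p.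
Proof.
have main (x0 : V0 R T) q : ~ circuit (@adj G Tc) (inl x0) q.
  move=> [wq nq sq]; case: q wq nq sq => [//|[?|Y] q]; first by case=> -[].
  case: q => [//|[x1|?] q]; last by move=> [_ []].
  move=> [oxY [ox1Y wq]] nq sq.
  have [_ nq1] := (NoDup_cons_iff _ _).1 nq; have [nY _] := (NoDup_cons_iff _ _).1 nq.
  have q0 : q <> nil by move=> E; rewrite E in sq.
  have [Y2 [p' [w [Eq Y2w sw]]]] := Tc_path (leqnn _) wq nq1 q0.
  have xx1 : proj1_sig x0 <> proj1_sig x1.
    move=> /V0_eq E1; have [nx _] := (NoDup_cons_iff _ _).1 nq1; apply: nx.
    by rewrite -E1; apply: walk_end_tail wq q0.
  have [E [hullE EY _]] := on_cylinder_V1 Y; have [E2 [hullE2 EY2 _]] := on_cylinder_V1 Y2.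
  have {}oxY : on_cylinder (proj1_sig x0) (cylinder E) by rewrite -EY.
  have {}ox1Y : on_cylinder (proj1_sig x1) (cylinder E) by rewrite -EY.
  have [b Eb sb] := cylinder_first_edge hullE ox1Y oxY (nesym xx1).
  have x1w : adj (proj1_sig x1) w by move: Y2w; rewrite EY2 => -[].
  have [x1b _] := Eb.
  apply: (side_disjoint acyclic x1w sw); apply: side_distinct sb => // bw.
  apply: nY; right; rewrite Eq; left; congr inr; apply: V1_inj Y2w _.
  by rewrite EY -bw.
case: x => [x0|Y]; first exact: main.
case: p => [|[x1|Y1] q]; [by case|by move=> hc; apply: main (circuit_rotate hc)|by move=> [[]]].
Qed.

Definition cyl_vertex u v (uv : adj u v) : V1 R T :=
  exist _ (cylinder_of R u v) (ex_intro _ u (ex_intro _ v (conj uv erefl))).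

Lemma cyl_vertex_edge u v (uv : adj u v) : proj1_sig (cyl_vertex uv) (u, v).
Proof.
have [E hullE uvE] := hull_exists hrel (hE uv).
by rewrite /= (cylinder_ofE hullE uv uvE).
Qed.

Lemma cyl_vertex_edgeC u v (uv : adj u v) : proj1_sig (cyl_vertex uv) (v, u).
Proof.
have [E hullE uvE] := hull_exists hrel (hE uv).
by rewrite /= (cylinder_ofE hullE uv uvE); apply: cylinder_sym.
Qed.

(** Consecutive edges of a path in T lie in the same cylinder or in two cylinders meeting at a
    vertex of [V0], which is then adjacent to both. *)
Lemma Tc_connected : connected_graph (@adj G Tc).
Proof.
pose reach (p q : Tc) := exists s, walk (@adj G Tc) p s q.
have rS p q : reach p q -> reach q p.
  by move=> [s ws]; have [s' [ws' _ _]] := walk_rev (@adj_sym G Tc) ws; exists s'.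
have rT p q r : reach p q -> reach q r -> reach p r.
  by move=> [s ws] [t wt]; exists (s ++ t); apply: walk_trans ws wt.
have share v (Y Y' : V1 R T) : on_cylinder v (proj1_sig Y) -> on_cylinder v (proj1_sig Y') ->
    reach (inr Y) (inr Y').
  move=> oY oY'; have [->|YY'] := EM (Y = Y'); first by exists nil.
  have v0 : is_V0 R v.
    left; exists (proj1_sig Y), (proj1_sig Y'); split=> //; [exact: proj2_sig|exact: proj2_sig|].
    by move=> E; apply: YY'; apply: V1_eq.
  by exists [:: inl (exist _ v v0); inr Y'].
have cyls (Y Y' : V1 R T) : reach (inr Y) (inr Y').
  have [E [hullE EY [u [v Euv]]]] := on_cylinder_V1 Y.
  have [E' [hullE' EY' [u' [v' Euv']]]] := on_cylinder_V1 Y'.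
  have [p wp] := conn v u'; have oY : on_cylinder v (proj1_sig Y).
    by exists u; rewrite EY; apply: cylinder_sym.
  have oY' : on_cylinder u' (proj1_sig Y') by exists v'; rewrite EY'.
  elim: p v wp Y oY {E hullE EY u Euv} => [|z p IH] v /=; first by move=> -> Y oY; apply: (share u').
  move=> [vz wp] Y oY; apply: (rT _ (inr (cyl_vertex vz))).
    by apply: share oY _; exists z; apply: cyl_vertex_edge.
  by apply: (IH z) => //; exists v; apply: cyl_vertex_edgeC.
have verts (x : V0 R T) : (exists Y : V1 R T, reach (inl x) (inr Y)) \/ (forall u v, ~ adj u v).
  case: x => x0 hx; have [[Y [Y' [cY cY' _ oY _]]]|no] := hx; last by right.
  by left; exists (exist _ Y cY), [:: inr (exist _ Y cY)].
have empty (Y : V1 R T) : ~ (forall u v, ~ adj u v).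
  by have [E [_ _ [u [v [uv _]]]]] := on_cylinder_V1 Y => no; apply: no uv.
move=> [x|Y] [x'|Y']; last exact: cyls.
- case: (verts x) => [[Y h]|no].
    case: (verts x') => [[Y' h']|/(empty Y)//].
    exact: rT h (rT _ _ _ (cyls _ _) (rS _ _ h')).
  have [[|z p] wp] := conn (proj1_sig x) (proj1_sig x'); last by case: wp => /no.
  by exists nil; rewrite (V0_eq wp).
- case: (verts x) => [[Y h]|/(empty Y')//]; exact: rT h (cyls _ _).
- case: (verts x') => [[Y' h]|/(empty Y)//]; exact: rT (cyls _ _) (rS _ _ h).
Qed.

Lemma Tc_gtree : is_gtree Tc.
Proof.
split; [|exact: Tc_connected|exact: Tc_acyclic|].
- have [[x] _ _ _] := hT; have [[u [v uv]]|no] := EM (exists u v : T, adj u v).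
    by constructor; exact: (inr (cyl_vertex uv)).
  have vx : is_V0 R x by right=> u v uv; apply: no; exists u, v.
  by constructor; exact: (inl (exist _ x vx)).
- by move=> g [x|Y] [x'|Y'] //= _ [].
Qed.

(** * Stabilizers, elliptic subgroups and acylindricity of the tree of cylinders *)

Lemma vstab_V0 (x : V0 R T) : vstab (inl x : Tc) = vstab (proj1_sig x).
Proof.
apply/seteqP; split=> g; rewrite /vstab /=; first by move=> [] /(congr1 (@proj1_sig _ _)).
by move=> E; congr inl; apply: V0_eq.
Qed.

Lemma vstab_V1 E (Y : V1 R T) e : is_hull H E -> proj1_sig Y = cylinder E -> cylinder E e ->
  vstab (inr Y : Tc) = E.
Proof.
move=> hullE EY Ee; apply/seteqP; split=> g; rewrite /vstab /=.
  by move=> [] /(congr1 (@proj1_sig _ _)) /=; rewrite EY => /(cylinder_stabilizer _ hullE Ee).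
move=> Eg; congr inr; apply: V1_eq => /=.
by rewrite EY; apply/(cylinder_stabilizer _ hullE Ee).
Qed.

Lemma V1_hull (Y : V1 R T) : is_hull H (vstab (inr Y : Tc)).
Proof.
have [E [hullE EY [u [v uvE]]]] := on_cylinder_V1 Y.
by rewrite (vstab_V1 hullE EY uvE).
Qed.

(** A vertex outside [V0] lies on a single cylinder, which its stabilizer must preserve. *)
Lemma V0_or_V1 v : is_V0 R v \/ exists Y : V1 R T, vstab v `<=` vstab (inr Y : Tc).
Proof.
have [h|no] := EM (is_V0 R v); [by left|right].
have [w vw] : exists w, adj v w.
  apply: contrapT => nw; apply: no; right=> a b ab.
  have [[|z p] wp] := conn v a; last by apply: nw; exists z; case: wp.
  by apply: nw; exists b; move: wp => /= ->.
exists (cyl_vertex vw) => g gv.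
rewrite /vstab /=; congr inr; apply: eq_exist => /=; apply: contrapT => ne; apply: no; left.
exists (act_edges g (cylinder_of R v w)), (cylinder_of R v w); split=> //.
- by apply: act_is_cylinder; [exact: conjs_coelementary|exists v, w].
- by exists v, w.
- rewrite -{1}[v]gv; apply: act_on_cylinder; exists w; exact: (cyl_vertex_edge vw).
- by exists w; exact: (cyl_vertex_edge vw).
Qed.

(** The stabilizer contains that of an edge of the cylinder at [x], which is infinite, and is
    contained in the hull. *)
Lemma Tc_edge_stabilizer (p q : Tc) : adj p q -> infinite_elementary H (estab p q).
Proof.
have main (x : V0 R T) (Y : V1 R T) : on_cylinder (proj1_sig x) (proj1_sig Y) ->
    infinite_elementary H (estab (inl x : Tc) (inr Y)).
  have [E [hullE EY [u [v uvE]]]] := on_cylinder_V1 Y.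
  rewrite EY => -[w [xw hw]]; rewrite /estab vstab_V0 (vstab_V1 hullE EY uvE).
  have [iw _] := hE xw; split.
    by apply: infinite_sub iw => g gw; split; [case: gw|apply: hw].
  have [_ eE _ _ _] := hullE; apply: elementary_sub eE _ _; last by move=> g [].
  by apply: subgroupI; [exact: vstab_subgroup|exact: hull_subgroup hullE].
case: p q => [x|Y] [x'|Y'] //=; first exact: main.
by move=> /main; rewrite /estab setIC.
Qed.

Lemma to_collapsed_iso : is_giso (@to_collapsed G n H T).
Proof.
have cls (p q : Tc) : collapse_class (infinite_elementary H) p q -> p = q.
  elim=> [a b [ab]|//|a b c _ -> _ -> //].
  by case; apply: Tc_edge_stabilizer.
have inj : injective (@to_collapsed G n H T).
  move=> p q /(congr1 (@proj1_sig _ _)) /= E; apply: cls; rewrite E; exact: rt_refl.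
split.
- have /choice[f hf] : forall C : collapsed_tree_of_cylinders H T, exists p, to_collapsed p = C.
    by case=> C hC; case: (hC) => p Ep; exists p; apply: eq_exist.
  by exists f => // p; apply: inj.
- move=> g p; apply: eq_exist; apply/esym.
  exact: (act_collapse_class (@conjs_infinite_elementary G n H) (T := Tc)).
- move=> p q; split=> [[_ [u [v [/cls -> /cls -> //]]]]|pq]; split=> /=.
    move=> E; have Epq : p = q by apply: inj; apply: eq_exist.
    by rewrite Epq in pq; exact: adj_irr pq.
  exists p, q; split=> //; [exact: rt_refl|exact: rt_refl|exact: Tc_edge_stabilizer].
Qed.

Lemma nonelementary_stabilizers A : ~ elementary H A ->
  ((exists v : T, A = vstab v) <-> (exists p : Tc, A = vstab p)).
Proof.
move=> nA; split=> [[v Av]|[[x|Y] Ap]].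
- case: (V0_or_V1 v) => [hv|[Y hY]]; first by exists (inl (exist _ v hv)); rewrite vstab_V0.
  case: nA; have [_ eE _ _ _] := V1_hull Y; rewrite Av.
  exact: elementary_sub eE (vstab_subgroup v) hY.
- by exists (proj1_sig x); rewrite Ap vstab_V0.
- by case: nA; have [_ eE _ _ _] := V1_hull Y; rewrite Ap.
Qed.

Lemma hull_cylinder E u v : is_hull H E -> adj u v -> infinite_set (E `&` estab u v) ->
  exists Y : V1 R T, vstab (inr Y : Tc) = E.
Proof.
move=> hullE uv i; have [_ _ mE _ _] := hullE; have [_ euv] := hE uv.
have Ee : cylinder E (u, v) by split=> //; apply: mE.
pose Y : V1 R T := exist _ _ (cylinder_is_cylinder hullE Ee).
by exists Y; apply: (@vstab_V1 E Y (u, v)).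
Qed.

Lemma elliptic_Tc A : subgroup A -> (elliptic Tc A <-> elliptic T A \/ parabolic H A).
Proof.
have up v : A `<=` vstab v -> elliptic Tc A.
  move=> Av; case: (V0_or_V1 v) => [hv|[Y hY]].
    by exists (inl (exist _ v hv)); rewrite vstab_V0.
  by exists (inr Y) => g /Av/hY.
move=> sA; split=> [[[x|Y] Ap]|[[v Av]|[_ [i [g Ag]]]]].
- by left; exists (proj1_sig x); rewrite -vstab_V0.
- have [E [hullE EY [u [v [uv uvE]]]]] := on_cylinder_V1 Y.
  rewrite (vstab_V1 hullE EY (conj uv uvE : cylinder E (u, v))) in Ap.
  (* A virtually cyclic hull contains an infinite edge stabilizer of T and is therefore elliptic in
     T; the other hulls are parabolic. *)
  have [_ _ _ _ [[h vE]|[i [g Eg]]]] := hullE; last by right; split=> //; exists i, g; rewrite -Eg.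
  left; have [iuv _] := hE uv.
  have [|w Ew] := vgen_elliptic hT (hull_subgroup hullE) vE (estab_subgroup u v) iuv uvE (x := u).
    by move=> k [].
  by exists w => k /Ap/Ew.
- exact: up Av.
- have hullP := peripheral_hull hrel i g; set P := conjs (H i) g in hullP Ag.
  (* Either [P] meets some edge stabilizer in an infinite set and is the stabilizer of that
     cylinder, or all these intersections are finite and one-endedness gives a fixed vertex in T. *)
  have [[u [v [uv iuv]]]|no] := EM (exists u v, adj u v /\ infinite_set (P `&` estab u v)).
    by have [Y EY] := hull_cylinder hullP uv iuv; exists (inr Y); rewrite EY.
  have [[a] _ _ _] := hT.
  have [|u v uv|w Pw] := @one_ended_elliptic _ _ conn acyclic P (hull_subgroup hullP) _ a.
  + by apply: conjs_has_ends; apply: hends.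
  + by apply: contrapT => i0; apply: no; exists u, v.
  + by apply: (up w) => k /Ag/Pw.
Qed.

(** By bipartiteness a segment of length 3 contains two distinct cylinder vertices, and distinct
    hulls have finite intersection. *)
Lemma Tc_almost_acylindrical : almost_k_acylindrical 2 Tc.
Proof.
have main (S : set G) (Y Y' : V1 R T) : Y <> Y' -> (forall g, S g -> act g (inr Y : Tc) = inr Y) ->
    (forall g, S g -> act g (inr Y' : Tc) = inr Y') -> finite_set S.
  move=> YY' SY SY'; apply: contrapT => iS; apply: YY'.
  have [E [hullE EY [u [v uvE]]]] := on_cylinder_V1 Y.
  have [E' [hullE' EY' [u' [v' uvE']]]] := on_cylinder_V1 Y'.
  have EE : E = E'.
    apply: (hull_uniq hullE hullE' iS); [rewrite -(vstab_V1 hullE EY uvE)|rewrite -(vstab_V1 hullE' EY' uvE')].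
      exact: SY.
    exact: SY'.
  by apply: (@V1_inj _ _ (u, v)); [rewrite EY|rewrite EY' -EE].
move=> [x|Y] p y.
  case: p => [|[?|Y] p]; [by []|by move=> [[]]|].
  case: p => [|[x1|?] p]; [by []| |by move=> [_ [[]]]].
  case: p => [|[?|Y'] p]; [by []|by move=> [_ [_ [[]]]]|].
  move=> _ np _; apply: (main _ Y Y') => [E|g hg|g hg].
  - have [_ np1] := (NoDup_cons_iff _ _).1 np; have [nY _] := (NoDup_cons_iff _ _).1 np1.
    by apply: nY; right; left; rewrite E.
  - by apply: hg; right; left.
  - by apply: hg; right; right; right; left.
case: p => [|[x1|?] p]; [by []| |by move=> [[]]].
case: p => [|[?|Y'] p]; [by []|by move=> [_ [[]]]|].
move=> _ np _; apply: (main _ Y Y') => [E|g hg|g hg].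
- have [nY _] := (NoDup_cons_iff _ _).1 np.
  by apply: nY; right; left; rewrite E.
- by apply: hg; left.
- by apply: hg; right; right; left.
Qed.

(** By [equivariant_map] it is enough that hulls of cylinders fix points of [T']. Each contains an
    infinite edge stabilizer, elliptic in [T']; this spreads to the hull by finite index or, after
    conjugation into [H i], by smallness. *)
Lemma Tc_dominates (T' : gGraph G) : (forall i, small (H i)) -> is_gtree T' ->
  almost_acylindrical T' -> dominates T T' -> dominates Tc T'.
Proof.
move=> smH hT' [k ak] [f fE]; have [_ conn' acyclic' noinv'] := hT'.
have fix_f v : vstab v `<=` vstab (f v) by move=> g gv; rewrite /vstab /= -fE gv.
apply: equivariant_map => -[x|Y]; first by exists (f (proj1_sig x)); rewrite vstab_V0.
have [E [hullE EY [u [v [uv uvE]]]]] := on_cylinder_V1 Y.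
rewrite (vstab_V1 hullE EY (conj uv uvE : cylinder E (u, v))).
have [iuv _] := hE uv; have uf : estab u v `<=` vstab (f u) by move=> g [/fix_f].
have [_ _ _ _ [[h vE]|[i [g Eg]]]] := hullE.
  exact: vgen_elliptic hT' (hull_subgroup hullE) vE (estab_subgroup u v) iuv uvE uf.
have [|||w Hw] := @small_elliptic _ _ conn' acyclic' noinv' (H i) (conjs (estab u v) g^-1)
  (act g (f u)) k (hsub i) (smH i) ak (conjs_subgroup _ (estab_subgroup u v)).
- by rewrite -(conjsK (H i) g) -Eg; apply: conjs_mono.
- exact: conjs_infinite.
- by rewrite vstab_act; apply: conjs_mono.
exists (act g^-1 w); rewrite Eg vstab_act invgK; exact: conjs_mono.
Qed.

End Cylinders.

Theorem proposition6p2 (G : groupType) (n : nat) (H : 'I_n -> set G)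
  (hG : finitely_generated (@setT G))
  (hHsub : forall i, subgroup (H i))
  (hHfg : forall i, finitely_generated (H i))
  (hHends : forall i, one_ended (H i))
  (hrel : relatively_hyperbolic H)
  (T : gGraph G) (hT : is_gtree T)
  (hE : forall u v : T, adj u v -> infinite_elementary H (estab u v)) :
  let Tc := tree_of_cylinders H T in
  [/\ (* T_c is a tree *)
      is_gtree Tc,
      (* (1) *)
      (forall p q : Tc, adj p q -> infinite_elementary H (estab p q)) /\
      is_giso (@to_collapsed G n H T),
      (* (2) *)
      [/\ forall A : set G, ~ elementary H A ->
            ((exists v : T, A = vstab v) <-> (exists p : Tc, A = vstab p)),
          forall A : set G, subgroup A ->
            (elliptic Tc A <-> elliptic T A \/ parabolic H A)
        & same_deformation_space Tc T <->
          (forall A : set G, parabolic H A -> elliptic T A)]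
    & (* (3) *)
      almost_k_acylindrical 2 Tc /\
      ((forall i, small (H i)) ->
        forall T' : gGraph G, is_gtree T' -> almost_acylindrical T' ->
          dominates T T' -> dominates Tc T')].
Proof.
move=> Tc; split; [exact: (Tc_gtree hHends hrel hT hE)| | |].
- by split; [apply: Tc_edge_stabilizer|apply: to_collapsed_iso].
- have ell := elliptic_Tc hHends hrel hT hE.
  split; [by move=> A; apply: nonelementary_stabilizers|exact: ell|].
  split=> [h A pA|h A sA]; first by apply/(h A pA.1)/(ell A pA.1); right.
  split=> [/(ell A sA)[//|]|eA]; first exact: h.
  by apply/(ell A sA); left.
- split; first exact: Tc_almost_acylindrical.
  by move=> smH T' hT'; apply: Tc_dominates.
Qed.
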